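(* Let $A$ be an arbitrary $2\times 2$ real expansive matrix, let $\mathcal{D}=\{A^k\mid k\in\mathbb{Z}\}$, let $C$ be a foldable figure in $\mathbb{R}^2$ containing the origin $0$ in its interior, and let $\widetilde{\mathcal{W}}$ be the affine Weyl group associated with $C$. Then there exist a full rank lattice $\widetilde{\Gamma}\subset\mathbb{R}^2$ and a measurable set $W\subset\mathbb{R}^2$ that is a three-way tiling set for $\widetilde{\Gamma}$, $\widetilde{\mathcal{W}}$ and $\mathcal{D}$, that is, each of the families $$\{W+\gamma\mid \gamma\in\widetilde{\Gamma}\},\qquad \{w\,W\mid w\in\widetilde{\mathcal{W}}\},\qquad \{A^kW\mid k\in\mathbb{Z}\}$$ is a measurable tiling of $\mathbb{R}^2$. Hence $W$ is simultaneously a $(\mathcal{D},\widetilde{\Gamma})$-dilation-translation wavelet set and a $(\mathcal{D},\widetilde{\mathcal{W}})$-dilation-reflection wavelet set. In particular, $(\widetilde{\mathcal{W}},\widetilde{\Gamma},\mathcal{D})$ is an allowable triple.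
   Context: A real $n\times n$ matrix $A$ is expansive if all its (complex) eigenvalues have absolute value $>1$. A full rank lattice in $\mathbb{R}^n$ is a set $\{\sum_i k_i b_i\mid k_i\in\mathbb{Z}\}$ with $\{b_1,\dots,b_n\}$ a basis of $\mathbb{R}^n$; it is identified with the group of translations by its vectors. For a countable group $G$ acting on $\mathbb{R}^n$, $\{gW\mid g\in G\}$ is a measurable tiling of $\mathbb{R}^n$ if the sets $gW$, $g\in G$, are pairwise disjoint up to Lebesgue null sets and their union is $\mathbb{R}^n$ up to a Lebesgue null set. Foldable figures and affine Weyl groups. A compact connected subset $F$ of $\mathbb{R}^n$ is a foldable figure if there exists a finite set $\mathcal{S}$ of affine hyperplanes that cuts $F$ into finitely many congruent subfigures $F_1,\dots,F_m$, each similar to $F$, so that reflection in any of the cutting hyperplanes in $\mathcal{S}$ bounding $F_k$ takes it into some $F_\ell$. Foldable figures are, up to translation, exactly the compact, connected, convex fundamental domains of affine Weyl groups: the group $\widetilde{\mathcal{W}}$ generated by the reflections about the bounding hyperplanes of a foldable figure $C$ is (after a translation moving a suitable vertex of $C$ to the origin) the affine Weyl group of some root system $R$, and has $C$ as a fundamental domain. This $\widetilde{\mathcal{W}}$ is the affine Weyl group associated with $C$. Here a root system $R$ in $\mathbb{R}^n$ is a finite set of nonzero vectors spanning $\mathbb{R}^n$ such that, with $r^\vee=2r/\langle r,r\rangle$ and $\rho_r(x)=x-\langle x,r\rangle r^\vee$: for $r\in R$, $\alpha r\in R$ iff $\alpha=\pm1$; $\rho_r(R)=R$ for all $r\in R$;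 $\langle s,r^\vee\rangle\in\mathbb{Z}$ for all $r,s\in R$ ($R$ may be reducible). The affine Weyl group of $R$ is the group generated by the reflections $\rho_{r,k}(x)=\rho_r(x)+k\,r^\vee$ about the hyperplanes $\{x\mid \langle x,r\rangle=k\}$, $r\in R$, $k\in\mathbb{Z}$. Congruence. For a discrete group $G$ acting on $\mathbb{R}^n$, measurable sets $\Omega,\Sigma$ are $G$-congruent if there are a subset $I\subset G$ and measurable partitions (up to null sets) $\{\Omega_g\}_{g\in I}$ of $\Omega$ and $\{\Sigma_g\}_{g\in I}$ of $\Sigma$ with $g\Omega_g=\Sigma_g$ for all $g\in I$. Wavelet sets. A measurable set $W$ is a $(\mathcal{D},\widetilde{\Gamma})$-dilation-translation wavelet set if $\{A^kW\mid k\in\mathbb{Z}\}$ and $\{W+\gamma\mid\gamma\in\widetilde{\Gamma}\}$ are both measurable tilings of $\mathbb{R}^n$. When $0$ is an interior point of $C$, a measurable set $W$ is a $(\mathcal{D},\widetilde{\mathcal{W}})$-dilation-reflection wavelet set if $W$ is $\widetilde{\mathcal{W}}$-congruent to $C$ and $\{A^kW\mid k\in\mathbb{Z}\}$ is a measurable tiling of $\mathbb{R}^n$. Allowable triples. The triple $(\widetilde{\mathcal{W}},\widetilde{\Gamma},\mathcal{D})$ is allowable if there exists a measurable set $W$ which is (1) $\widetilde{\mathcal{W}}$-congruent to $C$; (2) a measurable tiling set of $\mathbb{R}^n$ under $\mathcal{D}=\{A^k\mid k\in\mathbb{Z}\}$; and (3) $\widetilde{\Gamma}$-congruent to the fundamental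 parallelepiped $\{\sum_i t_ib_i\mid 0\le t_i<1\}$ of $\widetilde{\Gamma}$, where $\{b_1,\dots,b_n\}$ is a basis generating $\widetilde{\Gamma}$. *)

(* Defs.v *)
From mathcomp Require Import all_boot all_order all_algebra.
From mathcomp Require Import complex.
From mathcomp Require Import all_classical all_reals all_analysis.
From mathcomp Require Import measurable_realfun.

Set Implicit Arguments.
Unset Strict Implicit.
Unset Printing Implicit Defensive.

Import Order.TTheory GRing.Theory Num.Theory.
Import numFieldNormedType.Exports.

Local Open Scope classical_set_scope.
Local Open Scope ring_scope.

(** * Euclidean geometry of column vectors *)

(* The topology on ['cV[R]_n] comes from the sup norm; it is the Euclidean one,
   but [`|x|] is not the Euclidean norm, hence [enorm]. *)
Definition dotcv (R : realType) (n : nat) (u v : 'cV[R]_n) : R :=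
  \sum_(i < n) u i ord0 * v i ord0.

Definition enorm (R : realType) (n : nat) (u : 'cV[R]_n) : R :=
  Num.sqrt (dotcv u u).

Definition similitude (R : realType) (n : nat) (r : R)
    (f : 'cV[R]_n -> 'cV[R]_n) : Prop :=
  forall x y, enorm (f x - f y) = r * enorm (x - y).

Definition congruent_figures (R : realType) (n : nat)
    (P Q : set 'cV[R]_n) : Prop :=
  exists2 f, similitude 1 f & f @` P = Q.

Definition similar_figures (R : realType) (n : nat)
    (P Q : set 'cV[R]_n) : Prop :=
  exists r : R, 0 < r /\ exists2 f, similitude r f & f @` P = Q.

(** * Affine hyperplanes and reflections *)

(* A pair [h = (a, c)] with [a != 0] encodes the hyperplane [<x, a> = c];
   the condition [a != 0] is stated wherever hyperplanes are quantified over. *)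
Definition hyperplane (R : realType) (n : nat) (h : 'cV[R]_n * R) :
    set 'cV[R]_n :=
  [set x | dotcv x h.1 = h.2].

Definition reflection (R : realType) (n : nat) (h : 'cV[R]_n * R)
    (x : 'cV[R]_n) : 'cV[R]_n :=
  x - (2 * (dotcv x h.1 - h.2) / dotcv h.1 h.1) *: h.1.

(* The hyperplane contains a facet of P: P lies in one of its closed
   half-spaces and contains a nonempty relatively open piece of it. *)
Definition bounding (R : realType) (n : nat) (P : set 'cV[R]_n)
    (h : 'cV[R]_n * R) : Prop :=
  ((forall x, P x -> dotcv x h.1 <= h.2) \/
   (forall x, P x -> h.2 <= dotcv x h.1)) /\
  exists U : set 'cV[R]_n,
    [/\ open U, hyperplane h `&` U !=set0 & hyperplane h `&` U `<=` P].

(** * Foldable figures *)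

Definition cut_locus (R : realType) (n : nat) (S : seq ('cV[R]_n * R)) :
    set 'cV[R]_n :=
  [set x | exists2 h, h \in S & hyperplane h x].

(* The open cell of the arrangement S containing x, for x off the cut locus *)
Definition cell (R : realType) (n : nat) (S : seq ('cV[R]_n * R))
    (x : 'cV[R]_n) : set 'cV[R]_n :=
  [set y | forall h, h \in S ->
     0 < (dotcv x h.1 - h.2) * (dotcv y h.1 - h.2)].

Definition subfigure (R : realType) (n : nat) (S : seq ('cV[R]_n * R))
    (F : set 'cV[R]_n) : set (set 'cV[R]_n) :=
  [set closure (F `&` cell S x) | x in F `\` cut_locus S].

(* There are finitely many subfigures because S is finite.  There must be at
   least two: with the empty S every compact connected set would be foldable. *)
Definition foldable (R : realType) (n : nat) (F : set 'cV[R]_n) : Prop :=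
  [/\ compact F, connected F &
   exists S : seq ('cV[R]_n * R),
     [/\ forall h, h \in S -> h.1 != 0,
         exists P Q, [/\ subfigure S F P, subfigure S F Q & P <> Q],
         forall P Q, subfigure S F P -> subfigure S F Q ->
           congruent_figures P Q,
         forall P, subfigure S F P -> similar_figures P F &
         forall P h, subfigure S F P -> h \in S -> bounding P h ->
           exists2 Q, subfigure S F Q & reflection h @` P `<=` Q]].

(** * Groups of transformations *)

Definition transformation_group (T : Type) (G : set (T -> T)) : Prop :=
  [/\ G id,
      forall f g, G f -> G g -> G (f \o g) &
      forall f, G f -> exists g, [/\ G g, cancel f g & cancel g f]].

Definition generated_group (T : Type) (S : set (T -> T)) : set (T -> T) :=
  smallest (@transformation_group T) S.

Definition affine_weyl_group (R : realType) (n : nat) (C : set 'cV[R]_n) :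
    set ('cV[R]_n -> 'cV[R]_n) :=
  generated_group
    [set reflection h | h in [set h | h.1 != 0 /\ bounding C h]].

Definition translations (R : realType) (n : nat) (Gamma : set 'cV[R]_n) :
    set ('cV[R]_n -> 'cV[R]_n) :=
  [set (fun x => x + g) | g in Gamma].

Definition dilations (R : realType) (n : nat) (A : 'M[R]_n.+1) :
    set ('cV[R]_n.+1 -> 'cV[R]_n.+1) :=
  [set (fun x => (A ^ k) *m x) | k in [set: int]].

Definition expansive (R : realType) (n : nat) (A : 'M[R]_n) : Prop :=
  forall z : complex R, eigenvalue (map_mx (real_complex R) A) z -> 1 < `|z|.

(** * Lattices *)

(* The columns of B form a basis of [R^n] generating Gamma *)
Definition lattice_basis (R : realType) (n : nat) (B : 'M[R]_n)
    (Gamma : set 'cV[R]_n) : Prop :=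
  B \in unitmx /\
  Gamma = [set \sum_(i < n) (k i)%:~R *: col i B | k in [set: 'I_n -> int]].

Definition full_rank_lattice (R : realType) (n : nat)
    (Gamma : set 'cV[R]_n) : Prop :=
  exists B : 'M[R]_n, lattice_basis B Gamma.

Definition parallelepiped (R : realType) (n : nat) (B : 'M[R]_n) :
    set 'cV[R]_n :=
  [set \sum_(i < n) t i *: col i B |
     t in [set t : 'I_n -> R | forall i, 0 <= t i < 1]].

(** * Lebesgue measure in the plane *)

Definition cv2 (R : realType) (p : R * R) : 'cV[R]_2 :=
  \col_i (if i == ord0 then p.1 else p.2).

Definition plane_measure (R : realType) :
    set (measurableTypeR R * measurableTypeR R) -> \bar R :=
  (@lebesgue_measure R \x @lebesgue_measure R)%E.

Definition lebesgue_null (R : realType) (N : set 'cV[R]_2) : Prop :=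
  (@plane_measure R).-negligible (@cv2 R @^-1` N).

(* Measurability with respect to the completion of the Borel sigma-algebra *)
Definition lebesgue_measurable (R : realType) (E : set 'cV[R]_2) : Prop :=
  completed_algebra_gen (@plane_measure R) (@cv2 R @^-1` E).

(** * Tilings, congruence, wavelet sets *)

Definition ae_decomposition (R : realType) (I : Type) (D : set I)
    (E : I -> set 'cV[R]_2) (X : set 'cV[R]_2) : Prop :=
  [/\ forall i j, D i -> D j -> i <> j -> lebesgue_null (E i `&` E j),
      lebesgue_null (X `\` \bigcup_(i in D) E i) &
      lebesgue_null (\bigcup_(i in D) E i `\` X)].

Definition measurable_tiling (R : realType) (G : set ('cV[R]_2 -> 'cV[R]_2))
    (W : set 'cV[R]_2) : Prop :=
  ae_decomposition G (fun g => g @` W) [set: 'cV[R]_2].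

Definition measurable_partition (R : realType) (I : Type) (D : set I)
    (E : I -> set 'cV[R]_2) (X : set 'cV[R]_2) : Prop :=
  (forall i, D i -> lebesgue_measurable (E i)) /\ ae_decomposition D E X.

Definition congruent_by (R : realType) (G : set ('cV[R]_2 -> 'cV[R]_2))
    (Omega Sigma : set 'cV[R]_2) : Prop :=
  exists (I : set ('cV[R]_2 -> 'cV[R]_2))
         (Omega_ Sigma_ : ('cV[R]_2 -> 'cV[R]_2) -> set 'cV[R]_2),
    [/\ I `<=` G,
        measurable_partition I Omega_ Omega,
        measurable_partition I Sigma_ Sigma &
        forall g, I g -> g @` Omega_ g = Sigma_ g].

Definition dilation_translation_wavelet_set (R : realType) (A : 'M[R]_2)
    (Gamma W : set 'cV[R]_2) : Prop :=
  [/\ lebesgue_measurable W,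
      measurable_tiling (dilations A) W &
      measurable_tiling (translations Gamma) W].

Definition dilation_reflection_wavelet_set (R : realType) (A : 'M[R]_2)
    (C W : set 'cV[R]_2) : Prop :=
  [/\ lebesgue_measurable W,
      congruent_by (affine_weyl_group C) W C &
      measurable_tiling (dilations A) W].

(* Congruence with the parallelepiped does not depend on the basis of Gamma. *)
Definition allowable (R : realType) (C Gamma : set 'cV[R]_2) (A : 'M[R]_2) :
    Prop :=
  exists W : set 'cV[R]_2,
    [/\ lebesgue_measurable W,
        congruent_by (affine_weyl_group C) W C,
        measurable_tiling (dilations A) W &
        forall B, lattice_basis B Gamma ->
          congruent_by (translations Gamma) W (parallelepiped B)].

(* Main.v *)
(** A foldable figure is similar to each of its cells, and reflections carry these onto
    one another; zooming into cells shows that the figure is a convex polygon with angles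
    [pi / m].  So it is a rectangle or a triangle with angles [pi/3, pi/3, pi/3],
    [pi/2, pi/4, pi/4] or [pi/2, pi/3, pi/6], onto which its Weyl group folds the plane.

    Such a figure yields a bounded neighbourhood [K] of [0] which tiles the plane under the
    Weyl group and under a lattice [Gamma] having a translation [c] in common with it.  For a
    rectangle [K] is the figure; for a triangle a corner of half size, chosen away from [0],
    is turned about its vertex or folded over a side, and the result is a rearrangement of a
    parallelogram with area that of the triangle.

    A norm that [A] expands gives a dilation tile [E], a shell around [0].  Some [A^-k E] lies
    in [K], and some translate [K + n c] lies in some [A^l E].  Exchanging [K] and [E] along
    these two injections as in the Schroeder-Bernstein theorem only moves pieces of [K] by
    [n c] and pieces of [E] by powers of [A], so that the result tiles in all three ways. *)

Require Import Defs.
From mathcomp Require Import all_boot all_order all_algebra.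
From mathcomp Require Import complex.
From mathcomp Require Import all_classical all_reals all_analysis.
From mathcomp Require Import measurable_realfun.
From mathcomp Require Import ring lra zify.
Import Order.TTheory GRing.Theory Num.Theory.
Import numFieldNormedType.Exports.
Set Implicit Arguments.
Unset Strict Implicit.
Unset Printing Implicit Defensive.
Local Open Scope classical_set_scope.
Local Open Scope ring_scope.


(** * Affine maps and null sets of the plane *)

Section coordinates.
Context {R : realType}.
Implicit Types (u v x y : 'cV[R]_2) (f g : 'cV[R]_2 -> 'cV[R]_2).

(** Foldability asks for no convexity, so the polygon has to be extracted from self-similarity: near
    an interior point the figure is everything, its subfigures there are cut out by finitely many
    lines, and pulling such a subfigure back to the whole figure magnifies the picture by [1 / r].
    Repeating this gives a window larger than the figure. Angles come from the same maps: a corner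
    is carried by a composition of maps onto subfigures to an interior point, where reflected copies
    of it must close up along a cutting line, so that an integer multiple of the angle is [pi]. That
    the figure is a fundamental domain is then shown in coordinates: explicit functions invariant
    under its mirrors separate its points, up to a null set, and an explicit chain of mirrors leads
    every point into it. The exchange moves pieces of [K] by multiples of one vector [c], which must
    be translations of both groups at once; hence the vector in [common_tile]. The corner cut from a
    triangle must leave [0] in the interior of what remains, and this decides the vertex at which to
    cut. *)

Definition px u : R := u ord0 ord0.
Definition py u : R := u (lift ord0 ord0) ord0.

Lemma px_cv2 (p : R * R) : px (cv2 p) = p.1.
Proof. by rewrite /px mxE. Qed.
Lemma py_cv2 (p : R * R) : py (cv2 p) = p.2.
Proof. by rewrite /py mxE. Qed.
Lemma pxD u v : px (u + v) = px u + px v. Proof. by rewrite /px mxE. Qed.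
Lemma pyD u v : py (u + v) = py u + py v. Proof. by rewrite /py mxE. Qed.
Lemma pxN u : px (- u) = - px u. Proof. by rewrite /px mxE. Qed.
Lemma pyN u : py (- u) = - py u. Proof. by rewrite /py mxE. Qed.
Lemma pxZ a u : px (a *: u) = a * px u. Proof. by rewrite /px mxE. Qed.
Lemma pyZ a u : py (a *: u) = a * py u. Proof. by rewrite /py mxE. Qed.
Lemma px0 : px 0 = 0. Proof. by rewrite /px mxE. Qed.
Lemma py0 : py 0 = 0. Proof. by rewrite /py mxE. Qed.
Definition pE := (px_cv2, py_cv2, pxD, pyD, pxN, pyN, pxZ, pyZ, px0, py0).

Lemma plane_ext u v : px u = px v -> py u = py v -> u = v.
Proof.
move=> hx hy; apply/colP => i; case: (unliftP ord0 i) => [j ->|-> //].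
by rewrite (ord1 j).
Qed.

Lemma dotE u v : dotcv u v = px u * px v + py u * py v.
Proof. by rewrite /dotcv big_ord_recl big_ord1. Qed.

Lemma dotcvC u v : dotcv u v = dotcv v u.
Proof. by rewrite !dotE mulrC [X in _ + X]mulrC. Qed.

Definition affine_bij f := exists a b c d e g : R, a * d - b * c != 0 /\
  forall x, f x = cv2 (a * px x + b * py x + e, c * px x + d * py x + g).

Lemma affine_bij_id : affine_bij id.
Proof.
exists 1, 0, 0, 1, 0, 0; split=> [|x]; first by rewrite mulr1 mulr0 subr0 oner_neq0.
by apply: plane_ext; rewrite !pE /=; ring.
Qed.

Lemma affine_bij_comp f g : affine_bij f -> affine_bij g -> affine_bij (f \o g).
Proof.
move=> [a [b [c [d [e [h [D F]]]]]]] [a' [b' [c' [d' [e' [h' [D' F']]]]]]].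
exists (a * a' + b * c'), (a * b' + b * d'), (c * a' + d * c'),
  (c * b' + d * d'), (a * e' + b * h' + e), (c * e' + d * h' + h); split.
  have -> : (a * a' + b * c') * (c * b' + d * d') -
    (a * b' + b * d') * (c * a' + d * c') = (a * d - b * c) * (a' * d' - b' * c').
    by ring.
  by rewrite mulf_neq0.
by move=> x /=; rewrite F F' !pE /=; congr (cv2 (_, _)); ring.
Qed.

Lemma affine_bij_inv f : affine_bij f ->
  exists g, [/\ affine_bij g, cancel f g & cancel g f].
Proof.
move=> [a [b [c [d [e [h [D F]]]]]]].
pose D1 := (a * d - b * c)^-1.
have DD : D1 * (a * d - b * c) = 1 by rewrite mulVf.
exists (fun x => cv2 (D1 * d * px x + - D1 * b * py x + D1 * (b * h - d * e),
   - D1 * c * px x + D1 * a * py x + D1 * (c * e - a * h))); split.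
- exists (D1 * d), (- D1 * b), (- D1 * c), (D1 * a), (D1 * (b * h - d * e)),
    (D1 * (c * e - a * h)); split=> //.
  have -> : D1 * d * (D1 * a) - - D1 * b * (- D1 * c) = D1 * (D1 * (a * d - b * c)).
    by ring.
  by rewrite DD mulr1 invr_eq0.
- move=> x; rewrite F; apply: plane_ext; rewrite !pE /=.
    by transitivity (D1 * (a * d - b * c) * px x); [ring | rewrite DD mul1r].
  by transitivity (D1 * (a * d - b * c) * py x); [ring | rewrite DD mul1r].
- move=> x; rewrite F; apply: plane_ext; rewrite !pE /=.
    transitivity (D1 * (a * d - b * c) * px x - (D1 * (a * d - b * c) - 1) * e).
      by ring.
    by rewrite DD; ring.
  transitivity (D1 * (a * d - b * c) * py x - (D1 * (a * d - b * c) - 1) * h).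
    by ring.
  by rewrite DD; ring.
Qed.

Lemma image_cancel (T U : Type) (f : T -> U) (g : U -> T) (A : set T) :
  cancel f g -> cancel g f -> f @` A = g @^-1` A.
Proof.
move=> fK gK; apply/seteqP; split=> [_ [x Ax <-]|y Ay]; rewrite /= ?fK //.
by exists (g y).
Qed.

End coordinates.

(** * Null sets of the line under affine maps *)

Section line.
Context {R : realType}.
Notation mu := (@lebesgue_measure R).

Lemma measurable_affine1 (a b : R) :
  measurable_fun setT ((fun x => a * x + b) : measurableTypeR R -> measurableTypeR R).
Proof.
apply: measurable_funD; last exact: measurable_cst.
by apply: measurable_funM => //; exact: measurable_cst.
Qed.

(** [|a|] times the pushforward of Lebesgue measure along [x -> a x + b] gives every half-open
    interval its length, so by uniqueness it is Lebesgue measure; preimages of null sets are then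
    null. *)
Lemma negligible_affine1 (a b : R) (N : set (measurableTypeR R)) : a != 0 ->
  mu.-negligible N -> mu.-negligible ((fun x => a * x + b) @^-1` N).
Proof.
move=> a0 [N0 [mN0 N00 NN]].
exists ((fun x => a * x + b) @^-1` N0); split; last by move=> x /= /NN.
  by rewrite -[X in measurable X]setTI; exact: measurable_affine1.
pose f := ((fun x => a * x + b) : measurableTypeR R -> measurableTypeR R).
have mf : measurable_fun setT f := measurable_affine1 a b.
have [nu nuE] : exists nu : {measure set (measurableTypeR R) -> \bar R},
    forall A, nu A = (`|a|%:E * mu (f @^-1` A))%E.
  pose nu' := mscale (NngNum (normr_ge0 a)) (pushforward mu f).
  by exists (nu' mf).
have munu : forall A, measurable A -> mu A = nu A.
  apply: lebesgue_measure_unique => _ [[c d] _ <-] /=.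
  rewrite nuE.
  have [a_lt0|a_gt0|/eqP] := ltgtP a 0; last by rewrite (negbTE a0).
  - have -> : f @^-1` `]c, d] = `[(d - b) / a, (c - b) / a[%classic.
      apply/seteqP; split=> x; rewrite /= !in_itv /= /f.
        by rewrite ler_ndivrMr // ltr_ndivlMr // => /andP[h1 h2]; apply/andP; split; lra.
      by rewrite ler_ndivrMr // ltr_ndivlMr // => /andP[h1 h2]; apply/andP; split; lra.
    rewrite !lebesgue_measure_itv /= !lte_fin ltr_nM2r ?invr_lt0 // ltrD2r.
    case: ifP => h; last by rewrite mule0.
    by rewrite -EFinB -EFinM ltr0_norm //; congr EFin; field.
  - have -> : f @^-1` `]c, d] = `](c - b) / a, (d - b) / a]%classic.
      apply/seteqP; split=> x; rewrite /= !in_itv /= /f.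
        by rewrite ler_pdivlMr // ltr_pdivrMr // => /andP[h1 h2]; apply/andP; split; lra.
      by rewrite ler_pdivlMr // ltr_pdivrMr // => /andP[h1 h2]; apply/andP; split; lra.
    rewrite !lebesgue_measure_itv /= !lte_fin ltr_pM2r ?invr_gt0 // ltrD2r.
    case: ifP => h; last by rewrite mule0.
    by rewrite -EFinB -EFinM gtr0_norm //; congr EFin; field.
have /= := munu _ mN0; rewrite N00 nuE => /esym/eqP.
by rewrite mule_eq0 eqe normr_eq0 (negbTE a0) /= => /eqP.
Qed.
End line.

(** * Null sets of the plane through their sections *)

Section plane_null.
Context {R : realType}.
Notation mu := (@lebesgue_measure R).
Notation T := (measurableTypeR R).
Notation mu2 := (mu \x mu)%E.

Lemma plane_null_xsection (N : set (T * T)) : measurable N ->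
  mu2 N = 0%E <-> {ae mu, forall x, mu (xsection N x) = 0%E}.
Proof.
move=> mN.
have mf : measurable_fun setT (mu \o xsection N) by exact: measurable_fun_xsection.
have := ae_eq_integral_abs mu measurableT mf.
rewrite (_ : integral _ _ _ = mu2 N); last first.
  by apply: eq_integral => x _; rewrite gee0_abs.
move=> [H1 H2]; split=> [/H1|H].
  by apply: filterS => x /= /(_ I).
by apply: H2; apply: filterS H => x Hx _.
Qed.

Lemma plane_null_ysection (N : set (T * T)) : measurable N ->
  mu2 N = 0%E <-> {ae mu, forall y, mu (ysection N y) = 0%E}.
Proof.
move=> mN.
have mf : measurable_fun setT (mu \o ysection N) by exact: measurable_fun_ysection.
have := ae_eq_integral_abs mu measurableT mf.
have E : (mu \x^ mu)%E N = mu2 N.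
  apply/esym; apply: product_measure_unique => // A B mA mB.
  exact: product_measure2E.
rewrite (_ : integral _ _ _ = mu2 N); last first.
  by rewrite -E; apply: eq_integral => x _; rewrite gee0_abs.
move=> [H1 H2]; split=> [/H1|H].
  by apply: filterS => x /= /(_ I).
by apply: H2; apply: filterS H => x Hx _.
Qed.

Definition affine2 (a b c d e g : R) (p : T * T) : T * T :=
  (a * p.1 + b * p.2 + e, c * p.1 + d * p.2 + g).

Lemma measurable_affine2 a b c d e g : measurable_fun setT (affine2 a b c d e g).
Proof.
apply/measurable_fun_pairP; split => /=.
  by do ![apply: measurable_funD|apply: measurable_funM|exact: measurable_cst
    |exact: measurable_fst|exact: measurable_snd].
by do ![apply: measurable_funD|apply: measurable_funM|exact: measurable_cst
    |exact: measurable_fst|exact: measurable_snd].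
Qed.

Lemma measurable_affine2_pre a b c d e g (N : set (T * T)) : measurable N ->
  measurable (affine2 a b c d e g @^-1` N).
Proof. by move=> mN; rewrite -[X in measurable X]setTI; exact: measurable_affine2. Qed.

Lemma ae_affine1 (a b : R) (P : T -> Prop) : a != 0 ->
  {ae mu, forall x : T, P x} -> {ae mu, forall x : T, P (a * x + b)}.
Proof. by move=> a0 /(negligible_affine1 b a0). Qed.

Lemma null_affine1 (a b : R) (A : set T) : a != 0 -> measurable A -> 
  mu A = 0%E -> mu ((fun x => a * x + b) @^-1` A) = 0%E.
Proof.
move=> a0 mA A0; apply/negligibleP.
  by rewrite -[X in measurable X]setTI; exact: measurable_affine1.
by apply: negligible_affine1 => //; apply/negligibleP.
Qed.

(** A triangular map acts on each horizontal section by an affine map of the line, and on the set of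
    sections by another one, so Fubini reduces the claim to the one-dimensional case used twice. *)
Lemma null_upper (a b d e g : R) (N : set (T * T)) : a != 0 -> d != 0 -> measurable N ->
  mu2 N = 0%E -> mu2 (affine2 a b 0 d e g @^-1` N) = 0%E.
Proof.
move=> a0 d0 mN /(plane_null_ysection mN) H.
apply/plane_null_ysection; first exact: measurable_affine2_pre.
have := ae_affine1 g d0 H; apply: filterS => y.
move=> /(@null_affine1 a (b * y + e) _ a0 (measurable_ysection _ mN)) <-.
congr (mu _); apply/seteqP; split=> x /=; rewrite /ysection /= !inE /affine2 /=;
  by rewrite mul0r add0r addrA.
Qed.

Lemma null_lower (a c d e g : R) (N : set (T * T)) : a != 0 -> d != 0 -> measurable N ->
  mu2 N = 0%E -> mu2 (affine2 a 0 c d e g @^-1` N) = 0%E.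
Proof.
move=> a0 d0 mN /(plane_null_xsection mN) H.
apply/plane_null_xsection; first exact: measurable_affine2_pre.
have := ae_affine1 e a0 H; apply: filterS => x.
move=> /(@null_affine1 d (c * x + g) _ d0 (measurable_xsection _ mN)) <-.
congr (mu _); apply/seteqP; split=> y /=; rewrite /xsection /= !inE /affine2 /=;
  by rewrite mul0r addr0 addrA (addrC (d * y)).
Qed.

(** When [a] is nonzero, Gaussian elimination factors the map into an upper triangular one followed
    by a lower triangular one. When [a = 0], a shear adds the second column to the first, and the
    new corner entry [b] is nonzero by the determinant. *)
Lemma null_affine2 (a b c d e g : R) (N : set (T * T)) : a * d - b * c != 0 -> measurable N ->
  mu2 N = 0%E -> mu2 (affine2 a b c d e g @^-1` N) = 0%E.
Proof.
have main a' b' c' d' e' g' (M : set (T * T)) : a' != 0 -> a' * d' - b' * c' != 0 ->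
    measurable M -> mu2 M = 0%E -> mu2 (affine2 a' b' c' d' e' g' @^-1` M) = 0%E.
  move=> a0 D mM M0.
  have D' : d' - b' * c' / a' != 0.
    by have -> : d' - b' * c' / a' = (a' * d' - b' * c') / a';
       [field | rewrite mulf_neq0 ?invr_neq0].
  rewrite (_ : _ @^-1` _ = affine2 a' b' 0 (d' - b' * c' / a') e' (g' - c' / a' * e') @^-1`
    (affine2 1 0 (c' / a') 1 0 0 @^-1` M)); last first.
    rewrite /preimage; apply: eq_set => -[x y]; congr (M _); rewrite /affine2 /=.
    by congr (_, _); field.
  by apply: null_upper => //; [exact: measurable_affine2_pre
    | apply: null_lower => //; exact: oner_neq0].
move=> D mN N0; have [a0|] := eqVneq a 0; last by move=> a0; exact: main.
rewrite (_ : _ @^-1` _ = affine2 1 0 (-1) 1 0 0 @^-1`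
    (affine2 (a + b) b (c + d) d e g @^-1` N)); last first.
  rewrite /preimage; apply: eq_set => -[x y]; congr (N _); rewrite /affine2 /=.
  by congr (_, _); ring.
apply: null_lower; rewrite ?oner_neq0 //; first exact: measurable_affine2_pre.
apply: main => //.
  by move: D; rewrite a0 mul0r !add0r oppr_eq0 mulf_eq0 negb_or => /andP[].
by have -> : (a + b) * d - b * (c + d) = a * d - b * c by ring.
Qed.

End plane_null.

(** * Lebesgue measurable sets of the plane *)

Section lebesgue_plane.
Context {R : realType}.
Notation mu := (@lebesgue_measure R).
Notation T := (measurableTypeR R).
Notation mu2 := (mu \x mu)%E.
Implicit Types (E F N : set 'cV[R]_2) (f : 'cV[R]_2 -> 'cV[R]_2).

Lemma null_set0 : lebesgue_null (set0 : set 'cV[R]_2).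
Proof. by rewrite /lebesgue_null preimage_set0; exact: (@negligible_set0 _ _ _ mu2). Qed.

Lemma nullS E F : E `<=` F -> lebesgue_null F -> lebesgue_null E.
Proof. by move=> EF; apply: (@negligibleS _ _ _ mu2) => x; exact: EF. Qed.

Lemma nullU E F : lebesgue_null E -> lebesgue_null F -> lebesgue_null (E `|` F).
Proof. exact: (@negligibleU _ _ _ mu2). Qed.

Lemma null_affine f N : affine_bij f -> lebesgue_null N -> lebesgue_null (f @` N).
Proof.
move=> /affine_bij_inv [h [[a [b [c [d [e [g [D F]]]]]]] fK hK]] [M [mM M0 NM]].
exists (affine2 a b c d e g @^-1` M); split.
- exact: measurable_affine2_pre.
- exact: null_affine2.
- rewrite (image_cancel _ fK hK) => -[x y] /= Nh; apply: NM.
  by rewrite /= /affine2 /=; move: Nh; rewrite F !pE.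
Qed.

(** The vertical axis is the product of a point and the line, hence null, and every line is an
    affine image of it; the two cases only choose the coordinate to solve for. *)
Lemma null_line (n : 'cV[R]_2) (c : R) : n != 0 ->
  lebesgue_null [set x | dotcv x n = c].
Proof.
move=> n0.
have yaxis : lebesgue_null [set x : 'cV[R]_2 | px x = 0].
  have m0 : measurable ([set 0] `*` setT : set (T * T)) by exact: measurableX.
  exists ([set 0] `*` setT); split=> //.
    rewrite [LHS]product_measure1E //.
    apply/eqP; rewrite mule_eq0; apply/orP; left; apply/eqP.
    exact: (@lebesgue_measure_set1 R 0).
  by move=> [x y]; rewrite /= pE.
have [x0|x0] := eqVneq (px n) 0.
  have y0 : py n != 0.
    by apply: contra_neq n0 => y0; apply: plane_ext; rewrite ?x0 ?y0 !pE.
  have af : affine_bij (fun z : 'cV[R]_2 =>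
      cv2 (0 * px z + 1 * py z + 0, 1 * px z + 0 * py z + c / py n)).
    exists 0, 1, 1, 0, 0, (c / py n); split=> //.
  apply: nullS (null_affine af yaxis) => z /= <-.
  exists (cv2 (py z - px z * px n / py n - py z, px z)); first by rewrite /= x0 !pE /=; ring.
  by apply: plane_ext; rewrite !pE /= ?dotE x0; field.
have af : affine_bij (fun z : 'cV[R]_2 =>
    cv2 (1 * px z + (- py n / px n) * py z + c / px n, 0 * px z + 1 * py z + 0)).
  exists 1, (- py n / px n), 0, 1, (c / px n), 0; split=> //; by rewrite mulr1 mulr0 subr0 oner_eq0.
apply: nullS (null_affine af yaxis) => z /= <-.
exists (cv2 (0, py z)); first by rewrite /= !pE.
by apply: plane_ext; rewrite !pE /= ?dotE; field.
Qed.

(** Squeezing between Borel sets that differ by a null set is symmetric under complement and passes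
    to countable unions and affine images, which a Borel set enlarged by a negligible set does less
    directly. *)
Lemma lmeasP E : lebesgue_measurable E <-> exists A B : set (T * T),
  [/\ measurable A, measurable B, A `<=` @cv2 R @^-1` E,
      @cv2 R @^-1` E `<=` B & mu2 (B `\` A) = 0%E].
Proof.
split=> [[A mA [N [N0 [mN0 N00 NN0]] <-]]|[A [B [mA mB AE EB BA]]]].
  exists A, (A `|` N0); split=> //; first exact: measurableU.
    by apply: setUS.
  rewrite setDUl setDv set0U; apply: (@subset_measure0 _ _ _ mu2 _ N0) => //.
  exact: measurableD.
exists A => //; exists (@cv2 R @^-1` E `\` A).
  exists (B `\` A); split=> //; first exact: measurableD.
  by move=> x [/EB].
by apply/seteqP; split=> x /=; [case=> [/AE|[]]|have [] := pselect (A x); tauto].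
Qed.

Lemma lmeas_null E : lebesgue_null E -> lebesgue_measurable E.
Proof. by move=> nE; exists set0 => //; exists (@cv2 R @^-1` E) => //; rewrite set0U. Qed.

Lemma lmeas_borel E : measurable (@cv2 R @^-1` E : set (T * T)) -> lebesgue_measurable E.
Proof.
move=> mE; apply/lmeasP; exists (@cv2 R @^-1` E), (@cv2 R @^-1` E); split=> //.
by rewrite setDv measure0.
Qed.

Lemma lmeasC E : lebesgue_measurable E -> lebesgue_measurable (~` E).
Proof.
move=> /lmeasP [A [B [mA mB AE EB BA]]]; apply/lmeasP; exists (~` B), (~` A).
split; [exact: measurableC|exact: measurableC| | |].
- by move=> x nB /EB.
- by move=> x nE /AE.
- by rewrite setDE setCK setIC -setDE.
Qed.

Lemma lmeas_bigcup (F : nat -> set 'cV[R]_2) :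
  (forall i, lebesgue_measurable (F i)) -> lebesgue_measurable (\bigcup_i F i).
Proof.
move=> mF; have /choice [A AP] : forall i, exists A : set (T * T) * set (T * T),
    [/\ measurable A.1, measurable A.2, A.1 `<=` @cv2 R @^-1` F i,
      @cv2 R @^-1` F i `<=` A.2 & mu2 (A.2 `\` A.1) = 0%E].
  by move=> i; have /lmeasP [A [B H]] := mF i; exists (A, B).
apply/lmeasP; exists (\bigcup_i (A i).1), (\bigcup_i (A i).2); split.
- by apply: bigcupT_measurable => i; have [] := AP i.
- by apply: bigcupT_measurable => i; have [] := AP i.
- by move=> x [i _ Ax]; exists i => //; have [_ _ + _ _] := AP i; apply.
- by move=> x [i _ Ax]; exists i => //; have [_ _ _ + _] := AP i; apply.
- have mm i : measurable ((A i).2 `\` (A i).1).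
    by have [? ? _ _ _] := AP i; exact: measurableD.
  apply: (@subset_measure0 _ _ _ mu2 _ (\bigcup_i ((A i).2 `\` (A i).1))).
  + by apply: measurableD; apply: bigcupT_measurable => i; have [] := AP i.
  + exact: bigcupT_measurable.
  + by move=> x [[i _ A2] nA]; exists i => //; split=> // A1; apply: nA; exists i.
  + apply/(@negligibleP _ _ _ mu2); first exact: bigcupT_measurable.
    apply: (@negligible_bigcup _ _ _ mu2) => i.
    by apply/(@negligibleP _ _ _ mu2) => //; have [] := AP i.
Qed.

Lemma lmeasU E F : lebesgue_measurable E -> lebesgue_measurable F ->
  lebesgue_measurable (E `|` F).
Proof.
move=> mE mF; rewrite -bigcup2E; apply: lmeas_bigcup => -[//|[//|i]] /=.
by apply: lmeas_null; exact: null_set0.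
Qed.

Lemma lmeasI E F : lebesgue_measurable E -> lebesgue_measurable F ->
  lebesgue_measurable (E `&` F).
Proof.
by move=> mE mF; rewrite -[_ `&` _]setCK setCI; apply/lmeasC/lmeasU; exact: lmeasC.
Qed.

Lemma lmeasD E F : lebesgue_measurable E -> lebesgue_measurable F ->
  lebesgue_measurable (E `\` F).
Proof. by move=> mE mF; apply: lmeasI => //; exact: lmeasC. Qed.

Lemma lmeas_affine f E : affine_bij f -> lebesgue_measurable E ->
  lebesgue_measurable (f @` E).
Proof.
move=> /affine_bij_inv [h [[a [b [c [d [e [g [D F]]]]]]] fK hK]].
move=> /lmeasP [A [B [mA mB AE EB BA]]]; apply/lmeasP.
have hE p : h (cv2 p) = cv2 (affine2 a b c d e g p) by rewrite F !pE.
exists (affine2 a b c d e g @^-1` A), (affine2 a b c d e g @^-1` B); split.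
- exact: measurable_affine2_pre.
- exact: measurable_affine2_pre.
- by rewrite (image_cancel _ fK hK) => p /AE /=; rewrite hE.
- by rewrite (image_cancel _ fK hK) => p /=; rewrite hE => /EB.
- by apply: (@null_affine2 R a b c d e g (B `\` A) D _ BA); exact: measurableD.
Qed.

(** Half-planes are the case without quadratic terms; unit balls of the norms built from [A] are
    complements of the case without linear ones. *)
Lemma lmeas_quadratic (a b c d e g k : R) : lebesgue_measurable
  [set x | a * px x ^+ 2 + b * (px x * py x) + c * py x ^+ 2 + d * px x + e * py x + g <= k].
Proof.
apply: lmeas_borel.
have -> : @cv2 R @^-1` [set x | a * px x ^+ 2 + b * (px x * py x) + c * py x ^+ 2 +
    d * px x + e * py x + g <= k] = (fun p : T * T => a * p.1 ^+ 2 + b * (p.1 * p.2) +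
    c * p.2 ^+ 2 + d * p.1 + e * p.2 + g) @^-1` `]-oo, k]%classic.
  by apply/seteqP; split=> -[x y] /=; rewrite !pE in_itv.
rewrite -[X in measurable X]setTI; apply: (_ : measurable_fun setT _) => //.
by do ![apply: measurable_funD|apply: measurable_funM|exact: measurable_cst
    |apply: measurable_funX|exact: measurable_fst|exact: measurable_snd].
Qed.

Lemma lmeas_halfplane (n : 'cV[R]_2) (c : R) : lebesgue_measurable [set x | dotcv x n <= c].
Proof.
have := lmeas_quadratic 0 0 0 (px n) (py n) 0 c.
congr lebesgue_measurable; apply/seteqP; split=> x /=; rewrite dotE;
  by rewrite !mul0r !add0r addr0 mulrC (mulrC (py n)).
Qed.

End lebesgue_plane.

(** * Tilings by groups of affine maps *)

Section tiles.
Context {R : realType}.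
Local Notation V := 'cV[R]_2.
Implicit Types (G : set (V -> V)) (X Y E : set V) (f g : V -> V).

Definition affine_group G :=
  transformation_group G /\ forall g, G g -> affine_bij g.

(** Only overlaps with [X] itself are tested; [tile_overlap] recovers all pairs by moving one of the
    two copies back to [X], as affine bijections preserve null sets. *)
Definition tile G X := (forall g, G g -> g <> id -> lebesgue_null (g @` X `&` X)) /\
  lebesgue_null (~` \bigcup_(g in G) (g @` X)).

Lemma agroup_inv G g : affine_group G -> G g -> exists h, [/\ G h, cancel g h & cancel h g].
Proof. by move=> [[_ _ +] _] Gg => /(_ g Gg). Qed.

Lemma agroup_comp G f g : affine_group G -> G f -> G g -> G (f \o g).
Proof. by move=> [[_ + _] _]; apply. Qed.

Lemma tile_overlap G X f g : affine_group G -> tile G X -> G f -> G g -> f <> g ->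
  lebesgue_null (f @` X `&` g @` X).
Proof.
move=> aG [T1 _] Gf Gg fg; have [h [Gh gK hK]] := agroup_inv aG Gg.
have hf : h \o f <> id.
  by move=> e; apply: fg; apply/funext => x; rewrite -[LHS]hK -[h _]/((h \o f) x) e.
have := null_affine (aG.2 g Gg) (T1 _ (agroup_comp aG Gh Gf) hf).
apply: nullS => _ [[x Xx <-] [y Xy yx]]; exists y; last by [].
by split=> //; exists x => //=; rewrite -yx gK.
Qed.

Lemma tile_tiling G X : affine_group G -> tile G X -> measurable_tiling G X.
Proof.
move=> aG tX; split.
- by move=> f g Gf Gg fg; apply: tile_overlap tX _ _ _.
- by rewrite setTD; case: tX.
- by apply: nullS null_set0; rewrite setDT.
Qed.

(** The mechanism behind every rearrangement below. An overlap of the new set with its image under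
    [f] splits into four; each reduces to an overlap of images of [X], except when [f = g] or
    [f \o g = id], where a mixed overlap is empty because the moved and the unmoved part of [X] are
    disjoint. *)
Lemma tile_move G X Y g : affine_group G -> tile G X -> G g ->
  tile G ((X `\` Y) `|` g @` (X `&` Y)).
Proof.
move=> aG tX Gg; have [h [Gh gK hK]] := agroup_inv aG Gg.
have ov f : G f -> f <> id -> lebesgue_null (f @` X `&` X) by apply: tX.1.
split.
- move=> f Gf fid.
  have [k [Gk fK kK]] := agroup_inv aG Gf.
  pose p1 := f @` X `&` X.
  pose p2 := f @` X `&` g @` (X `&` Y).
  pose p3 := f @` (g @` (X `&` Y)) `&` (X `\` Y).
  pose p4 := f @` (g @` X) `&` g @` X.
  have n1 : lebesgue_null p1 by apply: ov.
  have n2 : lebesgue_null (f @` (X `\` Y) `&` g @` (X `&` Y)).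
    have [fg|fg] := pselect (f = g).
      apply: nullS null_set0; rewrite fg => _ [[x [_ nYx] <-] [y [_ Yy]]].
      by move=> /(can_inj gK) yx; apply: nYx; rewrite -yx.
    apply: nullS (tile_overlap aG tX Gf Gg fg); apply: setISS.
      by apply: image_subset => x [].
    by apply: image_subset => x [].
  have n3 : lebesgue_null p3.
    have Gfg := agroup_comp aG Gf Gg.
    have [fg|fg] := pselect (f \o g = id).
      apply: nullS null_set0 => _ [[_ [x [_ Yx] <-] <-] []] _; apply.
      by rewrite -[f (g x)]/((f \o g) x) fg.
    apply: nullS (ov _ Gfg fg) => _ [[_ [x [Xx _] <-] <-] [Xz _]].
    by split=> //; exists x.
  have n4 : lebesgue_null p4.
    have fg : f \o g <> g.
      by move=> e; apply: fid; apply/funext => x; rewrite -[in LHS](hK x) -[LHS]/((f \o g) (h x)) e.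
    apply: nullS (tile_overlap aG tX (agroup_comp aG Gf Gg) Gg fg).
    by move=> _ [[_ [x Xx <-] <-] Xz]; split=> //; exists x.
  apply: nullS (nullU (nullU n1 n2) (nullU n3 n4)).
  move=> _ [[x [Xx|[z Xz zx]] <-] [Xfx|gfx]].
  + by left; left; split; [exists x => //; case: Xx|case: Xfx].
  + by left; right; split; [exists x|].
  + by right; left; split=> //; exists x => //; exists z.
  + right; right; split; last by case: gfx => w [Xw _] <-; exists w.
    by exists x => //; exists z => //; case: Xz.
- apply: nullS tX.2; apply: subsetC => _ [f Gf [x Xx <-]].
  have [Yx|Yx] := pselect (Y x).
    exists (f \o h); first exact: agroup_comp.
    by exists (g x); [right; exists x|rewrite /= gK].
  by exists f => //; exists x => //; left.
Qed.

(** Countability of the group enters in the covering: the images under all group elements of the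
    null set lost from [X] must have a null union. *)
Lemma tile_ae G X Y : affine_group G -> countable G -> tile G X ->
  lebesgue_null (X `\` Y) -> lebesgue_null (Y `\` X) -> tile G Y.
Proof.
move=> aG cG tX XY YX; split.
- move=> g Gg gid; have := nullU (nullU (tX.1 g Gg gid) (null_affine (aG.2 g Gg) YX)) YX.
  apply: nullS => _ [[x Yx <-] Ygx].
  have [Xx|Xx] := pselect (X x); last by left; right; exists x.
  have [Xgx|Xgx] := pselect (X (g x)); last by right.
  by left; left; split=> //; exists x.
- have := nullU tX.2 (_ : lebesgue_null (\bigcup_(g in G) (g @` (X `\` Y)))).
  have nG : lebesgue_null (\bigcup_(g in G) (g @` (X `\` Y))).
    have [G0|/set0P [g0 Gg0]] := eqVneq G set0.
      by rewrite G0 bigcup_set0; exact: null_set0.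
    have [s sP] : exists s : nat -> V -> V, forall g, G g -> exists i, s i = g.
      have /pfcard_geP [G0|[s]] := cG; first by move: Gg0; rewrite G0.
      by exists s => g Gg; have [i _ <-] := 'surj_s Gg; exists i.
    have : lebesgue_null (\bigcup_i (if `[< G (s i) >] then s i @` (X `\` Y) else set0)).
      rewrite /lebesgue_null preimage_bigcup.
      apply: (@negligible_bigcup _ _ _ ((@lebesgue_measure R) \x (@lebesgue_measure R))%E) => i.
      case: ifP => [/asboolP Gs|_]; last exact: null_set0.
      exact: null_affine (aG.2 _ Gs) XY.
    apply: nullS => x [g Gg gx]; have [i si] := sP g Gg.
    by exists i => //; rewrite si asboolT.
  move=> /(_ nG); apply: nullS => x nU.
  have [/= [g Gg [z Xz zx]]|H] := pselect ((\bigcup_(g in G) (g @` X)) x); last by left.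
  right; exists g => //; exists z => //; split=> // Yz; apply: nU.
  by exists g => //; exists z.
Qed.

(** The pieces are indexed by the whole group: [g] carries the part of [X] that it sends into [E].
    Copies of [E] cover [X], copies of [X] cover [E], and neither family overlaps, so both families
    of pieces are partitions. *)
Lemma tile_congruent G X E : affine_group G -> tile G X -> tile G E ->
  lebesgue_measurable X -> lebesgue_measurable E -> congruent_by G X E.
Proof.
move=> aG tX tE mX mE.
exists G, (fun g => X `&` g @^-1` E), (fun g => g @` (X `&` g @^-1` E)).
have pre g : G g -> exists h, [/\ G h, g @^-1` E = h @` E, cancel g h & cancel h g].
  move=> Gg; have [h [Gh gK hK]] := agroup_inv aG Gg; exists h; split=> //.
  by rewrite (image_cancel _ hK gK).
have im g : G g -> g @` (X `&` g @^-1` E) = g @` X `&` E.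
  move=> Gg; apply/seteqP; split=> [_ [x [Xx Ex] <-]|_ [[x Xx <-] Ex]]; last by exists x.
  by split=> //; exists x.
have mpre g : G g -> lebesgue_measurable (X `&` g @^-1` E).
  move=> Gg; have [h [Gh -> _ _]] := pre g Gg.
  by apply: lmeasI => //; apply: lmeas_affine => //; exact: aG.2.
split=> //.
- split=> //; split.
  + move=> f g Gf Gg fg; have [h [Gh e1 fK hK]] := pre f Gf; have [k [Gk e2 gK kK]] := pre g Gg.
    apply: nullS (_ : lebesgue_null (h @` E `&` k @` E)).
      by rewrite -e1 -e2 => x [[_ ?] [_ ?]].
    apply: (tile_overlap aG tE Gh Gk) => hk; apply: fg; apply/funext => x.
    by rewrite -[LHS]kK -hk fK.
  + apply: nullS tE.2 => x [Xx nx] [g Gg [y Ey yx]]; apply: nx.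
    have [h [Gh e1 gK hK]] := pre g Gg; exists h => //; split=> //=.
    by rewrite -yx gK.
  + by apply: nullS null_set0 => x [[g _ [Xx _]]].
- split; first by move=> g Gg; apply: lmeas_affine; [exact: aG.2|exact: mpre].
  split.
  + move=> f g Gf Gg fg; rewrite !im //.
    by apply: nullS (tile_overlap aG tX Gf Gg fg) => x [[]? _ []].
  + apply: nullS tX.2 => x [Ex nx] [g Gg gx]; apply: nx.
    by exists g => //; rewrite im.
  + by apply: nullS null_set0 => x [[g Gg]]; rewrite im // => -[].
Qed.

Lemma affine_bij_group : affine_group (@affine_bij R).
Proof.
split=> //; split; [exact: affine_bij_id|exact: affine_bij_comp|].
by move=> f /affine_bij_inv [g [? ? ?]]; exists g.
Qed.

Lemma sub_generated (S : set (V -> V)) : S `<=` generated_group S.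
Proof. exact: sub_gen_smallest. Qed.

Lemma generated_sub (S G : set (V -> V)) : transformation_group G -> S `<=` G ->
  generated_group S `<=` G.
Proof. by move=> tG SG; apply: smallest_sub. Qed.

Lemma generated_affine_group (S : set (V -> V)) : S `<=` @affine_bij R ->
  affine_group (generated_group S).
Proof.
move=> SA; have GA := generated_sub affine_bij_group.1 SA.
split; last exact: GA.
split.
- by move=> G [[? _ _] _].
- move=> f g Gf Gg H HS; have [[_ h _] _] := HS; apply: h; [exact: Gf|exact: Gg].
- move=> f Gf; have [g [_ fK gK]] := affine_bij_inv (GA _ Gf).
  exists g; split=> // H HS; have [[_ _ h] _] := HS.
  (* [H] contains some inverse [g'] of [f]; inverses are unique, so the affine inverse [g] lies in
     every such [H]. *)
  have [g' [Hg' fK' _]] := h f (Gf _ HS).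
  by suff -> : g = g' by []; apply/funext => x; rewrite -[in LHS](gK x) -{2}(gK x) fK' fK.
Qed.

End tiles.

(** * Expansive matrices and the exchange argument *)

Lemma expr_unbounded (F : archiRealFieldType) (b m : F) : 1 < m -> exists k : nat, b < m ^+ k.
Proof.
move=> m1; have h : 0 < m - 1 by rewrite subr_gt0.
have [k hk] : exists k : nat, `|b| / (m - 1) < k%:R.
  by exists (Num.bound (`|b| / (m - 1))); apply: archi_boundP; rewrite divr_ge0 // ltW.
exists k; apply: le_lt_trans (ler_norm b) _.
apply: lt_le_trans (_ : k%:R * (m - 1) <= _); first by rewrite -ltr_pdivrMr.
have : 1 + k%:R * (m - 1) <= m ^+ k.
  elim: k {hk} => [|k IH]; first by rewrite mul0r addr0 expr0.
  rewrite exprS; apply: le_trans (_ : m * (1 + k%:R * (m - 1)) <= _).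
    rewrite -natr1 -subr_ge0 (_ : _ - _ = k%:R * (m - 1) ^+ 2); last by ring.
    by rewrite mulr_ge0 ?ler0n ?sqr_ge0.
  by rewrite ler_pM2l // (lt_trans ltr01).
by apply: le_trans; rewrite lerDr ler01.
Qed.

Lemma big2 (Z : nmodType) (F : 'I_2 -> Z) : \sum_(i < 2) F i = F ord0 + F (lift ord0 ord0).
Proof. by rewrite big_ord_recl big_ord1. Qed.

Lemma det2 (F : comNzRingType) (A : 'M[F]_2) : \det A = A ord0 ord0 * A (lift ord0 ord0) (lift ord0 ord0) -
  A ord0 (lift ord0 ord0) * A (lift ord0 ord0) ord0.
Proof.
rewrite (expand_det_row _ ord0) big2 /cofactor !det_mx11 !mxE /= expr0 expr1.
rewrite mul1r mulN1r mulrN; congr (_ * A _ _ - _ * A _ _); by apply/val_inj.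
Qed.

Section dilation.
Context {R : realType}.
Local Notation V := 'cV[R]_2.
Implicit Types (X Y E K : set V) (f g : V -> V) (A : 'M[R]_2).

Lemma mulmx2E (A : 'M[R]_2) x : A *m x = cv2 (
  A ord0 ord0 * px x + A ord0 (lift ord0 ord0) * py x,
  A (lift ord0 ord0) ord0 * px x + A (lift ord0 ord0) (lift ord0 ord0) * py x).
Proof. by apply: plane_ext; rewrite !pE /px /py !mxE big2. Qed.

Lemma mulmx_affine (A : 'M[R]_2) : A \in unitmx -> affine_bij (fun x => A *m x).
Proof.
rewrite unitmxE unitfE det2 => D; do 4 eexists; exists 0, 0; split; first exact: D.
by move=> x; rewrite mulmx2E !addr0.
Qed.

Definition dil (A : 'M[R]_2) (k : int) (x : V) : V := (A ^ k) *m x.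

Lemma dil0 A x : dil A 0 x = x.
Proof. by rewrite /dil expr0z mul1mx. Qed.

Lemma dilD A k l x : A \in unitmx -> dil A k (dil A l x) = dil A (k + l) x.
Proof. by move=> Au; rewrite /dil mulmxA; congr (_ *m _); rewrite exprzDr. Qed.

Lemma dil1 A x : dil A 1 x = A *m x.
Proof. by rewrite /dil expr1z. Qed.

Lemma dil_unit (A : 'M[R]_2) k : A \in unitmx -> A ^ k \in unitmx.
Proof. by move=> Au; exact: (@unitrXz _ A k). Qed.

Lemma dilK A k : A \in unitmx -> cancel (dil A k) (dil A (- k)).
Proof. by move=> Au x; rewrite dilD // addNr dil0. Qed.

Lemma dil_affine A k : A \in unitmx -> affine_bij (dil A k).
Proof. by move=> Au; apply: mulmx_affine; exact: dil_unit. Qed.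

Lemma dilationsE A g : dilations A g <-> exists k, g = dil A k.
Proof. by split=> [[k _ <-]|[k ->]]; exists k. Qed.

Lemma dilations_group A : A \in unitmx -> affine_group (dilations A).
Proof.
move=> Au; split; last by move=> g /dilationsE [k ->]; exact: dil_affine.
split.
- by apply/dilationsE; exists 0; apply/funext => x; rewrite dil0.
- move=> f g /dilationsE [k ->] /dilationsE [l ->]; apply/dilationsE; exists (k + l).
  by apply/funext => x /=; rewrite dilD.
- move=> f /dilationsE [k ->]; exists (dil A (- k)); split.
  + by apply/dilationsE; exists (- k).
  + exact: dilK.
  + by move=> x; have := @dilK A (- k) Au x; rewrite opprK.
Qed.

(** Expansiveness bounds eigenvalues only; in the Euclidean norm [A] may at first shrink vectors.
    Here every single application stretches by at least [m > 1]. Measurability of the unit ball is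
    recorded because the dilation tile is made from it. *)
Record expanding_norm (A : 'M[R]_2) (m : R) (nm : V -> R) : Prop := ExpandingNorm {
  en_gt1 : 1 < m;
  en_ge0 : forall x, 0 <= nm x;
  en_eq0 : forall x, nm x = 0 -> x = 0;
  en_scale : forall a x, nm (a *: x) = `|a| * nm x;
  en_tri : forall x y, nm (x + y) <= nm x + nm y;
  en_exp : forall x, m * nm x <= nm (A *m x);
  en_meas : lebesgue_measurable [set x | nm x < 1] }.

Section with_norm.
Variables (A : 'M[R]_2) (m : R) (nm : V -> R).
Hypotheses (Au : A \in unitmx) (hn : expanding_norm A m nm).

Let m0 : 0 < m. Proof. exact: lt_trans ltr01 (en_gt1 hn). Qed.

Lemma nm_dil (k : nat) x : m ^+ k * nm x <= nm (dil A k x).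
Proof.
elim: k => [|k IH]; first by rewrite expr0 mul1r dil0.
rewrite -addn1 PoszD addrC -dilD // dil1 exprD expr1 (mulrC _ m) -mulrA.
by apply: le_trans (en_exp hn _); rewrite ler_pM2l.
Qed.

Lemma nm_dilN (k : nat) x : nm (dil A (- k%:Z) x) <= m ^- k * nm x.
Proof.
rewrite mulrC ler_pdivlMr ?exprn_gt0 // mulrC; apply: le_trans (nm_dil _ _) _.
by rewrite dilD // subrr dil0.
Qed.

Lemma pow_small (e : R) : 0 < e -> exists k : nat, m ^- k < e.
Proof.
move=> e0; have [k hk] := expr_unbounded e^-1 (en_gt1 hn).
by exists k; rewrite invf_plt ?posrE ?exprn_gt0.
Qed.

(** The unit ball without its preimage under [A]: each nonzero orbit leaves the ball exactly once,
    and the shell holds its last point inside. *)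
Definition shell : set V := [set x | nm x < 1 <= nm (A *m x)].

Lemma shell_meas : lebesgue_measurable shell.
Proof.
have -> : shell = [set x | nm x < 1] `\` (dil A (-1) @` [set x | nm x < 1]).
  apply/seteqP; split=> x /=.
    move=> /andP[h1 h2]; split=> // -[y hy yx]; move: h2.
    by rewrite -yx -dil1 dilD // subrr dil0 leNgt hy.
  move=> [h1 h2]; rewrite /shell /= h1 leNgt; apply/negP => h; apply: h2.
  by exists (A *m x) => //; rewrite -dil1 dilD // addNr dil0.
apply: lmeasD; first exact: en_meas hn.
by apply: lmeas_affine; [exact: dil_affine|exact: en_meas hn].
Qed.

Lemma shell_dil (k : nat) x : (0 < k)%N -> shell x -> ~ shell (dil A k x).
Proof.
case: k => // k _ /andP[_ h1] /andP[h2 _]; move: h2; rewrite ltNge => /negP; apply.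
rewrite -addn1 PoszD -dilD // dil1; apply: le_trans (nm_dil k _).
apply: le_trans h1 _; rewrite ler_peMl ?(en_ge0 hn) //.
by rewrite exprn_ege1 // ltW // (en_gt1 hn).
Qed.

Lemma shell_tile : tile (dilations A) shell.
Proof.
split.
- move=> g /dilationsE [k ->] kid; apply: nullS null_set0 => _ [[x Ex <-]].
  have k0 : k != 0 by apply: contra_not_neq kid => ->; apply/funext => y; rewrite dil0.
  case: k k0 {kid} => [k|k] k0; first by apply: shell_dil; rewrite ?lt0n.
  move=> H; apply: (@shell_dil k.+1 _ _ H) => //.
  by rewrite dilD // NegzE subrr dil0.
(* Only the origin is missed, and it lies on a null line. *)
- apply: (@nullS _ _ [set x | dotcv x (cv2 (1, 0)) = 0]); last first.
    apply: null_line; apply/eqP => /(congr1 px); rewrite !pE /= => /eqP.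
    by rewrite oner_eq0.
  move=> x Hx; suff -> : x = 0 by rewrite /= dotE !pE !mul0r addr0.
  apply/eqP/negP => /negP x0; apply: Hx.
  have nx0 : 0 < nm x.
    by rewrite lt_neqAle (en_ge0 hn) andbT eq_sym; apply: contra_neq x0 => /(en_eq0 hn).
  (* Some negative power brings [x] into the unit ball; the least positive power that takes the
     result out again is preceded by a point of the shell. *)
  have [k0 hk0] : exists k : nat, nm (dil A (- k%:Z) x) < 1.
    have nV : 0 < (nm x)^-1 by rewrite invr_gt0.
    have [k hk] := pow_small nV.
    exists k; apply: le_lt_trans (nm_dilN _ _) _.
    by rewrite -(@mulVf _ (nm x)) ?gt_eqF // ltr_pM2r.
  set y := dil A _ x in hk0.
  have ny0 : 0 < nm y.
    rewrite lt_neqAle (en_ge0 hn) andbT eq_sym; apply: contra_neq x0 => /(en_eq0 hn) y0.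
    by rewrite -(@dilK A (- k0%:Z) Au x) -/y y0 /dil mulmx0.
  have ex : exists j : nat, 1 <= nm (dil A j y).
    have [k hk] := pow_small ny0.
    exists k; apply: le_trans (nm_dil _ _).
    by rewrite -(@mulfV _ (m ^+ k)) ?gt_eqF ?exprn_gt0 // ler_pM2l ?exprn_gt0 // ltW.
  case: (ex_minnP ex) => -[|j] hj minj; first by move: hj; rewrite dil0 leNgt hk0.
  have Ej : shell (dil A j y).
    rewrite /shell /= -dil1 dilD // -PoszD add1n hj andbT ltNge.
    by apply/negP => /minj; rewrite ltnn.
  exists (dil A (k0%:Z - j%:Z)); first by apply/dilationsE; exists (k0%:Z - j%:Z).
  exists (dil A j y) => //; rewrite dilD // /y dilD //.
  by rewrite subrK subrr dil0.
Qed.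

Lemma dil_inj k : injective (dil A k).
Proof. by apply: can_inj; exact: dilK. Qed.

Lemma nm_sub x y : nm x - nm y <= nm (x + y).
Proof.
have := en_tri hn (x + y) (- y); rewrite addrK -scaleN1r (en_scale hn) normrN1 mul1r.
by rewrite lerBlDr.
Qed.

(** After [A^-l] the bounded set has size [d] and the step [y] along [c] is short, with [2 d + nm y]
    below the thickness [1 - 1 / m] of the annulus of norms between [1 / m] and [1], which is part
    of the shell. Walking outwards by steps [y], the set cannot jump over the annulus. *)
Lemma shell_catch (M : R) (c : V) : c != 0 -> 0 <= M -> exists (l n : nat),
  forall z, nm z <= M -> shell (dil A (- l%:Z) (z + c *+ n)).
Proof.
move=> c0 M0.
have nc0 : 0 < nm c.
  by rewrite lt_neqAle (en_ge0 hn) andbT eq_sym; apply: contra_neq c0 => /(en_eq0 hn).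
have mV : 0 < 1 - m^-1 by rewrite subr_gt0 invf_lt1 // (en_gt1 hn).
have M1 : 0 < 2 * M + nm c by lra.
have [l hl] := pow_small (divr_gt0 mV M1); move: hl; rewrite ltr_pdivlMr // => hl.
pose y := dil A (- l%:Z) c; pose d := m ^- l * M.
have ml0 : 0 < m ^- l by rewrite invr_gt0 exprn_gt0.
have d0 : 0 <= d by rewrite mulr_ge0 // ltW.
have hy : nm y <= m ^- l * nm c by exact: nm_dilN.
have y0 : 0 < nm y.
  rewrite lt_neqAle (en_ge0 hn) andbT eq_sym; apply: contra_neq c0 => /(en_eq0 hn) y0.
  by rewrite -(@dilK A (- l%:Z) Au c) -/y y0 /dil mulmx0.
have hm : 2 * d + nm y < 1 - m^-1.
  by apply: le_lt_trans hl; rewrite /d mulrDr; lra.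
have mV0 : 0 < m^-1 by rewrite invr_gt0.
have ex : exists n : nat, 1 <= n%:R * nm y + d.
  exists (Num.bound ((nm y)^-1)).
  have : (nm y)^-1 < (Num.bound (nm y)^-1)%:R by apply: archi_boundP; rewrite invr_ge0 ltW.
  by rewrite -[X in X < _]mul1r ltr_pdivrMr // => h; lra.
(* [n.+1] is the first index at which the outer bound reaches [1], so at index [n] the set is still
   inside the ball and already beyond norm [1 / m]. *)
case: (ex_minnP ex) => -[|n] hn1 minn; first by move: hn1; rewrite mul0r; lra.
have hn2 : n%:R * nm y + d < 1.
  by rewrite ltNge; apply/negP => /minn; rewrite ltnn.
exists l, n => z hz.
have dz : nm (dil A (- l%:Z) z) <= d.
  by apply: le_trans (nm_dilN _ _) _; rewrite /d ler_pM2l.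
have -> : dil A (- l%:Z) (z + c *+ n) = n%:R *: y + dil A (- l%:Z) z.
  by rewrite /dil mulmxDr -scaler_nat -scalemxAr addrC.
have nz : nm (n%:R *: y) = n%:R * nm y by rewrite (en_scale hn) normr_nat.
apply/andP; split.
  by apply: le_lt_trans (en_tri hn _ _) _; rewrite nz; lra.
apply: le_trans (en_exp hn _); rewrite -ler_pdivrMl // mulr1.
apply: le_trans (nm_sub _ _); rewrite nz.
by move: hn1; rewrite -natr1 mulrDl mul1r; lra.
Qed.

Theorem three_way_tile K (G1 G2 : set (V -> V)) (M e : R) (c : V) :
  lebesgue_measurable K -> (forall x, K x -> nm x <= M) -> 0 < e ->
  (forall x, nm x < e -> K x) -> affine_group G1 -> affine_group G2 ->
  tile G1 K -> tile G2 K -> c != 0 ->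
  (forall n : nat, G1 (fun x => x + c *+ n)) -> (forall n : nat, G2 (fun x => x + c *+ n)) ->
  exists W, [/\ lebesgue_measurable W, tile G1 W, tile G2 W & tile (dilations A) W].
Proof.
move=> mK KM e0 eK aG1 aG2 t1 t2 c0 cG1 cG2.
have M0 : 0 <= M.
  apply: le_trans (KM 0 _); first exact: (en_ge0 hn).
  by apply: eK; rewrite -(scale0r 0) (en_scale hn) normr0 mul0r.
have [l [n catch]] := shell_catch c0 M0.
have [k0 hk0] := pow_small e0.
(* The successor makes the exponent positive, which puts [phi] of the shell outside the shell; the
   second move below then leaves alone the pieces displaced by the first. *)
pose k := k0.+1.
have hk : m ^- k < e.
  apply: le_lt_trans hk0; rewrite /k exprS invfM -[leRHS]mul1r ler_pM2r ?invr_gt0 ?exprn_gt0 //.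
  by rewrite invf_le1 // ltW // (en_gt1 hn).
pose phi := dil A (- k%:Z); pose t x := x + c *+ n; pose psi x := dil A (- l%:Z) (t x).
have aphi : affine_bij phi by exact: dil_affine.
have at_ : affine_bij t by apply: aG1.2; exact: cG1.
have apsi : affine_bij psi by apply: affine_bij_comp => //; exact: dil_affine.
pose h := phi \o psi.
have ah : affine_bij h by exact: affine_bij_comp.
have phiK x : shell x -> K (phi x).
  move=> /andP[x1 _]; apply: eK; apply: le_lt_trans (nm_dilN _ _) _.
  by apply: lt_trans hk; rewrite gtr_pMr ?invr_gt0 ?exprn_gt0.
have psiE x : K x -> shell (psi x) by move=> /KM; exact: catch.
have phiE x : shell x -> ~ shell (phi x).
  move=> Ex Ephi; apply: (@shell_dil k _ _ Ephi) => //.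
  by rewrite /phi dilD // subrr dil0.
(* [F i] holds the points reached by [i] round trips [h] from points of [K] that are not in [phi] of
   the shell. On their union [K1] the exchange uses [psi], elsewhere the inverse of [phi]. *)
pose F := fix F (i : nat) := if i is j.+1 then h @` F j else K `\` phi @` shell.
have mE := shell_meas.
have mF i : lebesgue_measurable (F i).
  elim: i => [|i IH] /=; last exact: lmeas_affine.
  by apply: lmeasD => //; exact: lmeas_affine.
pose K1 := \bigcup_i F i.
have mK1 : lebesgue_measurable K1 by exact: lmeas_bigcup.
have FK i : F i `<=` K.
  elim: i => [|i IH] /=; first by move=> x [].
  by move=> _ [x /IH Kx <-]; apply: phiK; exact: psiE.
have K1K : K1 `<=` K by move=> x [i _]; exact: FK.
pose E1 := psi @` K1; pose E2 := shell `\` E1.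
have phi_inj : injective phi by exact: dil_inj.
have phiE2 : phi @` E2 = K `\` K1.
  apply/seteqP; split.
    move=> _ [x [Ex nE1] <-]; split; first exact: phiK.
    move=> [[|i] _ /=]; first by case=> _; apply; exists x.
    move=> [y Fy /phi_inj yx]; apply: nE1; exists y => //.
    by exists i.
  move=> x [Kx nK1].
  have [[y Ey yx]|nphi] := pselect ((phi @` shell) x); last first.
    by exfalso; apply: nK1; exists 0%N.
  exists y => //; split=> // -[z [i _ Fz] zy]; apply: nK1; exists i.+1 => //=.
  by exists z => //; rewrite /h /= zy.
exists ((K `\` K1) `|` t @` (K `&` K1)); split.
- by apply: lmeasU; [exact: lmeasD|apply: lmeas_affine => //; exact: lmeasI].
- exact: (tile_move K1 aG1 t1 (cG1 n)).
- exact: (tile_move K1 aG2 t2 (cG2 n)).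
have aD := dilations_group Au.
have Dphi : dilations A phi by apply/dilationsE; exists (- k%:Z).
have Dl : dilations A (dil A l) by apply/dilationsE; exists l%:Z.
(* Seen from the shell, the same set arises by two moves: [E2] goes into [K] by [phi], and [E1], the
   copy of [K1], goes by [A^l] to the translate of [K1]. *)
have := tile_move E1 aD (tile_move E2 aD shell_tile Dphi) Dl.
suff <- : (((shell `\` E2) `|` phi @` (shell `&` E2)) `\` E1) `|`
    (dil A l @` (((shell `\` E2) `|` phi @` (shell `&` E2)) `&` E1)) =
    (K `\` K1) `|` t @` (K `&` K1) by [].
have E1E : E1 `<=` shell by move=> _ [x /K1K /psiE + <-].
have -> : shell `&` E2 = E2 by apply: setIidr => x [].
have -> : shell `\` E2 = E1.
  apply/seteqP; split=> x.
    by move=> [Ex nE2]; apply: contrapT => nE1; apply: nE2.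
  by move=> E1x; split; [exact: E1E|case].
have disj x : (phi @` E2) x -> ~ E1 x by move=> [y [Ey _] <-] /E1E; exact: phiE.
have -> : (E1 `|` phi @` E2) `\` E1 = phi @` E2.
  apply/seteqP; split=> x; first by case=> -[].
  by move=> px; split; [right|exact: disj].
have -> : (E1 `|` phi @` E2) `&` E1 = E1.
  by apply/seteqP; split=> x; [case|move=> ?; split=> //; left].
have -> : K `&` K1 = K1 by apply/seteqP; split=> x; [case|move=> K1x; split=> //; exact: K1K].
rewrite phiE2; congr (_ `|` _).
have dt x : dil A l (psi x) = t x by rewrite /psi dilD // subrr dil0.
apply/seteqP; split=> [_ [_ [x K1x <-] <-]|_ [x K1x <-]].
  by exists x => //; rewrite dt.
by exists (psi x); [exists x|rewrite dt].
Qed.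

End with_norm.
End dilation.

(** * Norms expanded by an expansive matrix *)

Section expansive.
Context {R : realType}.
Local Notation V := 'cV[R]_2.
Local Notation i1 := (lift ord0 ord0 : 'I_2).

Lemma eigenvalue_det (F : fieldType) n (A : 'M[F]_n) a :
  \det (A - a%:M) = 0 -> eigenvalue A a.
Proof.
move=> D; rewrite /eigenvalue /eigenspace kermx_eq0 row_free_unit unitmxE D.
by rewrite unitr0.
Qed.

Lemma expansive_root (A : 'M[R]_2) (z : complex R) : expansive A ->
  z ^+ 2 - (real_complex R (\tr A)) * z + real_complex R (\det A) = 0 -> 1 < `|z|.
Proof.
move=> hA hz; apply: hA; apply: eigenvalue_det; rewrite -hz.
rewrite !det2 /mxtrace big2 !mxE /= !mulr1n !mulr0n !subr0.
by rewrite rmorphB !rmorphM rmorphD; ring.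
Qed.

(** The determinant is the product of two complex eigenvalues. For the second inequality, the
    characteristic polynomial [p] satisfies [p(1) p(-1) = (1 + d)^2 - t^2]; were this not positive,
    the intermediate value theorem would give a real root in [[-1, 1]]. *)
Lemma expansive_trace_det (A : 'M[R]_2) : expansive A ->
  1 < \det A ^+ 2 /\ \tr A ^+ 2 < (1 + \det A) ^+ 2.
Proof.
move=> hA; set t := \tr A; set d := \det A; split.
  have [z hz] := @solve_monicpoly (complex R) 2 (fun i => if i == 0%N then - (real_complex R d) else real_complex R t) isT.
  move: hz; rewrite !big_ord_recl big_ord0 /= expr0 mulr1 expr1 addr0 => hz.
  have h1 : 1 < `|z| by apply: expansive_root hA _; rewrite hz -/t -/d; ring.
  pose z2 := real_complex R t - z.
  have h2 : 1 < `|z2|.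
    apply: expansive_root hA _; rewrite -/t -/d /z2.
    by transitivity (z ^+ 2 - (- real_complex R d + real_complex R t * z)); [ring|rewrite hz; ring].
  have zz : z * z2 = real_complex R d.
    by transitivity (real_complex R t * z - z ^+ 2); [rewrite /z2; ring|rewrite hz; ring].
  have : 1 < `|real_complex R d| by rewrite -zz normrM mulr_egt1.
  have -> : `|real_complex R d| = real_complex R `|d| by rewrite normc_def /= expr0n /= addr0 sqrtr_sqr.
  rewrite (_ : 1 = real_complex R 1) // ltcR => d1.
  by rewrite -real_normK ?num_real // exprn_egt1.
rewrite ltNge; apply/negP => H.
have H' : (1 - t + d) * (1 + t + d) <= 0.
  by rewrite (_ : _ * _ = (1 + d) ^+ 2 - t ^+ 2); [rewrite subr_le0 | ring].
pose p : {poly R} := 'X^2 - t *: 'X + d%:P.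
have pE x : p.[x] = x ^+ 2 - t * x + d by rewrite /p !hornerE.
have [x /andP[x1 x2] rx] : exists2 x, -1 <= x <= 1 & root p x.
  have le11 : -1 <= 1 :> R by lra.
  have [h|h] := lerP (p.[-1]) 0.
    have [h'|h'] := ltrP (p.[1]) 0.
      have : 0 <= p.[-1].
        move: h h'; rewrite !pE => h h'.
        rewrite leNgt; apply/negP => h2.
        by move: H'; nra.
      move=> h2; exists (-1); first by rewrite lexx.
      by rewrite rootE; apply/eqP; apply/le_anti; rewrite h.
    by apply: poly_ivt => //; rewrite h h'.
  have h' : p.[1] <= 0.
    by move: h; rewrite !pE => h; rewrite leNgt; apply/negP => h2; move: H'; nra.
  have hN : (- p).[-1] <= 0 <= (- p).[1] by rewrite !hornerN oppr_le0 oppr_ge0 (ltW h) h'.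
  have [x x1 x2] := poly_ivt le11 hN.
  by exists x => //; rewrite rootN in x2.
have := @expansive_root A (real_complex R x) hA; rewrite -/t -/d.
rewrite -rmorphXn -rmorphM -rmorphB -rmorphD -pE (eqP rx) => /(_ erefl).
have -> : `|real_complex R x| = real_complex R `|x| by rewrite normc_def /= expr0n /= addr0 sqrtr_sqr.
by rewrite (_ : 1 = real_complex R 1) // ltcR ltNge ler_norml x1 x2.
Qed.


Lemma sqrt_sum_tri (a b c d : R) :
  Num.sqrt ((a + c) ^+ 2 + (b + d) ^+ 2) <=
  Num.sqrt (a ^+ 2 + b ^+ 2) + Num.sqrt (c ^+ 2 + d ^+ 2).
Proof.
set r := Num.sqrt (a ^+ 2 + b ^+ 2); set s := Num.sqrt (c ^+ 2 + d ^+ 2).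
have r0 : 0 <= r by exact: sqrtr_ge0.
have s0 : 0 <= s by exact: sqrtr_ge0.
have r2 : r ^+ 2 = a ^+ 2 + b ^+ 2 by rewrite sqr_sqrtr // addr_ge0 ?sqr_ge0.
have s2 : s ^+ 2 = c ^+ 2 + d ^+ 2 by rewrite sqr_sqrtr // addr_ge0 ?sqr_ge0.
have h : a * c + b * d <= r * s.
  apply: le_trans (ler_norm _) _; rewrite -(@ler_pXn2r _ 2) ?nnegrE ?mulr_ge0 //.
  rewrite real_normK ?num_real // exprMn r2 s2 -subr_ge0.
  by rewrite (_ : _ - _ = (a * d - b * c) ^+ 2) ?sqr_ge0 //; ring.
rewrite -[leRHS]ger0_norm ?addr_ge0 // -sqrtr_sqr; apply: ler_wsqrtr.
rewrite (_ : (r + s) ^+ 2 = r ^+ 2 + s ^+ 2 + 2 * (r * s)); last by ring.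
by rewrite r2 s2; move: h; lra.
Qed.

(* Lyapunov form: the functionals [u = l x] and [w = l (A x)] turn [A] into the
   companion map [(u, w) -> (w, t w - d u)], for which
   [(w - t d / (1 + d) u)^2 + k u^2] grows as soon as [t^2 < (1 + d)^2, 1 < d^2]. *)
Lemma companion_form (t d : R) : 1 < d ^+ 2 -> t ^+ 2 < (1 + d) ^+ 2 ->
  exists b k l : R, [/\ 0 < k, 1 < l & forall u w,
    l * ((w + b * u) ^+ 2 + k * u ^+ 2) <=
    ((t * w - d * u) + b * w) ^+ 2 + k * w ^+ 2].
Proof.
move=> d1 td.
have e0 : 1 + d != 0.
  by apply/eqP => e0; move: td; rewrite e0 expr0n /= ltNge sqr_ge0.
(* This [b] gives both quadratic forms the same mixed term [2 b u w], so that only the coefficients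
   of [u^2] and [w^2] have to grow. *)
pose b := - (t * d / (1 + d)).
have bE : b * (1 + d) = - (t * d) by rewrite /b; field.
have E0 : 0 < (1 + d) ^+ 2 by rewrite lt_neqAle sqr_ge0 eq_sym expf_neq0.
(* lower bounds for the coefficient [a = k + b^2] of [u^2] *)
have m1 : b ^+ 2 < d ^+ 2.
  rewrite -(ltr_pM2r E0) -exprMn bE sqrrN exprMn mulrC ltr_pM2l //.
  by apply: lt_trans d1; exact: ltr01.
pose q := 1 - t ^+ 2 - 2 * b * t.
have m2 : q < d ^+ 2.
  have : 0 < (d ^+ 2 - q) * (1 + d) ^+ 2.
    have -> : (d ^+ 2 - q) * (1 + d) ^+ 2 = (d ^+ 2 - 1 + t ^+ 2) * (1 + d) ^+ 2 +
       2 * t * (1 + d) * (b * (1 + d)) by rewrite /q; ring.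
    rewrite bE.
    have -> : (d ^+ 2 - 1 + t ^+ 2) * (1 + d) ^+ 2 + 2 * t * (1 + d) * - (t * d) =
      (d ^+ 2 - 1) * ((1 + d) ^+ 2 - t ^+ 2) by ring.
    by rewrite mulr_gt0 ?subr_gt0.
  by rewrite pmulr_lgt0 // subr_gt0.
(* Any value strictly between would do: [a > b^2] makes the form positive definite, [a < d^2] lets
   the coefficient of [u^2] grow, and [a > q] that of [w^2]. *)
pose a := (Num.max (b ^+ 2) q + d ^+ 2) / 2.
have mx : Num.max (b ^+ 2) q < d ^+ 2 by rewrite gt_max m1 m2.
have [a1 a2] : b ^+ 2 < a /\ q < a.
  have : b ^+ 2 <= Num.max (b ^+ 2) q by rewrite le_max lexx.
  have : q <= Num.max (b ^+ 2) q by rewrite le_max lexx orbT.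
  by rewrite /a; lra.
have a3 : a < d ^+ 2 by rewrite /a; lra.
(* [c] is the smaller of the two gains and [S] bounds the form by a multiple of [u^2 + w^2], so the
   form grows by at least the fraction [c / S] of itself. *)
pose c := Num.min (d ^+ 2 - a) (a - q).
have c0 : 0 < c by rewrite lt_min !subr_gt0 a3 a2.
pose S := a + 1 + `|b|.
have S0 : 0 < S.
  by rewrite /S; have := sqr_ge0 b; have := normr_ge0 b; lra.
exists b, (a - b ^+ 2), (1 + c / S); split.
- by rewrite subr_gt0.
- by rewrite ltrDl divr_gt0.
- move=> u w.
  have -> : (w + b * u) ^+ 2 + (a - b ^+ 2) * u ^+ 2 = a * u ^+ 2 + 2 * b * u * w + w ^+ 2.
    by ring.
  have -> : ((t * w - d * u) + b * w) ^+ 2 + (a - b ^+ 2) * w ^+ 2 =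
     d ^+ 2 * u ^+ 2 - 2 * (t * d + b * d) * u * w + (t ^+ 2 + 2 * b * t + a) * w ^+ 2 by ring.
  have -> : t * d + b * d = - b by move: bE; lra.
  set N := a * u ^+ 2 + 2 * b * u * w + w ^+ 2.
  have hN : N <= S * (u ^+ 2 + w ^+ 2).
    have h1 : 2 * b * u * w <= `|b| * (u ^+ 2 + w ^+ 2).
      apply: le_trans (ler_norm _) _.
      rewrite (_ : 2 * b * u * w = b * (2 * u * w)); last by ring.
      rewrite normrM ler_wpM2l // ler_norml; apply/andP; split.
        by have := sqr_ge0 (u + w); rewrite sqrrD -mulr_natr; lra.
      by have := sqr_ge0 (u - w); rewrite sqrrB -mulr_natr; lra.
    have := sqr_ge0 u; have := sqr_ge0 w; have := sqr_ge0 b => hb hw hu.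
    by rewrite /N /S; nra.
  have cN : c / S * N <= c * (u ^+ 2 + w ^+ 2).
    rewrite -mulrA ler_pM2l // mulrC ler_pdivrMr //; by rewrite mulrC.
  have hc1 : c * u ^+ 2 <= (d ^+ 2 - a) * u ^+ 2.
    by rewrite ler_wpM2r ?sqr_ge0 // ge_min lexx.
  have hc2 : c * w ^+ 2 <= (a - q) * w ^+ 2.
    by rewrite ler_wpM2r ?sqr_ge0 // ge_min lexx orbT.
  have E : (a - q) * w ^+ 2 = (a - 1 + t ^+ 2 + 2 * b * t) * w ^+ 2 by rewrite /q; ring.
  rewrite mulrDl mul1r; apply: le_trans (lerD (lexx _) cN) _.
  by rewrite /N; move: hc1 hc2; rewrite E; lra.
Qed.

(** A row vector is cyclic when it and its product with [A] are independent. One of [(1, 0)],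
    [(0, 1)], [(1, 1)] is cyclic unless [A] is scalar, and then the Euclidean form itself is
    multiplied by [p^2]. *)
Lemma expansive_form (A : 'M[R]_2) : expansive A -> exists a b c d l : R,
  [/\ a * d - b * c != 0, 1 < l & forall x,
   l * ((a * px x + b * py x) ^+ 2 + (c * px x + d * py x) ^+ 2) <=
   (a * px (A *m x) + b * py (A *m x)) ^+ 2 + (c * px (A *m x) + d * py (A *m x)) ^+ 2].
Proof.
move=> hA; have [d1 td] := expansive_trace_det hA.
set p := A ord0 ord0; set q := A ord0 i1; set r := A i1 ord0; set s := A i1 i1.
have dE : \det A = p * s - q * r by rewrite det2.
have tE : \tr A = p + s by rewrite /mxtrace big2.
have [b [k [l [k0 l1 H]]]] := companion_form d1 td.
(* [(e, f)] is the row [l], and [(e p + f r, e q + f s)] is [l A] *)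
have main (e f : R) : e * (e * q + f * s) - f * (e * p + f * r) != 0 ->
  exists a b c d l : R,
  [/\ a * d - b * c != 0, 1 < l & forall x,
   l * ((a * px x + b * py x) ^+ 2 + (c * px x + d * py x) ^+ 2) <=
   (a * px (A *m x) + b * py (A *m x)) ^+ 2 + (c * px (A *m x) + d * py (A *m x)) ^+ 2].
  move=> D; pose g := Num.sqrt k.
  have g2 : g ^+ 2 = k by rewrite sqr_sqrtr // ltW.
  have g0 : g != 0 by rewrite gt_eqF // sqrtr_gt0.
  exists ((e * p + f * r) + b * e), ((e * q + f * s) + b * f), (g * e), (g * f), l.
  split=> //.
    have -> : (e * p + f * r + b * e) * (g * f) - (e * q + f * s + b * f) * (g * e) =
      - (g * (e * (e * q + f * s) - f * (e * p + f * r))) by ring.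
    by rewrite oppr_eq0 mulf_neq0.
  move=> x; have := H (e * px x + f * py x) ((e * p + f * r) * px x + (e * q + f * s) * py x).
  rewrite mulmx2E !pE /= -/p -/q -/r -/s tE dE -g2 -!exprMn.
  congr (_ * (_ ^+ 2 + _ ^+ 2) <= _ ^+ 2 + _ ^+ 2); ring.
have [q0|q0] := eqVneq q 0; last first.
  by apply: (main 1 0); rewrite !mul0r subr0 addr0 !mul1r.
have [r0|r0] := eqVneq r 0; last first.
  by apply: (main 0 1); rewrite !mul0r !add0r !mul1r oppr_eq0.
have [ps|ps] := eqVneq p s; last first.
  apply: (main 1 1); rewrite q0 r0 !mul1r add0r addr0 subr_eq0.
  by rewrite eq_sym.
exists 1, 0, 0, 1, (p ^+ 2); split.
- by rewrite mulr1 mulr0 subr0 oner_eq0.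
- move: d1; rewrite dE q0 ps mul0r subr0 -expr2.
  have := sqr_ge0 s => s0 h; rewrite ltNge; apply/negP => h2.
  by move: h; rewrite ltNge expr_le1 // h2.
- by move=> x; rewrite mulmx2E !pE /= -/p -/q -/r -/s q0 r0 -ps; lra.
Qed.

(** The constant compares the norm with the coordinates in both directions: one direction will bound
    the tile [K], the other will put a ball of the norm inside it. *)
Lemma expansive_norm (A : 'M[R]_2) : expansive A ->
  A \in unitmx /\ exists (m : R) (nm : V -> R) (C : R),
   [/\ expanding_norm A m nm, 0 < C, forall x, nm x <= C * (`|px x| + `|py x|) &
       forall x, `|px x| + `|py x| <= C * nm x].
Proof.
move=> hA; split.
  rewrite unitmxE unitfE; apply/eqP => d0; have [] := expansive_trace_det hA.
  by rewrite d0 expr0n /= ltr10.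
have [a [b [c [d [l [D l1 H]]]]]] := expansive_form hA.
pose nm x := Num.sqrt ((a * px x + b * py x) ^+ 2 + (c * px x + d * py x) ^+ 2).
have l0 : 0 < l by exact: lt_trans ltr01 l1.
have nm0 x : 0 <= nm x by exact: sqrtr_ge0.
have nmE x : nm x ^+ 2 = (a * px x + b * py x) ^+ 2 + (c * px x + d * py x) ^+ 2.
  by rewrite sqr_sqrtr // addr_ge0 ?sqr_ge0.
have nm1 x : `|a * px x + b * py x| <= nm x.
  by rewrite -sqrtr_sqr; apply: ler_wsqrtr; rewrite lerDl sqr_ge0.
have nm2 x : `|c * px x + d * py x| <= nm x.
  by rewrite -sqrtr_sqr; apply: ler_wsqrtr; rewrite lerDr sqr_ge0.
have solx x : px x = (d * (a * px x + b * py x) - b * (c * px x + d * py x)) / (a * d - b * c).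
  by field.
have soly x : py x = (a * (c * px x + d * py x) - c * (a * px x + b * py x)) / (a * d - b * c).
  by field.
pose S := `|a| + `|b| + `|c| + `|d|.
have S0 : 0 <= S by rewrite !addr_ge0.
pose C1 := S / `|a * d - b * c|.
have C10 : 0 <= C1 by rewrite divr_ge0.
have lin (e f u w : R) M : `|u| <= M -> `|w| <= M -> `|e * u - f * w| <= (`|e| + `|f|) * M.
  move=> hu hw; apply: le_trans (ler_normB _ _) _; rewrite !normrM mulrDl.
  by apply: lerD; apply: ler_wpM2l.
have bnd x : `|px x| + `|py x| <= C1 * nm x.
  rewrite [X in `|X| + _ <= _](solx x) [X in _ + `|X| <= _](soly x).
  rewrite (normrM _ (_^-1)) (normrM (_ - _) (_^-1)) normfV -mulrDl /C1 mulrAC.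
  rewrite ler_wpM2r ?invr_ge0 //.
  apply: le_trans (lerD (lin _ _ _ _ _ (nm1 x) (nm2 x)) (lin _ _ _ _ _ (nm2 x) (nm1 x))) _.
  by rewrite -mulrDl ler_wpM2r // /S; lra.
exists (Num.sqrt l), nm, (1 + C1 + S); split.
- split=> //.
  + by rewrite -[ltLHS]sqrtr1 ltr_sqrt.
  + move=> x x0; have := bnd x; rewrite x0 mulr0 => h.
    have [hx hy] : `|px x| <= 0 /\ `|py x| <= 0.
      by have := normr_ge0 (px x); have := normr_ge0 (py x); lra.
    by apply: plane_ext; apply/eqP; rewrite !pE -normr_le0.
  + move=> k x; rewrite /nm !pE -sqrtr_sqr -sqrtrM ?sqr_ge0 //.
    by congr Num.sqrt; ring.
  + move=> x y; rewrite /nm !pE; apply: le_trans (sqrt_sum_tri _ _ _ _).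
    by rewrite le_eqVlt; apply/orP; left; apply/eqP; congr Num.sqrt; ring.
  + by move=> x; rewrite /nm -sqrtrM ?(ltW l0) //; exact: ler_wsqrtr (H x).
  + have -> : [set x | nm x < 1] = ~` [set x | - (a ^+ 2 + c ^+ 2) * px x ^+ 2 +
      (- 2 * (a * b + c * d)) * (px x * py x) + (- (b ^+ 2 + d ^+ 2)) * py x ^+ 2 +
      0 * px x + 0 * py x + 0 <= -1].
      have e x : - (a ^+ 2 + c ^+ 2) * px x ^+ 2 +
        (- 2 * (a * b + c * d)) * (px x * py x) + (- (b ^+ 2 + d ^+ 2)) * py x ^+ 2 +
        0 * px x + 0 * py x + 0 = - nm x ^+ 2 by rewrite nmE; ring.
      apply/seteqP; split=> x /=; rewrite e lerN2.
        by move=> h; apply/negP; rewrite -ltNge expr_lt1.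
      by move/negP; rewrite -ltNge expr_lt1.
    by apply: lmeasC; exact: lmeas_quadratic.
- by move: C10 S0; clearbody C1 S; lra.
- move=> x; have h : nm x <= `|a * px x + b * py x| + `|c * px x + d * py x|.
    rewrite -(@ler_pXn2r _ 2) ?nnegrE ?addr_ge0 // nmE.
    move: (a * px x + b * py x) (c * px x + d * py x) => u w.
    rewrite -[u ^+ 2]real_normK ?num_real // -[w ^+ 2]real_normK ?num_real //.
    by have := mulr_ge0 (normr_ge0 u) (normr_ge0 w); lra.
  apply: le_trans h _; apply: le_trans (lerD (ler_normD _ _) (ler_normD _ _)) _.
  rewrite !normrM; have := normr_ge0 (px x); have := normr_ge0 (py x).
  have := normr_ge0 a; have := normr_ge0 b; have := normr_ge0 c; have := normr_ge0 d.
  move: C10; rewrite /S; move: `|px x| `|py x| `|a| `|b| `|c| `|d| => X Y a' b' c' d' *.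
  have e1 : (1 + C1 + (a' + b' + c' + d')) * (X + Y) - (a' * X + b' * Y + (c' * X + d' * Y)) =
    (1 + C1) * (X + Y) + (b' + d') * X + (a' + c') * Y by ring.
  by rewrite -subr_ge0 e1 !addr_ge0 // mulr_ge0 // ?addr_ge0.
- move=> x; apply: le_trans (bnd x) _; rewrite ler_wpM2r //.
  by have := S0; lra.
Qed.

End expansive.

(** * Foldable figures are convex polygons *)

Section euclid.
Context {R : realType}.
Local Notation V := 'cV[R]_2.
Implicit Types (u v w x y z : V) (X Y : set V).

Lemma enormE u : enorm u = Num.sqrt (px u ^+ 2 + py u ^+ 2).
Proof. by rewrite /enorm dotE. Qed.

Lemma enorm_ge0 u : 0 <= enorm u. Proof. exact: sqrtr_ge0. Qed.

Lemma enorm_sqr u : enorm u ^+ 2 = dotcv u u.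
Proof. by rewrite /enorm sqr_sqrtr // dotE addr_ge0 // -expr2 sqr_ge0. Qed.

Lemma enorm_tri u v : enorm (u + v) <= enorm u + enorm v.
Proof. by rewrite !enormE !pE; exact: sqrt_sum_tri. Qed.

Lemma enormZ (a : R) u : enorm (a *: u) = `|a| * enorm u.
Proof.
rewrite !enormE !pE -sqrtr_sqr -sqrtrM ?sqr_ge0 //; congr Num.sqrt; ring.
Qed.

Lemma enormN u : enorm (- u) = enorm u.
Proof. by rewrite -scaleN1r enormZ normrN1 mul1r. Qed.

Lemma enormC u v : enorm (u - v) = enorm (v - u).
Proof. by rewrite -enormN opprB. Qed.

Lemma enorm0 : enorm (0 : V) = 0.
Proof. by rewrite -(scale0r 0) enormZ normr0 mul0r. Qed.

Lemma enorm_eq0 u : enorm u = 0 -> u = 0.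
Proof.
move=> u0; have := enorm_sqr u; rewrite u0 expr0n /= dotE => /esym/eqP.
rewrite paddr_eq0 -?expr2 ?sqr_ge0 // !sqrf_eq0 => /andP[/eqP h1 /eqP h2].
by apply: plane_ext; rewrite !pE.
Qed.

Lemma enorm_gt0 u : u != 0 -> 0 < enorm u.
Proof.
move=> u0; rewrite lt_neqAle enorm_ge0 andbT eq_sym.
by apply: contra_neq u0; exact: enorm_eq0.
Qed.

Lemma enorm_px u : `|px u| <= enorm u.
Proof. by rewrite enormE -sqrtr_sqr; apply: ler_wsqrtr; rewrite lerDl sqr_ge0. Qed.

Lemma enorm_py u : `|py u| <= enorm u.
Proof. by rewrite enormE -sqrtr_sqr; apply: ler_wsqrtr; rewrite lerDr sqr_ge0. Qed.

Lemma enorm_le1 u : enorm u <= `|px u| + `|py u|.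
Proof.
rewrite -(@ler_pXn2r _ 2) ?nnegrE ?addr_ge0 ?enorm_ge0 // enorm_sqr dotE.
move: (px u) (py u) => a b.
have := mulr_ge0 (normr_ge0 a) (normr_ge0 b) => h.
rewrite -!expr2 -[a ^+ 2]real_normK ?num_real // -[b ^+ 2]real_normK ?num_real //.
by lra.
Qed.

Lemma enorm_tri3 x y z : enorm (x - z) <= enorm (x - y) + enorm (y - z).
Proof. by have := enorm_tri (x - y) (y - z); rewrite addrA subrK. Qed.

Lemma nbhs_enormP v X : nbhs v X <-> exists2 e, 0 < e & forall x, enorm (x - v) < e -> X x.
Proof.
split.
  move=> /nbhs_ballP [e /= e0 H]; exists e => // x hx; apply: H; split=> // i j.
  rewrite /ball /= (ord1 j); case: (unliftP ord0 i) => [k ->|->].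
    rewrite (ord1 k) distrC; apply: le_lt_trans hx.
    by have := enorm_py (x - v); rewrite /py !mxE.
  rewrite distrC; apply: le_lt_trans hx.
  by have := enorm_px (x - v); rewrite /px !mxE.
move=> [e e0 H]; apply/nbhs_ballP; exists (e / 2) => /=; first by rewrite divr_gt0.
move=> x [_ hx]; apply: H; apply: le_lt_trans (enorm_le1 _) _.
have := hx ord0 ord0; have := hx (lift ord0 ord0) ord0.
rewrite /ball /= !pE /px /py => h1 h2.
by rewrite [e]splitr; apply: ltrD; rewrite distrC.
Qed.

Lemma openE_enorm X : open X <-> forall v, X v -> exists2 e, 0 < e & forall x, enorm (x - v) < e -> X x.
Proof.
rewrite openE; split=> H v /H; first by move/nbhs_enormP.
by move=> h; apply/nbhs_enormP.
Qed.

Lemma eball_open v (e : R) : open [set x | enorm (x - v) < e].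
Proof.
apply/openE_enorm => y hy; exists (e - enorm (y - v)); first by rewrite subr_gt0.
by move=> x hx; apply: le_lt_trans (enorm_tri3 x y v) _; rewrite -ltrBrDr.
Qed.

Lemma closureE_enorm X v : closure X v <->
  forall e, 0 < e -> exists2 x, X x & enorm (x - v) < e.
Proof.
split.
  move=> H e e0; have [x [Xx hx]] : X `&` [set x | enorm (x - v) < e] !=set0.
    by apply: H; apply/nbhs_enormP; exists e.
  by exists x.
by move=> H A /nbhs_enormP [e /H [x Xx hx] HA]; exists x; split=> //; exact: HA.
Qed.

Lemma closed_enorm X : closed X -> forall v, (forall e, 0 < e -> exists2 x, X x & enorm (x - v) < e) -> X v.
Proof. by move=> cX v H; apply: cX; apply/closureE_enorm. Qed.

Lemma interior_sub X v : interior X v -> X v.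
Proof. exact: interior_subset. Qed.

Lemma compact_closed_plane X : compact X -> closed X.
Proof. by apply: compact_closed; exact: norm_hausdorff. Qed.

Definition lip (f : V -> R) := exists2 C, 0 < C & forall x y, `|f x - f y| <= C * enorm (x - y).

Lemma lip_continuous (f : V -> R) : lip f -> continuous f.
Proof.
move=> [C C0 H] v A /nbhs_ballP [e /= e0 HA]; apply/nbhs_enormP; exists (e / C).
  by rewrite divr_gt0.
move=> x; rewrite ltr_pdivlMr // mulrC enormC => h; apply: HA.
exact: le_lt_trans (H v x) h.
Qed.

Lemma compact_max (f : V -> R) X : compact X -> X !=set0 -> lip f ->
  exists2 x, X x & forall y, X y -> f y <= f x.
Proof.
move=> cX X0 lf.
have [x Xx H] := @compact_EVT_max _ _ f X X0 cX (continuous_subspaceT (lip_continuous lf)).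
exists x; first by rewrite inE in Xx.
by move=> y Xy; apply: H; rewrite inE.
Qed.

Lemma enorm_lip v : lip (fun x => enorm (x - v)).
Proof.
exists 1 => // x y; rewrite mul1r ler_norml; apply/andP; split.
  by have := enorm_tri3 y x v; rewrite (enormC y x); lra.
by have := enorm_tri3 x y v; lra.
Qed.

Lemma dot_lip (n : V) : lip (fun x => dotcv x n).
Proof.
exists (1 + `|px n| + `|py n|); first by have := normr_ge0 (px n); have := normr_ge0 (py n); lra.
move=> x y; rewrite !dotE.
have -> : px x * px n + py x * py n - (px y * px n + py y * py n) =
  px n * px (x - y) + py n * py (x - y) by rewrite !pE; ring.
apply: le_trans (ler_normD _ _) _; rewrite !normrM.
have := enorm_px (x - y); have := enorm_py (x - y); have := enorm_ge0 (x - y).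
have := normr_ge0 (px n); have := normr_ge0 (py n).
move: (enorm _) `|px n| `|py n| `|px (x - y)| `|py (x - y)| => E a b c d b0 a0 E0 hd hc.
by have := ler_wpM2l a0 hc; have := ler_wpM2l b0 hd; lra.
Qed.

Lemma compact_bounded_plane X : compact X -> exists2 M, 0 < M & forall x, X x -> enorm x <= M.
Proof.
move=> cX; have [->|/set0P X0] := eqVneq X set0; first by exists 1.
have [x Xx H] := compact_max cX X0 (enorm_lip 0).
exists (enorm x + 1); first by have := enorm_ge0 x; lra.
by move=> y /H; rewrite !subr0; lra.
Qed.

(** In complex notation, [x] or its conjugate is multiplied by [p + i q] and translated. The sign
    [s] tells the two cases apart, and [s ^+ 2 = 1] lets one calculation treat both. *)
Definition simform (r : R) (f : V -> V) := exists p q s e g : R,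
  [/\ s ^+ 2 = 1, p ^+ 2 + q ^+ 2 = r ^+ 2 & forall x,
   f x = cv2 (p * px x - s * q * py x + e, q * px x + s * p * py x + g)].

Lemma dot_polar u v : dotcv u v = (dotcv u u + dotcv v v - dotcv (u - v) (u - v)) / 2.
Proof. by rewrite !dotE !pE; field. Qed.

(** Polarisation turns preservation of distances up to [r] into preservation of scalar products up
    to [r^2]; the images of the coordinate vectors are then orthogonal of length [r] and determine
    the map. *)
Lemma similitude_form (r : R) f : 0 < r -> similitude r f -> simform r f.
Proof.
move=> r0 H.
have H2 x y : dotcv (f x - f y) (f x - f y) = r ^+ 2 * dotcv (x - y) (x - y).
  by rewrite -!enorm_sqr H exprMn.
pose a := f 0; have [L LE] : exists L, forall x, L x = f x - a by exists (fun x => f x - a).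
have dotL x y : dotcv (L x) (L y) = r ^+ 2 * dotcv x y.
  rewrite dot_polar [X in r ^+ 2 * X]dot_polar.
  have -> : L x - L y = f x - f y by rewrite !LE opprB addrA subrK.
  rewrite !H2 !LE -[X in f X - _]subr0. by rewrite !H2 !subr0; field.
pose e1 : V := cv2 (1, 0); pose e2 : V := cv2 (0, 1).
pose p := px (L e1); pose q := py (L e1); pose p' := px (L e2); pose q' := py (L e2).
have pq : p ^+ 2 + q ^+ 2 = r ^+ 2.
  by have := dotL e1 e1; rewrite !dotE !pE /= -/p -/q; lra.
have pq' : p' ^+ 2 + q' ^+ 2 = r ^+ 2.
  by have := dotL e2 e2; rewrite !dotE !pE /= -/p' -/q'; lra.
have pp : p * p' + q * q' = 0.
  by have := dotL e1 e2; rewrite !dotE !pE /= -/p' -/q' -/p -/q; lra.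
have r20 : r ^+ 2 != 0 by rewrite expf_neq0 // gt_eqF.
(* (p', q') = s (- q, p) *)
pose s := (p * q' - q * p') / r ^+ 2.
have s1 : s ^+ 2 = 1.
  rewrite /s expr_div_n (_ : (p * q' - q * p') ^+ 2 =
    (p ^+ 2 + q ^+ 2) * (p' ^+ 2 + q' ^+ 2) - (p * p' + q * q') ^+ 2); last by ring.
  by rewrite pq pq' pp expr0n subr0 -expr2 divff // expf_neq0.
have hp' : p' = - (s * q).
  have : r ^+ 2 * p' = - (p * q' - q * p') * q.
    rewrite -pq; transitivity (p * (p * p' + q * q') + q * (q * p') - p * q * q'); first by ring.
    by rewrite pp; ring.
  by move=> h; rewrite /s mulrAC -mulNr -mulNr -h mulrAC divff // mul1r.
have hq' : q' = s * p.
  have : r ^+ 2 * q' = (p * q' - q * p') * p.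
    rewrite -pq; transitivity (q * (p * p' + q * q') + p * (p * q') - q * p * p'); first by ring.
    by rewrite pp; ring.
  by move=> h; rewrite /s mulrAC -h mulrAC divff // mul1r.
exists p, q, s, (px a), (py a); split=> // x.
have h1 : p * px (L x) + q * py (L x) = r ^+ 2 * px x.
  have := dotL e1 x; rewrite !dotE !pE /= -/p -/q => ->; ring.
have h2 : p' * px (L x) + q' * py (L x) = r ^+ 2 * py x.
  have := dotL e2 x; rewrite !dotE !pE /= -/p' -/q' => ->; ring.
have D : p * q' - q * p' = s * r ^+ 2 by rewrite /s mulfVK.
have -> : f x = L x + a by rewrite LE subrK.
have hx : px (L x) = p * px x - s * q * py x.
  apply: (mulfI r20); rewrite -{1}pq.
  transitivity (p * (p * px (L x) + q * py (L x)) + q * (q * px (L x) - p * py (L x))); first by ring.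
  have : q * px (L x) - p * py (L x) = - s * (r ^+ 2 * py x).
    by rewrite -h2 hp' hq'; transitivity (s ^+ 2 * (q * px (L x) - p * py (L x))); [rewrite s1; ring|ring].
  by move=> ->; rewrite h1; ring.
have hy : py (L x) = q * px x + s * p * py x.
  apply: (mulfI r20); rewrite -{1}pq.
  transitivity (q * (p * px (L x) + q * py (L x)) - p * (q * px (L x) - p * py (L x))); first by ring.
  have : q * px (L x) - p * py (L x) = - s * (r ^+ 2 * py x).
    by rewrite -h2 hp' hq'; transitivity (s ^+ 2 * (q * px (L x) - p * py (L x))); [rewrite s1; ring|ring].
  by move=> ->; rewrite h1; ring.
by apply: plane_ext; rewrite !pE /= ?hx ?hy.
Qed.

Lemma simform_dot r f x y z w : simform r f ->
  dotcv (f x - f y) (f z - f w) = r ^+ 2 * dotcv (x - y) (z - w).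
Proof.
move=> [p [q [s [e [g [s1 pq F]]]]]]; rewrite !F !dotE !pE /= -pq.
transitivity ((p ^+ 2 + q ^+ 2) * (px (x - y) * px (z - w) + s ^+ 2 * (py (x - y) * py (z - w)))).
  by rewrite !pE; ring.
by rewrite s1 !pE mul1r.
Qed.

Lemma simform_enorm r f x y : 0 <= r -> simform r f -> enorm (f x - f y) = r * enorm (x - y).
Proof.
move=> r0 sf; rewrite /enorm (simform_dot _ _ _ _ sf) sqrtrM ?sqr_ge0 //.
by rewrite sqrtr_sqr ger0_norm.
Qed.

Lemma simform_comp r r' f g : simform r f -> simform r' g -> simform (r * r') (f \o g).
Proof.
move=> [p [q [s [e [h [s1 pq F]]]]]] [p' [q' [s' [e' [h' [s1' pq' F']]]]]].
exists (p * p' - s * q * q'), (q * p' + s * p * q'), (s * s'),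
  (p * e' - s * q * h' + e), (q * e' + s * p * h' + h); split.
- by rewrite exprMn s1 s1' mulr1.
- rewrite exprMn -pq -pq'; transitivity ((p ^+ 2 + q ^+ 2) * (p' ^+ 2 + s ^+ 2 * q' ^+ 2)); first by ring.
  by rewrite s1 mul1r.
- move=> x; rewrite /= F F' !pE /=; congr (cv2 (_, _)).
    transitivity (p * p' * px x - s * q * q' * px x - s * s' * (q * p') * py x
      - s' * p * q' * py x + (p * e' - s * q * h' + e)); first by ring.
    transitivity (p * p' * px x - s * q * q' * px x - s * s' * (q * p') * py x
      - s' * s ^+ 2 * p * q' * py x + (p * e' - s * q * h' + e)); last by ring.
    by rewrite s1 mulr1.
  transitivity (q * p' * px x + s * p * q' * px x + s * s' * (p * p') * py x
      - s' * q * q' * py x + (q * e' + s * p * h' + h)); first by ring.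
  transitivity (q * p' * px x + s * p * q' * px x + s * s' * (p * p') * py x
      - s' * s ^+ 2 * q * q' * py x + (q * e' + s * p * h' + h)); last by ring.
  by rewrite s1 mulr1.
Qed.

Lemma simform_inv r f : r != 0 -> simform r f ->
  exists g, [/\ simform r^-1 g, cancel f g & cancel g f].
Proof.
move=> r0 [p [q [s [e [h [s1 pq F]]]]]].
have r2 : r ^+ 2 != 0 by rewrite expf_neq0.
have sq0 : p ^+ 2 + q ^+ 2 != 0 by rewrite pq.
pose P := p / r ^+ 2; pose Q := - s * q / r ^+ 2.
pose g x : V := cv2 (P * px x - s * Q * py x - (P * e - s * Q * h),
   Q * px x + s * P * py x - (Q * e + s * P * h)).
have s4 a : s * (s * a) = a by rewrite mulrA -expr2 s1 mul1r.
have fK : cancel f g.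
  move=> x; rewrite /g F; apply: plane_ext; rewrite !pE /= /P /Q -pq.
    have -> : px x = ((p ^+ 2 + q ^+ 2) / (p ^+ 2 + q ^+ 2)) * px x by rewrite divff // mul1r.
    transitivity ((p ^+ 2 * px x + s ^+ 2 * q ^+ 2 * px x + (s ^+ 2 - 1) * s * p * q * py x) / (p ^+ 2 + q ^+ 2)).
      by field.
    by rewrite s1; field.
  transitivity ((s ^+ 2 * (p ^+ 2 + q ^+ 2) * py x) / (p ^+ 2 + q ^+ 2)).
    by field.
  by rewrite s1; field.
have gK : cancel g f.
  move=> x; rewrite F /g; apply: plane_ext; rewrite !pE /= /P /Q -pq.
    transitivity ((p ^+ 2 * (px x - e) + s ^+ 2 * q ^+ 2 * (px x - e)) / (p ^+ 2 + q ^+ 2) + e).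
      by field.
    by rewrite s1; field.
  transitivity (((1 - s ^+ 2) * (q * p) * (px x - e) + s ^+ 2 * q ^+ 2 * (py x - h) + s ^+ 2 * p ^+ 2 * (py x - h)) / (p ^+ 2 + q ^+ 2) + h).
    by field.
  by rewrite s1; field.
exists g; split=> //; exists P, Q, s, (- (P * e - s * Q * h)), (- (Q * e + s * P * h)); split=> //.
transitivity ((p ^+ 2 + s ^+ 2 * q ^+ 2) / r ^+ 2 ^+ 2); first by rewrite /P /Q; field.
by rewrite s1 mul1r pq; field.
Qed.

Lemma simform_affine r f : r != 0 -> simform r f -> affine_bij f.
Proof.
move=> r0 [p [q [s [e [g [s1 pq F]]]]]].
exists p, (- (s * q)), q, (s * p), e, g; split; last by move=> x; rewrite F mulNr.
have -> : p * (s * p) - - (s * q) * q = s * (p ^+ 2 + q ^+ 2) by ring.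
rewrite mulf_neq0 // ?pq ?expf_neq0 //.
by apply/eqP => s0; move: s1; rewrite s0 expr0n /= => /eqP; rewrite eq_sym oner_eq0.
Qed.

Lemma reflection_simform (h : V * R) : h.1 != 0 -> simform 1 (reflection h).
Proof.
case: h => a c /= a0; have D : px a ^+ 2 + py a ^+ 2 != 0.
  by have := enorm_sqr a; rewrite dotE -!expr2 => <-; rewrite expf_neq0 // gt_eqF // enorm_gt0.
exists ((py a ^+ 2 - px a ^+ 2) / (px a ^+ 2 + py a ^+ 2)),
  (- 2 * px a * py a / (px a ^+ 2 + py a ^+ 2)), (-1),
  (2 * c * px a / (px a ^+ 2 + py a ^+ 2)), (2 * c * py a / (px a ^+ 2 + py a ^+ 2)); split.
- by rewrite sqrrN expr1n.
- by field.
- by move=> x; rewrite /reflection /=; apply: plane_ext; rewrite !pE /= !dotE; field.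
Qed.

End euclid.

(** * Subfigures as similar copies of the figure *)

Section folding.
Context {R : realType}.
Local Notation V := 'cV[R]_2.
Implicit Types (u v w x y z : V) (X Y F P : set V) (S : seq (V * R)) (f g : V -> V).

Lemma simform_continuous (r : R) f : 0 < r -> simform r f -> continuous f.
Proof.
move=> r0 sf v A /nbhs_enormP [e e0 HA]; apply/nbhs_enormP; exists (e / r); first by rewrite divr_gt0.
by move=> x hx; apply: HA; rewrite (simform_enorm _ _ (ltW r0) sf) mulrC -ltr_pdivlMr.
Qed.

(** If [x] were missed, the compact image would stay at some distance [d] from it. As the map
    decreases no distance, the iterates of [x] would be pairwise at least [d] apart, which
    compactness forbids. *)
Lemma expanding_self_map_onto (r : R) f X : compact X -> simform r f -> 1 <= r ->
  f @` X `<=` X -> X `<=` f @` X.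
Proof.
move=> cX sf r1 fX x Xx; apply: contrapT => nfx.
have r0 : 0 < r by exact: lt_le_trans ltr01 r1.
have cfX : closed (f @` X).
  apply: compact_closed_plane; apply: continuous_compact => //.
  apply: continuous_subspaceT; exact: simform_continuous r0 sf.
have [d d0 hd] : exists2 d, 0 < d & forall y, X y -> d <= enorm (f y - x).
  apply: contrapT => H; apply: nfx; apply: (closed_enorm cfX) => e e0.
  apply: contrapT => H2; apply: H; exists e => // y Xy; rewrite leNgt; apply/negP => h.
  by apply: H2; exists (f y) => //; exists y.
pose u n := iter n f x.
have uX n : X (u n) by elim: n => [//|n IH]; apply: fX; exists (u n).
have sep m n : d <= enorm (u (m + n.+1)%N - u m).
  elim: m => [|m IH]; first by rewrite add0n; exact: hd.
  apply: le_trans IH _; rewrite addSn /u /= (simform_enorm _ _ (ltW r0) sf).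
  by rewrite ler_peMl ?enorm_ge0.
have [p [_ cp]] := cX (u @ \oo) _ (ltac:(by exists 0%N => // n _; exact: uX)).
have B : nbhs p [set y | enorm (y - p) < d / 2] by apply/nbhs_enormP; exists (d / 2) => //; rewrite divr_gt0.
have [_ [[n1 _ <-] h1]] := cp (range u) _ (ltac:(by exists 0%N => // n _; exists n)) B.
have [_ [[n2 /= n12 <-] h2]] := cp (u @` [set n | (n1 < n)%N]) _
  (ltac:(by exists n1.+1 => // n /= h; exists n)) B.
have := sep n1 (n2 - n1.+1)%N; rewrite addnS -addSn subnKC // leNgt => /negP; apply.
apply: le_lt_trans (enorm_tri3 _ p _) _; rewrite [X in _ < X]splitr; apply: ltrD => //.
by rewrite enormC.
Qed.

Lemma subfigure_sub S F P : closed F -> subfigure S F P -> P `<=` F.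
Proof.
move=> cF [x _ <-] y /closureE_enorm H; apply: (closed_enorm cF) => e /H [z [Fz _] hz].
by exists z.
Qed.

(** What is kept of foldability: one ratio [r < 1] for all subfigures, and reflections that carry
    subfigures onto subfigures and not merely into them. *)
Record folding F S (r : R) : Prop := Folding {
  fo_compact : compact F;
  fo_nz : forall h, h \in S -> h.1 != 0;
  fo_gt0 : 0 < r;
  fo_lt1 : r < 1;
  fo_map : forall P, subfigure S F P -> exists2 f, simform r f & f @` F = P;
  fo_refl : forall P h, subfigure S F P -> h \in S -> bounding P h ->
    subfigure S F (reflection h @` P) }.

Lemma foldable_folding F : foldable F -> exists S r, folding F S r.
Proof.
move=> [cF _ [S [S0 [P0 [Q0 [sP0 sQ0 PQ0]]] hcong hsim hrefl]]].
have clF := compact_closed_plane cF.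
have [r0 [r0gt [f0 sf0 fP0]]] := hsim _ sP0.
have {}sf0 := similitude_form r0gt sf0.
have [g0 [sg0 f0K g0K]] := simform_inv (lt0r_neq0 r0gt) sf0.
have r0V : 0 < r0^-1 by rewrite invr_gt0.
have maps P : subfigure S F P -> exists2 f, simform r0^-1 f & f @` F = P.
  move=> sP; have [k sk kP] := hcong _ _ sP0 sP.
  have {}sk := similitude_form ltr01 sk.
  exists (k \o g0); first by rewrite -[r0^-1]mul1r; exact: simform_comp.
  rewrite -kP -fP0; apply/seteqP; split=> [_ [_ [x P0x <-] <-]|_ [x P0x <-]].
    by exists x => //=; rewrite f0K.
  by exists (f0 x); [exists x|rewrite /= f0K].
have compP P : subfigure S F P -> compact P.
  move=> sP; have [f sf <-] := maps P sP; apply: continuous_compact => //.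
  apply: continuous_subspaceT; exact: simform_continuous r0V sf.
exists S, r0^-1; split=> //.
(* With a ratio of at least [1] each subfigure would be the whole figure, yet there are two
   different ones. *)
- rewrite ltNge; apply/negP => r1.
  have PF P : subfigure S F P -> P = F.
    move=> sP; have [f sf fP] := maps P sP.
    have PsF := subfigure_sub clF sP.
    apply/seteqP; split=> //; rewrite -fP; apply: expanding_self_map_onto sf r1 _ => //.
    by rewrite fP.
  by apply: PQ0; rewrite (PF _ sP0) (PF _ sQ0).
(* The target [Q] is a congruent copy of [P]; carrying it back to [P] turns the reflection into an
   isometry of the compact set [P] into itself, which is onto. *)
- move=> P h sP hS bP; have [Q sQ PQ] := hrefl _ _ sP hS bP.
  have [k sk kP] := hcong _ _ sP sQ.
  have {}sk := similitude_form ltr01 sk.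
  have [k' [sk' kK k'K]] := simform_inv (oner_neq0 _) sk.
  suff -> : reflection h @` P = Q by [].
  apply/seteqP; split=> //.
  have sfn : simform 1 (k' \o reflection h).
    by rewrite -[1]mul1r -{1}invr1; apply: simform_comp => //; exact: (reflection_simform (S0 _ hS)).
  have H : (k' \o reflection h) @` P `<=` P.
    move=> _ [x Px <-] /=; have : Q (reflection h x) by apply: PQ; exists x.
    by rewrite -kP => -[y Py <-]; rewrite kK.
  move=> q; rewrite -kP => -[y Py <-].
  have [x Px /= <-] := expanding_self_map_onto (compP _ sP) sfn (lexx _) H Py.
  by exists x => //; rewrite k'K.
Qed.

Definition offlines S x := forall h, h \in S -> dotcv x h.1 != h.2.

Lemma offlinesP S x : offlines S x <-> ~ cut_locus S x.
Proof.
split; first by move=> H [h /H /eqP hx /= e]; exact: hx.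
by move=> H h hS; apply/eqP => e; apply: H; exists h.
Qed.

Lemma near_offlines S : (forall h, h \in S -> h.1 != 0) -> forall v (e : R), 0 < e ->
  exists2 x, enorm (x - v) < e & offlines S x.
Proof.
suff H : (forall h, h \in S -> h.1 != 0) -> forall v (e : R), 0 < e -> exists x d,
    [/\ 0 < d, forall y, enorm (y - x) < d -> enorm (y - v) < e &
        forall y, enorm (y - x) < d -> offlines S y].
  move=> S0 v e e0; have [x [d [d0 h1 h2]]] := H S0 v e e0.
  by exists x; [apply: h1|apply: h2]; rewrite subrr enorm0.
elim: S => [|h S IH] S0 v e e0; first by exists v, e; split=> // y _ h; rewrite in_nil.
have hn0 : h.1 != 0 by apply: S0; rewrite mem_head.
have [x [d [d0 h1 h2]]] := IH (fun k kS => S0 k (@mem_behead _ (h :: S) k kS)) v e e0.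
have hn := enorm_gt0 hn0.
have [x' hx' hx'n] : exists2 x', enorm (x' - x) < d & dotcv x' h.1 != h.2.
  have [e1|ne] := eqVneq (dotcv x h.1) h.2; last by exists x; rewrite // subrr enorm0.
  exists (x + (d / 2 / enorm h.1) *: h.1).
    rewrite addrC addKr enormZ normrM normfV (ger0_norm (enorm_ge0 _)) mulfVK ?gt_eqF //.
    by rewrite gtr0_norm ?divr_gt0 //; lra.
  have -> : dotcv (x + (d / 2 / enorm h.1) *: h.1) h.1 = dotcv x h.1 + d / 2 / enorm h.1 * dotcv h.1 h.1.
    by rewrite !dotE !pE; ring.
  rewrite -enorm_sqr e1 (_ : _ / enorm h.1 * _ = d / 2 * enorm h.1); last first.
    by field; rewrite gt_eqF.
  by apply/eqP => e2; have := mulr_gt0 d0 hn; lra.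
have [C C0 hC] := dot_lip h.1.
pose g := `|dotcv x' h.1 - h.2|; have g0 : 0 < g by rewrite normr_gt0 subr_eq0.
exists x', (Num.min (d - enorm (x' - x)) (g / C)); split.
- by rewrite lt_min subr_gt0 hx' divr_gt0.
- move=> y; rewrite lt_min => /andP[hy _]; apply: h1.
  by apply: le_lt_trans (enorm_tri3 y x' x) _; rewrite -ltrBrDr.
- move=> y; rewrite lt_min => /andP[hy hy2] k; rewrite in_cons => /orP[/eqP ->|kS].
    apply/eqP => ey; move: hy2; rewrite ltr_pdivlMr // mulrC => hy2.
    by have := le_lt_trans (hC _ _) hy2; rewrite ey distrC /g ltxx.
  by apply: h2 => //; apply: le_lt_trans (enorm_tri3 y x' x) _; rewrite -ltrBrDr.
Qed.

Lemma cell_sub S F x : F x -> offlines S x -> subfigure S F (closure (F `&` cell S x)).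
Proof. by move=> Fx ox; exists x => //; split=> //; exact/offlinesP. Qed.

Lemma cell_refl S x : offlines S x -> cell S x x.
Proof.
move=> ox h hS; rewrite -expr2 lt_neqAle sqr_ge0 andbT eq_sym sqrf_eq0 subr_eq0.
exact: ox.
Qed.

Lemma closure_cell_side S F x y h : closure (F `&` cell S x) y -> h \in S ->
  0 <= (dotcv x h.1 - h.2) * (dotcv y h.1 - h.2).
Proof.
move=> /closureE_enorm H hS; rewrite leNgt; apply/negP => neg.
have [C C0 hC] := dot_lip h.1.
set a := dotcv x h.1 - h.2 in neg; set b := dotcv y h.1 - h.2 in neg.
have a0 : a != 0 by apply/eqP => a0; move: neg; rewrite a0 mul0r ltxx.
have b0 : 0 < `|b| by rewrite normr_gt0; apply/eqP => b0; move: neg; rewrite b0 mulr0 ltxx.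
have [z [_ cz] hz] := H (`|b| / C) (divr_gt0 b0 C0).
move: hz; rewrite ltr_pdivlMr // mulrC => hz.
have hb := le_lt_trans (hC z y) hz.
have := cz h hS; rewrite -/a.
have e : dotcv z h.1 - dotcv y h.1 = (dotcv z h.1 - h.2) - b by rewrite /b; ring.
move: hb; rewrite e; set c := dotcv z h.1 - h.2 => hb ac.
move: hb; rewrite real_ltr_norml ?num_real //.
have [b1|b1] := lerP 0 b; rewrite ?(ger0_norm b1) ?(ltr0_norm b1) => /andP[h1 h2].
  have : 0 < c by lra.
  by have : a < 0; [rewrite ltNge; apply/negP => a1; move: neg; rewrite ltNge mulr_ge0|nra].
have : c < 0 by lra.
have : 0 < a by rewrite ltNge; apply/negP => a1; move: neg; rewrite ltNge mulr_le0 // ltW.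
by nra.
Qed.

Lemma cell_nbhs S c1 : offlines S c1 ->
  exists2 k, 0 < k & forall y, enorm (y - c1) < k -> cell S c1 y.
Proof.
rewrite /offlines /cell; elim: S => [|h L IH] oL; first by exists 1.
have [|k1 k10 hk1] := IH; first by move=> h' h'L; apply: oL; rewrite in_cons h'L orbT.
have [C C0 hC] := dot_lip h.1.
have hn : dotcv c1 h.1 - h.2 != 0 by rewrite subr_eq0; apply: oL; rewrite mem_head.
have a0 : 0 < `|dotcv c1 h.1 - h.2| by rewrite normr_gt0.
exists (Num.min k1 (`|dotcv c1 h.1 - h.2| / C)); first by rewrite lt_min k10 divr_gt0.
move=> z; rewrite lt_min => /andP[z1 z2] h'; rewrite in_cons => /orP[/eqP ->|]; last exact: hk1.
move: z2; rewrite ltr_pdivlMr // mulrC => z2; have := le_lt_trans (hC z c1) z2.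
rewrite (_ : dotcv z h.1 - dotcv c1 h.1 = (dotcv z h.1 - h.2) - (dotcv c1 h.1 - h.2)); last by ring.
move: hn; set a := dotcv c1 h.1 - h.2; set b := dotcv z h.1 - h.2 => hn.
rewrite ltr_norml => /andP[b1 b2].
have [a1|a1] := ltrP 0 a; first by rewrite (gtr0_norm a1) in b1; rewrite mulr_gt0 //; lra.
have {}a1 : a < 0 by rewrite lt_neqAle hn.
by rewrite (ltr0_norm a1) in b2; rewrite nmulr_rgt0 //; lra.
Qed.

End folding.

(** * Magnification at interior points *)

Section zoom.
Context {R : realType}.
Local Notation V := 'cV[R]_2.
Implicit Types (u v w x y z : V) (X Y P : set V) (f g : V -> V).

Definition inL (L : seq (V * R)) x := forall h, h \in L -> dotcv x h.1 <= h.2.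

Lemma inL_cat L L' x : inL (L ++ L') x <-> inL L x /\ inL L' x.
Proof.
split=> [H|[H1 H2] h]; last by rewrite mem_cat => /orP[/H1|/H2].
by split=> h hL; apply: H; rewrite mem_cat hL ?orbT.
Qed.

Lemma dot_line x y n (t : R) :
  dotcv (x + t *: (y - x)) n = dotcv x n + t * (dotcv y n - dotcv x n).
Proof. by rewrite !dotE !pE; ring. Qed.

Lemma simform_pullback (r : R) f : simform r f -> exists phi : V * R -> V * R, forall h x,
  (dotcv (f x) h.1 <= h.2) = (dotcv x (phi h).1 <= (phi h).2).
Proof.
move=> [p [q [s [e [g [_ _ F]]]]]].
exists (fun h => (cv2 (p * px h.1 + q * py h.1, - s * q * px h.1 + s * p * py h.1),
   h.2 - (e * px h.1 + g * py h.1))) => h x /=.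
by rewrite F !dotE !pE /= lerBrDr; congr (_ <= _); ring.
Qed.

Lemma simform_interior (r : R) f X x : 0 < r -> simform r f -> interior (f @` X) (f x) -> interior X x.
Proof.
move=> r0 sf /nbhs_enormP [e e0 H]; apply/nbhs_enormP; exists (e / r); first by rewrite divr_gt0.
move=> y hy.
have [z Xz fzy] : (f @` X) (f y).
  by apply: H; rewrite (simform_enorm _ _ (ltW r0) sf) mulrC -ltr_pdivlMr.
have [g [_ fK _]] := simform_inv (lt0r_neq0 r0) sf.
by rewrite -(fK y) -fzy fK.
Qed.

Lemma interior_open_near X x y : interior X x -> exists2 e, 0 < e & forall y, enorm (y - x) < e -> interior X y.
Proof.
move=> /nbhs_enormP [e e0 H]; exists e => // z hz; apply/nbhs_enormP.
exists (e - enorm (z - x)); first by rewrite subr_gt0.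
move=> w hw; apply: H; apply: le_lt_trans (enorm_tri3 w z x) _; by rewrite -ltrBrDr.
Qed.

Section fixed.
Variables (F : set V) (S : seq (V * R)) (r : R).
Hypothesis fo : folding F S r.

Let r0 := fo_gt0 fo.
Let r1 := fo_lt1 fo.

(* pulling back a subfigure chosen near [c] *)
Lemma pull_step c (e : R) : interior F c -> 0 < e -> exists c1 P f c',
  [/\ enorm (c1 - c) < e, offlines S c1 /\ F c1, P = closure (F `&` cell S c1) /\ subfigure S F P,
     simform r f /\ f @` F = P & f c' = c1 /\ interior F c'].
Proof.
move=> iF e0; have [d d0 hd] := interior_open_near c iF.
have de : 0 < Num.min d e by rewrite lt_min d0.
have [c1 hc1 oc1] := near_offlines (fo_nz fo) c de.
move: hc1; rewrite lt_min => /andP[h1 h2].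
have ic1 := hd _ h1; have Fc1 := interior_sub ic1.
have sP := cell_sub Fc1 oc1.
have [f sf fP] := fo_map fo sP.
have [y Fy fy] : (f @` F) c1.
  by rewrite fP; apply: subset_closure; split=> //; exact: cell_refl.
exists c1, (closure (F `&` cell S c1)), f, y; split=> //; split=> //.
apply: (simform_interior r0 sf); rewrite fP fy.
have /nbhs_enormP [k k0 hk] := ic1.
have := cell_nbhs oc1.
move=> [k' k'0 hk']; apply/nbhs_enormP; exists (Num.min k k'); first by rewrite lt_min k0.
move=> z; rewrite lt_min => /andP[z1 z2]; apply: subset_closure; split; [exact: hk|exact: hk'].
Qed.

(** In a window of radius [rho] the figure is an intersection of half-planes. The centre is kept
    interior so that the magnification can be repeated. *)
Definition polyat c (rho : R) := interior F c /\
  exists L, forall x, enorm (x - c) < rho -> (F x <-> inL L x).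

(** A subfigure through a point [c1] near [c] is, inside the window, cut out by the half-planes of
    the figure and by the cutting lines. The similarity onto it has ratio [r], so pulling back
    divides the radius by [r]. *)
Lemma polyat_step c rho rho' : polyat c rho -> 0 < rho' -> rho' < rho ->
  exists c', polyat c' (rho' / r).
Proof.
move=> [iF [L HL]] rho'0 lt_rho.
have e0 : 0 < rho - rho' by rewrite subr_gt0.
have [c1 [P [f [c' [hc1 [oc1 Fc1] [defP sP] [sf fP] [fc' ic']]]]]] := pull_step iF e0.
have clF := compact_closed_plane (fo_compact fo).
exists c'; split=> //.
have [phi phiP] := simform_pullback sf.
pose side h := if dotcv c1 h.1 < h.2 then h else (- h.1, - h.2) : V * R.
exists (map phi (L ++ map side S)) => x hx.
have -> : inL (map phi (L ++ map side S)) x <-> inL (L ++ map side S) (f x).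
  split=> H h hL; first by rewrite phiP; apply: H; exact: map_f.
  by move/mapP: hL => [h' h'L ->]; rewrite -phiP; exact: H.
have -> : F x <-> P (f x).
  rewrite -fP; split=> [Fx|[y Fy fyx]]; first by exists x.
  have [g [_ fK _]] := simform_inv (lt0r_neq0 r0) sf.
  by rewrite -(fK x) -fyx fK.
have {hx} : enorm (f x - c1) < rho'.
  by rewrite -fc' (simform_enorm _ _ (ltW r0) sf) mulrC -ltr_pdivlMr.
move: (f x) => y hy.
have inball z : enorm (z - c1) < rho' -> enorm (z - c) < rho.
  by move=> hz; have := enorm_tri3 z c1 c; lra.
have sideP h z : h \in S -> (dotcv z (side h).1 <= (side h).2) =
    (0 <= (dotcv c1 h.1 - h.2) * (dotcv z h.1 - h.2)).
  move=> hS; rewrite /side; have := oc1 h hS.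
  case: ltgtP => // hlt _.
    by rewrite nmulr_rge0 ?subr_lt0 // subr_le0.
  rewrite pmulr_rge0 ?subr_gt0 // subr_ge0 /=.
  have -> : dotcv z (- h.1) = - dotcv z h.1 by rewrite !dotE !pE; ring.
  by rewrite lerN2.
rewrite inL_cat; split=> [Py|[Ly Sy]].
  split.
    by apply/HL; [exact: inball|exact: (subfigure_sub clF sP)].
  move=> _ /mapP [h hS ->]; rewrite sideP //; move: Py; rewrite defP => Py.
  exact: (closure_cell_side Py hS).
(* A point that satisfies the closed inequalities is approached from the open cell by moving it
   slightly towards [c1], which is strictly on the right side of every cutting line. *)
rewrite defP; apply/closureE_enorm => e ee.
have Lc1 : inL L c1.
  by apply/HL => //; apply: inball; rewrite subrr enorm0.
pose t := Num.min 1 (e / (1 + enorm (c1 - y))) / 2.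
have d0 : 0 < 1 + enorm (c1 - y) by have := enorm_ge0 (c1 - y); lra.
have m0 : 0 < Num.min 1 (e / (1 + enorm (c1 - y))) by rewrite lt_min ltr01 divr_gt0.
have t0 : 0 < t by rewrite divr_gt0.
have t1 : t < 1.
  have : Num.min 1 (e / (1 + enorm (c1 - y))) <= 1 by rewrite ge_min lexx.
  by rewrite /t; lra.
have te : t * enorm (c1 - y) < e.
  have : t < e / (1 + enorm (c1 - y)).
    have : Num.min 1 (e / (1 + enorm (c1 - y))) <= e / (1 + enorm (c1 - y)).
      by rewrite ge_min lexx orbT.
    by rewrite /t in t0 *; lra.
  by rewrite ltr_pdivlMr // => h; have := enorm_ge0 (c1 - y); lra.
exists (y + t *: (c1 - y)); last by rewrite addrC addKr enormZ gtr0_norm.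
have bz : enorm (y + t *: (c1 - y) - c1) < rho'.
  have -> : y + t *: (c1 - y) - c1 = (1 - t) *: (y - c1).
    by apply: plane_ext; rewrite !pE; ring.
  rewrite enormZ ger0_norm; last by lra.
  by have := enorm_ge0 (y - c1); nra.
split.
  apply/HL; first exact: inball.
  move=> h hL; rewrite dot_line; have := Lc1 h hL; have := Ly h hL.
  by move: (dotcv _ _) (dotcv _ _) h.2 => a b k; nra.
move=> h hS; rewrite dot_line; have := Sy (side h) (map_f _ hS); rewrite sideP //.
have := cell_refl oc1 hS; move: (dotcv c1 _) (dotcv y _) h.2 => a b k ha hab.
rewrite (_ : _ * _ = (1 - t) * ((a - k) * (b - k)) + t * ((a - k) * (a - k))); last by ring.
by apply: ltr_wpDl; [rewrite mulr_ge0 //; lra|rewrite mulr_gt0].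
Qed.

Lemma polyat_large c rho (M : R) : 0 < rho -> polyat c rho -> exists c' rho', M < rho' /\ polyat c' rho'.
Proof.
(* The mean of [1] and [1 / r]: a step starts from a radius strictly below [rho], so part of the
   gain is given up. *)
move=> rho0 pc; pose k := (1 + r) / (2 * r).
have k1 : 1 < k by rewrite /k ltr_pdivlMr ?mulr_gt0 //; have := r1; lra.
have k0 : 0 < k by lra.
have step (n : nat) : exists c', polyat c' (k ^+ n * rho).
  elim: n => [|n [c1 IH]]; first by exists c; rewrite expr0 mul1r.
  have kn : 0 < k ^+ n * rho by rewrite mulr_gt0 // exprn_gt0.
  have [||c' hc'] := polyat_step (rho' := k ^+ n * rho * ((1 + r) / 2)) IH.
  - by rewrite mulr_gt0 //; have := r0; lra.
  - by have := r1; nra.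
  exists c'; move: hc'; congr polyat; rewrite exprS /k; field.
  by rewrite gt_eqF.
have [n hn] := expr_unbounded (M / rho) k1.
have [c' pc'] := step n; exists c', (k ^+ n * rho); split=> //.
by rewrite -ltr_pdivrMr.
Qed.

End fixed.
End zoom.

Section polygon.
Context {R : realType}.
Local Notation V := 'cV[R]_2.
Implicit Types (u v w x y z : V) (X Y P : set V) (f g : V -> V).
Variables (F : set V) (S : seq (V * R)) (r : R).
Hypotheses (fo : folding F S r) (iF0 : interior F 0).

Let r0 := fo_gt0 fo.
Let r1 := fo_lt1 fo.

(** The window is taken wider than the diameter bound [2 M]. A point of the half-plane intersection
    outside it would produce, on the segment from [c], a point of the figure at distance [2 M + 1]
    from [c]. *)
Lemma folding_polygon : exists2 L : seq (V * R), (forall h, h \in L -> h.1 != 0) &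
  forall x, F x <-> inL L x.
Proof.
have [M M0 hM] := compact_bounded_plane (fo_compact fo).
have /nbhs_enormP [e e0 he] := iF0.
have p0 : polyat F 0 e.
  by split=> //; exists [::] => x hx; split=> [_ h|_]; [rewrite in_nil|apply: he].
have [c [rho [hrho [ic [L HL]]]]] := polyat_large fo (2 * M + 1) e0 p0.
have Fc := interior_sub ic.
have D x : F x -> enorm (x - c) <= 2 * M.
  move=> Fx; have := enorm_tri x (- c); rewrite enormN; have := hM x Fx; have := hM c Fc; lra.
have Lc : inL L c by apply/HL => //; rewrite subrr enorm0; lra.
exists [seq h <- L | h.1 != 0]; first by move=> h; rewrite mem_filter => /andP[].
move=> x; split.
  move=> Fx h; rewrite mem_filter => /andP[_]; apply: (_ : inL L x); apply/HL => //.
  by apply: le_lt_trans (D x Fx) _; lra.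
move=> Lx'; have Lx : inL L x.
  move=> h hL; have [h0|h0] := eqVneq h.1 0; last by apply: Lx'; rewrite mem_filter h0.
  by have := Lc h hL; rewrite h0 !dotE !pE !mulr0.
have [hx|hx] := ltrP (enorm (x - c)) rho; first exact/HL.
exfalso; pose t := (2 * M + 1) / enorm (x - c).
have d0 : 0 < enorm (x - c) by apply: lt_le_trans hx; lra.
have t0 : 0 < t by rewrite divr_gt0 //; lra.
have t1 : t < 1 by rewrite /t ltr_pdivrMr // mul1r; exact: lt_le_trans hx.
have E : enorm (c + t *: (x - c) - c) = 2 * M + 1.
  by rewrite addrC addKr enormZ gtr0_norm // /t mulfVK // gt_eqF.
have Fz : F (c + t *: (x - c)).
  apply/HL; first by rewrite E.
  move=> h hL; rewrite dot_line; have := Lc h hL; have := Lx h hL.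
  by move: (dotcv _ _) (dotcv _ _) h.2 => a b k; nra.
by have := D _ Fz; rewrite E; lra.
Qed.

(** Addresses of pieces in the repeated subdivision. The new factor [f] is applied first, so an
    induction can follow a corner of the figure to the point [f v] of a subfigure and go on with the
    shorter word [g]. *)
Inductive word : (V -> V) -> Prop :=
| word_id : word id
| word_comp g f P : word g -> subfigure S F P -> simform r f -> f @` F = P -> word (g \o f).

Lemma word_simform n g c (e : R) : 0 < e -> interior F c -> enorm (g c) < e -> word g ->
  simform (r ^+ n) g -> exists f c', [/\ word (g \o f), interior F c', enorm (g (f c')) < e
   & simform (r ^+ n.+1) (g \o f)].
Proof.
move=> e0 ic hc wg sg.
have rn0 : 0 < r ^+ n by rewrite exprn_gt0.
have d0 : 0 < (e - enorm (g c)) / r ^+ n by rewrite divr_gt0 // subr_gt0.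
have [c1 [P [f [c' [hc1 _ [_ sP] [sf fP] [fc' ic']]]]]] := pull_step fo ic d0.
exists f, c'; split=> //.
- exact: word_comp wg sP sf fP.
- rewrite fc'; have := enorm_tri (g c1 - g c) (g c); rewrite subrK.
  rewrite (simform_enorm _ _ (ltW rn0) sg).
  by move: hc1; rewrite ltr_pdivlMr // mulrC; lra.
- by rewrite exprSr; exact: simform_comp.
Qed.

(** Pieces chosen around points near [0] shrink like [r ^+ n], so a deep one lies within a ball of
    interior points; its diameter is at most [2 M r^n], made smaller than [e / 2]. *)
Lemma deep_word : exists2 g, word g & forall x, F x -> interior F (g x).
Proof.
have [M M0 hM] := compact_bounded_plane (fo_compact fo).
have [e e0 he] := interior_open_near 0 iF0.
have e2 : 0 < e / 2 by rewrite divr_gt0.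
have step n : exists g c, [/\ word g, interior F c, enorm (g c) < e / 2 & simform (r ^+ n) g].
  elim: n => [|n [g [c [wg ic hc sg]]]].
    exists id, 0; split=> //; [exact: word_id|by rewrite enorm0|rewrite expr0].
    exists 1, 0, 1, 0, 0; split; rewrite ?expr1n ?expr0n ?addr0 //.
    by move=> x; apply: plane_ext; rewrite !pE /=; ring.
  have [f [c' [? ? ? ?]]] := word_simform e2 ic hc wg sg.
  by exists (g \o f), c'.
have rV : 1 < r^-1 by rewrite invf_gt1.
have [n hn] := expr_unbounded (4 * M / e) rV.
have [g [c [wg ic hc sg]]] := step n.
exists g => // x Fx; apply: he; rewrite subr0.
have rn0 : 0 < r ^+ n by rewrite exprn_gt0.
have := enorm_tri (g x - g c) (g c); rewrite subrK (simform_enorm _ _ (ltW rn0) sg).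
have D : enorm (x - c) <= 2 * M.
  have := enorm_tri x (- c); rewrite enormN; have := hM x Fx; have := hM c (interior_sub ic); lra.
move: hn; rewrite exprVn -[X in _ < X]mul1r ltr_pdivlMr // mulrAC ltr_pdivrMr // mul1r.
by move: hc D; move: (enorm (x - c)) (enorm (g x)) (enorm (g c)) => a b d *; nra.
Qed.

End polygon.

(** * Corners of foldable figures *)

Section wedges.
Context {R : realType}.
Local Notation V := 'cV[R]_2.
Implicit Types (u v w x y z : V) (X Y P : set V) (f g : V -> V) (s a phi t : R).

Definition cr u v : R := px u * py v - py u * px v.
Definition dirv t : V := cv2 (cos t, sin t).
Definition norv t : V := cv2 (- sin t, cos t).

Lemma crC u v : cr u v = - cr v u. Proof. by rewrite /cr; ring. Qed.
Lemma cr_dir a t : cr (dirv a) (dirv t) = sin (t - a).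
Proof. by rewrite /cr !pE /= sinB; ring. Qed.
Lemma dir_dir t : dotcv (dirv t) (dirv t) = 1.
Proof. by rewrite dotE !pE /= -!expr2 cos2Dsin2. Qed.
Lemma enorm_dir t : enorm (dirv t) = 1.
Proof. by rewrite /enorm dir_dir sqrtr1. Qed.
Lemma dot_nor u t : dotcv u (norv t) = cr (dirv t) u.
Proof. by rewrite dotE /cr !pE /=; ring. Qed.
Lemma crZl (k : R) u v : cr (k *: u) v = k * cr u v.
Proof. by rewrite /cr !pE; ring. Qed.
Lemma crZr (k : R) u v : cr u (k *: v) = k * cr u v.
Proof. by rewrite /cr !pE; ring. Qed.
Lemma crDl u v w : cr (u + v) w = cr u w + cr v w.
Proof. by rewrite /cr !pE; ring. Qed.
Lemma crDr u v w : cr w (u + v) = cr w u + cr w v.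
Proof. by rewrite /cr !pE; ring. Qed.
Lemma cruu u : cr u u = 0. Proof. by rewrite /cr; ring. Qed.

Lemma polar_unit (x y : R) : x ^+ 2 + y ^+ 2 = 1 -> exists t, x = cos t /\ y = sin t.
Proof.
move=> xy; have x1 : -1 <= x <= 1.
  rewrite -ler_norml -(@expr_le1 _ 2) // real_normK ?num_real //.
  by have := sqr_ge0 y; lra.
have cE : cos (acos x) = x by apply: acosK; rewrite in_itv.
have sE : sin (acos x) ^+ 2 = y ^+ 2 by rewrite sin2cos2 cE; lra.
have /orP[/eqP h|/eqP h] : (y == sin (acos x)) || (y == - sin (acos x)).
  by rewrite -eqf_sqr sE.
- by exists (acos x); rewrite cE.
- by exists (- acos x); rewrite cosN sinN cE.
Qed.

(* The wedge between the rays at angles [a] and [a + s phi], [s = 1] or [s = -1],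
   for [0 < phi <= pi]; at [phi = pi] it is a half-plane. *)
Definition wedge s a phi x := 0 <= s * cr (dirv a) x /\ 0 <= s * cr x (dirv (a + s * phi)).

Lemma wedge_flip s a phi x : wedge (- s) (a + s * phi) phi x <-> wedge s a phi x.
Proof.
rewrite /wedge (_ : a + s * phi + - s * phi = a); last by ring.
rewrite (_ : - s * cr (dirv (a + s * phi)) x = s * cr x (dirv (a + s * phi))); last first.
  by rewrite /cr; ring.
rewrite (_ : - s * cr x (dirv a) = s * cr (dirv a) x); last by rewrite /cr; ring.
by split=> -[].
Qed.

Definition sgn1 s := s = 1 \/ s = -1.

Lemma sgn1_sin s t : sgn1 s -> s * sin (s * t) = sin t.
Proof. by case=> ->; rewrite ?mul1r // !mulN1r sinN opprK. Qed.

Lemma sgn1_cos s t : sgn1 s -> cos (s * t) = cos t.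
Proof. by case=> ->; rewrite ?mul1r // !mulN1r cosN. Qed.

Lemma sgn1_sqr s : sgn1 s -> s * s = 1.
Proof. by case=> ->; ring. Qed.

Lemma sgn1N s : sgn1 s -> sgn1 (- s).
Proof. by case=> ->; [right|left; rewrite opprK]. Qed.

Lemma wedge_dir s a phi t : sgn1 s -> wedge s a phi (dirv (a + s * t)) <->
  0 <= sin t /\ 0 <= sin (phi - t).
Proof.
move=> s1; rewrite /wedge !cr_dir.
rewrite (_ : a + s * t - a = s * t); last by ring.
rewrite (_ : a + s * phi - (a + s * t) = s * (phi - t)); last by ring.
by rewrite !sgn1_sin.
Qed.

Lemma wedgeZ s a phi (k : R) x : 0 <= k -> wedge s a phi x -> wedge s a phi (k *: x).
Proof.
move=> k0 [h1 h2]; split; rewrite ?crZr ?crZl mulrCA mulr_ge0 //.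
Qed.

Lemma wedge_start s a phi : sgn1 s -> 0 <= phi <= pi -> wedge s a phi (dirv a).
Proof.
move=> s1 hphi; rewrite -[a in dirv a]addr0 -[0](mulr0 s); apply/wedge_dir => //.
by rewrite subr0 sin0; split=> //; exact: sin_ge0_pi.
Qed.

Lemma wedge_end s a phi : sgn1 s -> 0 <= phi <= pi -> wedge s a phi (dirv (a + s * phi)).
Proof.
move=> s1 hphi; apply/wedge_dir => //.
by rewrite subrr sin0; split=> //; exact: sin_ge0_pi.
Qed.

Definition looks_like X v (e : R) (D : V -> Prop) := forall x, enorm (x - v) < e -> (X x <-> D (x - v)).

Lemma looks_like_flip X v e s a phi : looks_like X v e (wedge s a phi) ->
  looks_like X v e (wedge (- s) (a + s * phi) phi).
Proof. by move=> H x /H ->; rewrite wedge_flip. Qed.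

Lemma looks_like_ray X v e s a phi t (k : R) : looks_like X v e (wedge s a phi) -> 0 <= k < e ->
  wedge s a phi (dirv t) -> X (v + k *: dirv t).
Proof.
move=> H /andP[k0 ke] hw; apply/H; rewrite addrC addKr; last exact: wedgeZ.
by rewrite enormZ enorm_dir mulr1 ger0_norm.
Qed.

(** A similarity keeps the opening [phi] and changes only the orientation and the starting angle,
    through its own orientation [k] and rotation angle [th]. *)
Lemma simform_looks_like (r : R) f X v e s a phi : 0 < r -> simform r f -> sgn1 s ->
  looks_like X v e (wedge s a phi) -> exists s' a', sgn1 s' /\ looks_like (f @` X) (f v) (r * e) (wedge s' a' phi).
Proof.
move=> r0 sf s1 H; have [p [q [k [b [g [k1 pq F]]]]]] := sf.
have [h [hK fK _]] := simform_inv (lt0r_neq0 r0) sf.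
have [th [pE' qE']] : exists th, p / r = cos th /\ q / r = sin th.
  apply: polar_unit; rewrite !expr_div_n -mulrDl pq divff // expf_neq0 // gt_eqF //.
have ks : sgn1 k.
  have /eqP : (k - 1) * (k + 1) = 0 by rewrite -subr_sqr k1 expr1n subrr.
  rewrite mulf_eq0 => /orP[/eqP h1|/eqP h1]; [left|right]; lra.
have pr : p = r * cos th by rewrite -pE' mulrC mulfVK // gt_eqF.
have qr : q = r * sin th by rewrite -qE' mulrC mulfVK // gt_eqF.
have Ldir t x : k * cr (dirv (th + k * t)) (f x - f v) = r * cr (dirv t) (x - v).
  rewrite !F /cr !pE /= cosD sinD sgn1_cos // pr qr.
  have -> : sin (k * t) = k * sin t by rewrite -[in RHS](sgn1_sin t ks) mulrA sgn1_sqr // mul1r.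
  have c2 := cos2Dsin2 th; have kk := sgn1_sqr ks.
  transitivity (r * (cos th ^+ 2 + sin th ^+ 2) * ((k * k) * cos t * (py x - py v) - (k * k) * sin t * (px x - px v))).
    by ring.
  by rewrite c2 kk; ring.
exists (s * k), (th + k * a); split.
  by case: s1 ks => [->|->] [->|->]; [left|right|right|left]; ring.
move=> y hy.
have yE : f (h y) = y.
  by have [h' [_ fK' h'K]] := simform_inv (lt0r_neq0 r0) sf; rewrite -(h'K y) fK.
have hhy : enorm (h y - v) < e.
  by move: hy; rewrite -{1}yE (simform_enorm _ _ (ltW r0) sf) ltr_pM2l.
have -> : (f @` X) y <-> X (h y).
  by split=> [[x Xx <-]|Xh]; [rewrite fK|exists (h y)].
rewrite (H _ hhy) /wedge -{3 4}yE.
have e1 : s * k * cr (dirv (th + k * a)) (f (h y) - f v) = r * (s * cr (dirv a) (h y - v)).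
  by rewrite -mulrA Ldir mulrCA.
have e2 : s * k * cr (f (h y) - f v) (dirv (th + k * a + s * k * phi)) =
    r * (s * cr (h y - v) (dirv (a + s * phi))).
  rewrite (_ : th + k * a + s * k * phi = th + k * (a + s * phi)); last by ring.
  by rewrite crC mulrN -mulrA Ldir (crC (h y - v)); ring.
by rewrite e1 e2 !(pmulr_rge0 _ r0).
Qed.

Lemma wedge_split s a phi x (m : nat) : (0 < m)%N -> wedge s a (m%:R * phi) x ->
  exists2 i, (i < m)%N & wedge s (a + s * (i%:R * phi)) phi x.
Proof.
elim: m => // -[|m] IH _.
  by move=> H; exists 0%N => //; rewrite mul0r mulr0 addr0; rewrite mul1r in H.
move=> [h1 h2]; pose b := a + s * (m.+1%:R * phi).
have bE : b + s * phi = a + s * (m.+2%:R * phi) by rewrite /b -[in RHS]natr1; ring.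
have [h|h] := lerP 0 (s * cr (dirv b) x).
  by exists m.+1 => //; split=> //; rewrite -/b bE.
have [|i im hi] := IH isT; last by exists i => //; exact: ltnW.
by split=> //; rewrite -/b crC; lra.
Qed.

End wedges.

(** * Reflecting a wedge around its tip *)

Section walk.
Context {R : realType}.
Local Notation V := 'cV[R]_2.
Implicit Types (u v w x y z n : V) (X Y P : set V) (f g : V -> V) (s a phi t : R).

Lemma orth_dir t n : n != 0 -> dotcv (dirv t) n = 0 -> exists2 k, k != 0 & n = k *: norv t.
Proof.
move=> n0; rewrite dotE !pE /= => h.
have c2 := cos2Dsin2 t.
have e : n = (cos t * py n - sin t * px n) *: norv t.
  apply: plane_ext; rewrite !pE /=.
    transitivity ((cos t ^+ 2 + sin t ^+ 2) * px n - cos t * (cos t * px n + sin t * py n)); last by ring.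
    by rewrite c2 h; ring.
  transitivity ((cos t ^+ 2 + sin t ^+ 2) * py n - sin t * (cos t * px n + sin t * py n)); last by ring.
  by rewrite c2 h; ring.
exists (cos t * py n - sin t * px n) => //.
by apply: contra_neq n0 => k0; rewrite e k0 scale0r.
Qed.

Lemma dotZr u (k : R) n : dotcv u (k *: n) = k * dotcv u n.
Proof. by rewrite !dotE !pE; ring. Qed.
Lemma dotZl u (k : R) n : dotcv (k *: u) n = k * dotcv u n.
Proof. by rewrite !dotE !pE; ring. Qed.
Lemma dotDl u v n : dotcv (u + v) n = dotcv u n + dotcv v n.
Proof. by rewrite !dotE !pE; ring. Qed.
Lemma dotBl u v n : dotcv (u - v) n = dotcv u n - dotcv v n.
Proof. by rewrite !dotE !pE; ring. Qed.

Lemma cr0_dir u t : cr u (dirv t) = 0 -> u = dotcv u (dirv t) *: dirv t.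
Proof.
rewrite /cr dotE !pE /= => h; have c2 := cos2Dsin2 t; apply: plane_ext; rewrite !pE /=.
  transitivity ((cos t ^+ 2 + sin t ^+ 2) * px u - sin t * (px u * sin t - py u * cos t)).
    by rewrite c2 h; ring.
  by ring.
transitivity ((cos t ^+ 2 + sin t ^+ 2) * py u + cos t * (px u * sin t - py u * cos t)).
  by rewrite c2 h; ring.
by ring.
Qed.

Lemma reflection_line (v : V) (h : V * R) t u (k : R) : k != 0 -> h.1 = k *: norv t -> dotcv v h.1 = h.2 ->
  reflection h u = v + ((u - v) - (2 * cr (dirv t) (u - v)) *: norv t).
Proof.
move=> k0 hE hv; rewrite /reflection -hv hE.
have N : dotcv (norv t) (norv t) = 1 by rewrite dotE !pE /= -(cos2Dsin2 t); ring.
have -> : dotcv (k *: norv t) (k *: norv t) = k ^+ 2.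
  by rewrite dotZl dotZr N; ring.
rewrite !dotZr -mulrBr -dotBl dot_nor scalerA addrA subrKC.
congr (_ - _ *: _); by field.
Qed.

(** The mirror in the direction [t] sends the direction [a] to [2 t - a] and reverses
    orientation. *)
Lemma cr_mirror t a u : cr (dirv a) (u - (2 * cr (dirv t) u) *: norv t) = cr u (dirv (2 * t - a)).
Proof.
rewrite /cr !pE /= (_ : 2 * t - a = t + (t - a)); last by ring.
rewrite cosD sinD cosB sinB; have c2 := cos2Dsin2 t.
set X := px u; set Y := py u; set C := cos t; set D := sin t; set c := cos a; set d := sin a.
transitivity ((C ^+ 2 + D ^+ 2) * (c * Y - d * X) - 2 * (C * Y - D * X) * (c * C + d * D)).
  by rewrite c2; ring.
by ring.
Qed.

Section fixed.
Variables (F : set V) (S : seq (V * R)) (r : R).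
Hypothesis fo : folding F S r.
Let clF := compact_closed_plane (fo_compact fo).

Definition rayint v (e : R) t := exists2 k, 0 < k < e & interior F (v + k *: dirv t).

(** The final ray of the wedge of [P] enters the interior of the figure, so the figure goes on
    beyond it and only a cutting line can have stopped [P] there. That line carries a facet of [P],
    hence reflects [P] to a subfigure, whose wedge is the next one around [v]. *)
Lemma walk_step P v e s a phi : subfigure S F P -> sgn1 s -> 0 < phi <= pi -> 0 < e ->
  looks_like P v e (wedge s a phi) -> rayint v e (a + s * phi) ->
  (exists Q, subfigure S F Q /\ looks_like Q v e (wedge s (a + s * phi) phi)) /\
  exists h, [/\ h \in S, dotcv v h.1 = h.2 & dotcv (dirv (a + s * phi)) h.1 = 0].
Proof.
move=> sP s1 /andP[phi0 phipi] e0 nP [k /andP[k0 ke] iz].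
have phi01 : 0 <= phi <= pi by rewrite ltW.
set b := a + s * phi in iz *; set z := v + _ in iz.
have wb : wedge s a phi (dirv b) by exact: wedge_end.
have ray l : 0 <= l < e -> P (v + l *: dirv b) by move=> hl; exact: looks_like_ray nP hl wb.
have Pz : P z by apply: ray; rewrite (ltW k0).
have [x0 [Fx0 /offlinesP ox0] defP] := sP.
(* Otherwise a point [w] slightly beyond the ray would lie in the figure and in the cell of [P],
   hence in [P], though outside its wedge. *)
have [h hS hz] : exists2 h, h \in S & dotcv z h.1 = h.2.
  apply: contrapT => H.
  have oz : offlines S z by move=> h hS; apply/eqP => hz; apply: H; exists h.
  have [d d0 hd] := cell_nbhs oz.
  have [d' d'0 hd'] := interior_open_near 0 iz.
  pose l := Num.min (Num.min d d') (e - k) / 2.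
  have m0 : 0 < Num.min (Num.min d d') (e - k) by rewrite !lt_min d0 d'0 subr_gt0.
  have l0 : 0 < l by rewrite divr_gt0.
  have lm : l < Num.min (Num.min d d') (e - k) by rewrite /l; lra.
  move: lm; rewrite !lt_min -andbA => /and3P[ld ld' lek].
  pose w := z + (l * s) *: norv b.
  have nn : enorm (norv b) = 1.
    by rewrite enormE !pE /= sqrrN addrC cos2Dsin2 sqrtr1.
  have wz : enorm (w - z) = l.
    rewrite /w addrC addKr enormZ nn mulr1 normrM (gtr0_norm l0).
    by case: s1 => ->; rewrite ?normrN normr1 mulr1.
  have Pw : P w.
    rewrite -defP; apply: subset_closure; split.
      by apply: interior_sub; apply: hd'; rewrite wz.
    move=> h hS.
    have cz : 0 < (dotcv x0 h.1 - h.2) * (dotcv z h.1 - h.2).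
      rewrite lt_neqAle; move: (Pz); rewrite -defP => /closure_cell_side -> //.
      rewrite andbT eq_sym mulf_neq0 // subr_eq0; [exact: ox0|exact: oz].
    have cw := hd w (_ : enorm (w - z) < d) h hS.
    have {}cw : 0 < (dotcv z h.1 - h.2) * (dotcv w h.1 - h.2) by apply: cw; rewrite wz.
    move: cz cw; move: (dotcv x0 h.1 - h.2) (dotcv z h.1 - h.2) (dotcv w h.1 - h.2) => A B C AB BC.
    have B0 : B != 0 by apply/eqP => B0; move: AB; rewrite B0 mulr0 ltxx.
    have B2 : 0 < B ^+ 2 by rewrite lt_neqAle sqr_ge0 eq_sym expf_neq0.
    have : 0 < B ^+ 2 * (A * C).
      by rewrite (_ : B ^+ 2 * (A * C) = (A * B) * (B * C)); [rewrite mulr_gt0|ring].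
    by rewrite (pmulr_rgt0 _ B2).
  have wv : enorm (w - v) < e.
    have := enorm_tri3 w z v; rewrite wz.
    have -> : enorm (z - v) = k by rewrite /z addrC addKr enormZ enorm_dir mulr1 gtr0_norm.
    by lra.
  have [_] := (nP w wv).1 Pw.
  rewrite /w /z -/b (_ : _ - v = k *: dirv b + (l * s) *: norv b); last first.
    by apply: plane_ext; rewrite !pE; ring.
  rewrite crDl !crZl cruu (crC (norv b)).
  have -> : cr (dirv b) (norv b) = 1 by rewrite /cr !pE /= -(cos2Dsin2 b); ring.
  have := sgn1_sqr s1; nra.
have c0 : dotcv x0 h.1 - h.2 != 0 by rewrite subr_eq0; exact: ox0.
have side y : P y -> 0 <= (dotcv x0 h.1 - h.2) * (dotcv y h.1 - h.2).
  by rewrite -defP => /closure_cell_side; apply.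
have bh : dotcv (dirv b) h.1 = 0.
  pose d := Num.min k (e - k) / 2.
  have m0 : 0 < Num.min k (e - k) by rewrite lt_min k0 subr_gt0.
  have d0 : 0 < d by rewrite divr_gt0.
  have : d < Num.min k (e - k) by rewrite /d; lra.
  rewrite lt_min => /andP[dk dek]; clearbody d.
  have h1 : 0 <= k + d < e by apply/andP; split; lra.
  have h2 : 0 <= k - d < e by apply/andP; split; lra.
  have := side _ (ray _ h2); have := side _ (ray _ h1); move: c0.
  set A := dotcv x0 h.1 - h.2 => A0; rewrite -hz /z !dotDl !dotZl => i1 i2.
  have /eqP : A * dotcv (dirv b) h.1 * d = 0 by lra.
  by rewrite !mulf_eq0 (negbTE A0) (gt_eqF d0) orbF => /eqP.
have hv : dotcv v h.1 = h.2 by rewrite -hz /z dotDl dotZl bh mulr0 addr0.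
have hn0 := fo_nz fo hS.
have [q q0 hE] := orth_dir hn0 bh.
split; last by exists h.
have bd : bounding P h.
  split.
    have [c1|c1] := ltrP 0 (dotcv x0 h.1 - h.2).
      by right => y Py; rewrite -subr_ge0 -(pmulr_rge0 _ c1); exact: side.
    left => y Py; have {}c1 : dotcv x0 h.1 - h.2 < 0 by rewrite lt_neqAle c0.
    by rewrite -subr_le0 -(nmulr_rge0 _ c1); exact: side.
  exists [set x | enorm (x - z) < Num.min k (e - k)]; split; first exact: eball_open.
    by exists z; split=> //=; rewrite subrr enorm0 lt_min k0 subr_gt0.
  move=> x [hx /=]; rewrite lt_min => /andP[xk xek].
  have ux : cr (x - z) (dirv b) = 0.
    have /eqP : dotcv (x - z) h.1 = 0 by rewrite dotBl hz hx subrr.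
    rewrite hE dotZr mulf_eq0 (negbTE q0) dot_nor /= => /eqP h0.
    by rewrite crC h0 oppr0.
  have uE := cr0_dir ux; set l := dotcv _ _ in uE.
  have ll : `|l| = enorm (x - z) by rewrite uE enormZ enorm_dir mulr1.
  have -> : x = v + (k + l) *: dirv b.
    by rewrite scalerDl -uE addrA -/z addrC subrK.
  apply: ray; move: xk xek; rewrite -ll !ltr_norml => /andP[h1 h2] /andP[h3 h4].
  by apply/andP; split; lra.
exists (reflection h @` P); split; first exact: (fo_refl fo sP hS bd).
have refl u := reflection_line u q0 hE hv.
have sr := reflection_simform hn0.
have rv : reflection h v = v.
  by rewrite refl subrr /cr !pE !mulr0 subrr mulr0 scale0r subr0 addr0.
have reflB u : reflection h u - v = (u - v) - (2 * cr (dirv b) (u - v)) *: norv b.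
  by rewrite refl addrC addKr.
have rr u : reflection h (reflection h u) = u.
  rewrite refl !reflB; set m := u - v.
  rewrite [in X in _ + X = _](_ : cr (dirv b) (m - (2 * cr (dirv b) m) *: norv b) = - cr (dirv b) m); last first.
    rewrite cr_mirror (_ : 2 * b - b = b); last by ring.
    by rewrite crC.
  by rewrite mulrN scaleNr opprK subrK /m subrKC.
move=> x hx.
have hrx : enorm (reflection h x - v) < e.
  by rewrite -[v in _ - v]rv (simform_enorm _ _ ler01 sr) mul1r.
have -> : (reflection h @` P) x <-> P (reflection h x).
  by split=> [[y Py <-]|Pr]; [rewrite rr|exists (reflection h x)].
rewrite (nP _ hrx) reflB /wedge -/b.
set m := x - v; set M := m - _.
have -> : cr (dirv a) M = cr m (dirv (b + s * phi)).
  by rewrite /M cr_mirror; congr (cr _ (dirv _)); rewrite /b; ring.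
have -> : cr M (dirv b) = cr (dirv b) m.
  rewrite crC /M cr_mirror (_ : 2 * b - b = b); last by ring.
  by rewrite [in RHS]crC.
by split=> -[? ?].
Qed.

Lemma walk_run P v e s a phi (j : nat) : subfigure S F P -> sgn1 s -> 0 < phi <= pi -> 0 < e ->
  looks_like P v e (wedge s a phi) ->
  (forall i, (0 < i <= j)%N -> rayint v e (a + s * (i%:R * phi))) ->
  exists Q, subfigure S F Q /\ looks_like Q v e (wedge s (a + s * (j%:R * phi)) phi).
Proof.
move=> sP s1 hphi e0 nP; elim: j => [|j IH] H.
  by exists P; split=> //; rewrite mul0r mulr0 addr0.
have [|Q [sQ nQ]] := IH; first by move=> i /andP[i0 ij]; apply: H; rewrite i0 ltnW.
have E : a + s * (j%:R * phi) + s * phi = a + s * (j.+1%:R * phi) by rewrite -natr1; ring.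
have ri : rayint v e (a + s * (j%:R * phi) + s * phi) by rewrite E; apply: H; rewrite ltnS leqnn.
by have [+ _] := walk_step sQ s1 hphi e0 nQ ri; rewrite E.
Qed.

End fixed.
End walk.

(** * Angles of corners divide [pi] *)

Section angles.
Context {R : realType}.
Local Notation V := 'cV[R]_2.
Implicit Types (u v w x y z n : V) (X Y P : set V) (f g : V -> V) (s a phi t : R).

Lemma sin_lt0_pi2 t : pi < t < 2 * pi -> sin t < 0.
Proof.
move=> /andP[h1 h2]; rewrite -[t](subrK pi) sinDpi oppr_lt0 sin_gt0_pi //.
by apply/andP; split; lra.
Qed.

Lemma sin_le0_pi2 t : pi <= t < 2 * pi -> sin t <= 0.
Proof.
move=> /andP[]; rewrite le_eqVlt => /orP[/eqP <-|h1 h2]; first by rewrite sinpi.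
by rewrite ltW // sin_lt0_pi2 // h1.
Qed.

Lemma reach_pi phi : 0 < phi -> exists j : nat, j%:R * phi < pi <= j.+1%:R * phi.
Proof.
move=> phi0; have ex : exists j : nat, pi <= j%:R * phi.
  exists (Num.bound (pi / phi)); rewrite -ler_pdivrMr // ltW //.
  by apply: archi_boundP; rewrite divr_ge0 ?pi_ge0 // ltW.
case: (ex_minnP ex) => -[|j] hj minj; first by move: hj; rewrite mul0r leNgt pi_gt0.
by exists j; rewrite hj andbT ltNge; apply/negP => /minj; rewrite ltnn.
Qed.

Lemma interior_strict X n (c : R) : n != 0 -> (forall x, X x -> dotcv x n <= c) ->
  forall z, interior X z -> dotcv z n < c.
Proof.
move=> n0 H z /nbhs_enormP [e e0 he].
have nn := enorm_gt0 n0; have n2 : 0 < dotcv n n by rewrite -enorm_sqr exprn_gt0.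
have := H (z + (e / 2 / enorm n) *: n) (_ : _).
rewrite dotDl dotZl => H'; have k0 : 0 < e / 2 / enorm n by rewrite !divr_gt0.
have {}H' : dotcv z n + e / 2 / enorm n * dotcv n n <= c.
  apply: H'; apply: he; rewrite addrC addKr enormZ gtr0_norm // mulfVK ?gt_eqF //; lra.
by have := mulr_gt0 k0 n2; lra.
Qed.

Lemma strict_interior (L : seq (V * R)) z : (forall h, h \in L -> dotcv z h.1 < h.2) ->
  interior (inL L) z.
Proof.
move=> H; apply/nbhs_enormP; elim: L H => [|h L IH] H.
  by exists 1 => // x _ h; rewrite in_nil.
have [h' h'L|d d0 hd] := IH; first by apply: H; rewrite in_cons h'L orbT.
have [C C0 hC] := dot_lip h.1.
have g0 : 0 < h.2 - dotcv z h.1 by rewrite subr_gt0 H // mem_head.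
exists (Num.min d ((h.2 - dotcv z h.1) / C)); first by rewrite lt_min d0 divr_gt0.
move=> x; rewrite lt_min => /andP[x1 x2] h'; rewrite in_cons => /orP[/eqP ->|]; last exact: hd.
move: x2; rewrite ltr_pdivlMr // mulrC => x2; have := le_lt_trans (hC x z) x2.
by rewrite ltr_norml => /andP[_]; lra.
Qed.

Lemma sgn1_sinM s t : sgn1 s -> sin (s * t) = s * sin t.
Proof. by move=> s1; rewrite -[in RHS](sgn1_sin t s1) mulrA sgn1_sqr // mul1r. Qed.

Lemma sgn1_neq0 s : sgn1 s -> s != 0.
Proof. by case=> ->; rewrite ?oppr_eq0 oner_neq0. Qed.

Lemma dir_relation s a (A B : R) n : sgn1 s ->
  sin (B - A) * dotcv (dirv a) n - sin B * dotcv (dirv (a + s * A)) n +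
    sin A * dotcv (dirv (a + s * B)) n = 0.
Proof.
by move=> s1; rewrite !dotE !pE /= !cosD !sinD !sgn1_cos // !sgn1_sinM // sinN cosN; ring.
Qed.

Lemma dir_opp s a : sgn1 s -> dirv (a + s * pi) = - dirv a.
Proof.
move=> s1; apply: plane_ext; rewrite !pE /= ?cosD ?sinD sgn1_cos // sgn1_sinM // cospi sinpi;
  ring.
Qed.

Section fixed.
Variables (F : set V) (S : seq (V * R)) (r : R) (L : seq (V * R)).
Hypotheses (fo : folding F S r) (L0 : forall h, h \in L -> h.1 != 0)
  (FL : forall x, F x <-> inL L x).
Let clF := compact_closed_plane (fo_compact fo).

Lemma not_interior z : F z -> ~ interior F z -> exists2 h, h \in L & dotcv z h.1 = h.2.
Proof.
move=> Fz nz; apply: contrapT => H; apply: nz.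
have -> : F = inL L by apply/seteqP; split=> x /FL.
apply: strict_interior => h hL; rewrite lt_neqAle; apply/andP; split; last by move/FL: Fz; apply.
by apply/eqP => e; apply: H; exists h.
Qed.

Lemma rayint_strict v (e : R) n t : n != 0 -> (forall x, F x -> dotcv x n <= dotcv v n) ->
  rayint F v e t -> dotcv (dirv t) n < 0.
Proof.
move=> n0 H [k /andP[k0 _] iz]; have := interior_strict n0 H iz.
rewrite dotDl dotZl gtrDl pmulr_rlt0 //.
Qed.

(** At a boundary point some half-plane of the figure is tight, and directions into the interior
    point strictly to one side of its boundary. Steps of at most [pi] cannot keep to that side: the
    first ray, the last one less than [pi] away from it and the next one admit a nontrivial
    nonnegative combination equal to zero. *)
Lemma ray_exit v (e : R) s a phi : F v -> ~ interior F v -> sgn1 s -> 0 < phi <= pi ->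
  exists2 j : nat, (0 < j)%N & ~ rayint F v e (a + s * (j%:R * phi)).
Proof.
move=> Fv nv s1 /andP[phi0 phipi]; apply: contrapT => H.
have ri j : (0 < j)%N -> rayint F v e (a + s * (j%:R * phi)).
  by move=> j0; apply: contrapT => nr; apply: H; exists j.
have [h hL hv] := not_interior Fv nv.
have neg j : (0 < j)%N -> dotcv (dirv (a + s * (j%:R * phi))) h.1 < 0.
  move=> j0; apply: (rayint_strict (L0 hL)) (ri j j0) => x Fx.
  by rewrite hv; move/FL: Fx; apply.
have [j /andP[jA jB]] := reach_pi phi0.
pose th := a + s * phi; pose A := j%:R * phi; pose B := j.+1%:R * phi.
have AB : B = A + phi by rewrite /A /B -natr1; ring.
have d0 : dotcv (dirv th) h.1 < 0 by have := neg 1%N isT; rewrite mul1r.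
have d1 : dotcv (dirv (th + s * A)) h.1 < 0.
  have := neg j.+1 isT; rewrite (_ : a + _ = th + s * A) //.
  by rewrite -natr1 /th /A; ring.
have d2 : dotcv (dirv (th + s * B)) h.1 < 0.
  have := neg j.+2 isT; rewrite (_ : a + _ = th + s * B) //.
  by rewrite -natr1 /th /B; ring.
have comb : sin phi * dotcv (dirv th) h.1 - sin B * dotcv (dirv (th + s * A)) h.1 +
    sin A * dotcv (dirv (th + s * B)) h.1 = 0.
  by rewrite -[in sin phi](_ : B - A = phi) ?dir_relation //; rewrite AB; ring.
have sA : 0 <= sin A by apply: sin_ge0_pi; rewrite (ltW jA) andbT mulr_ge0 // ltW.
have sphi : 0 <= sin phi by apply: sin_ge0_pi; rewrite phipi ltW.
move: jB; rewrite le_eqVlt => /orP[/eqP BE|jB].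
  have : dotcv (dirv (th + s * B)) h.1 = - dotcv (dirv th) h.1.
    by rewrite /B -BE dir_opp // !dotE !pE; ring.
  by lra.
have sB : sin B < 0.
  by apply: sin_lt0_pi2; rewrite jB /= AB; move: jA; rewrite -/A; lra.
by move: comb d0 d1 d2 sA sphi sB; nra.
Qed.

(** If an edge of a subfigure does not enter the interior, its inner points are boundary points of
    the figure. A half-plane tight at one of them has the whole edge on its boundary line, and the
    middle of the wedge tells on which side the figure lies. *)
Lemma ray_support Q v (e : R) s b phi : F v -> subfigure S F Q -> sgn1 s -> 0 < phi <= pi -> 0 < e ->
  looks_like Q v e (wedge s b phi) -> ~ rayint F v e b ->
  forall x, F x -> 0 <= s * cr (dirv b) (x - v).
Proof.
move=> Fv sQ s1 /andP[phi0 phipi] e0 nQ nr.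
have wb : wedge s b phi (dirv b) by apply: wedge_start => //; rewrite phipi ltW.
have FQ k t : 0 <= k < e -> wedge s b phi (dirv t) -> F (v + k *: dirv t).
  by move=> hk hw; apply: (subfigure_sub clF sQ); exact: looks_like_ray nQ hk hw.
have e2 : 0 <= e / 2 < e by apply/andP; split; lra.
have e3 : 0 <= e * 3 / 4 < e by apply/andP; split; lra.
have [h hL hz] : exists2 h, h \in L & dotcv (v + (e / 2) *: dirv b) h.1 = h.2.
  apply: not_interior; first exact: FQ.
  by move=> iz; apply: nr; exists (e / 2) => //; apply/andP; split; lra.
have Fh x : F x -> dotcv x h.1 <= h.2 by move/FL; apply.
have := Fh _ (FQ _ _ e3 wb); have := Fh _ Fv.
rewrite -hz !dotDl !dotZl => i1 i2.
have bh : dotcv (dirv b) h.1 = 0 by move: i1 i2; move: (dotcv v _) (dotcv (dirv b) _) => A B; nra.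
have hv : dotcv v h.1 = h.2 by rewrite -hz dotDl dotZl bh mulr0 addr0.
have [k k0 hE] := orth_dir (L0 hL) bh.
have side x : F x -> k * cr (dirv b) (x - v) <= 0.
  by move=> Fx; rewrite -dot_nor -dotZr -hE dotBl subr_le0 hv Fh.
have wm : wedge s b phi (dirv (b + s * (phi / 2))).
  by apply/wedge_dir => //; split; apply: sin_ge0_pi; apply/andP; split; lra.
have := side _ (FQ _ _ e2 wm).
rewrite addrC addKr crZr cr_dir (_ : b + s * (phi / 2) - b = s * (phi / 2)); last by ring.
rewrite sgn1_sinM //.
have sp : 0 < sin (phi / 2) by apply: sin_gt0_pi; apply/andP; split; lra.
move=> hk x /side hx.
have ks : k * s <= 0.
  have p0 : 0 < e / 2 * sin (phi / 2) by rewrite mulr_gt0 // divr_gt0.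
  rewrite -(pmulr_rle0 _ p0); move: hk; congr (_ <= _); ring.
have ks0 : k * s < 0.
  by rewrite lt_neqAle ks andbT mulf_neq0 // sgn1_neq0.
rewrite -(nmulr_rle0 _ ks0) (_ : k * s * (s * cr (dirv b) (x - v)) = (s * s) * (k * cr (dirv b) (x - v))); last by ring.
by rewrite sgn1_sqr // mul1r.
Qed.

Definition corner_like v phi := exists e s a, [/\ 0 < e, sgn1 s & looks_like F v e (wedge s a phi)].

(** All rays at an interior point enter the interior, so the edge [a] lies on a cutting line and
    copies of the wedge continue around [v]. The copy that reaches the direction opposite to [a] may
    not straddle that line, hence ends on it. *)
Lemma wedge_up_interior P v (e : R) s a phi : subfigure S F P -> sgn1 s -> 0 < phi <= pi -> 0 < e ->
  looks_like P v e (wedge s a phi) -> interior F v -> exists m : nat, m%:R * phi = pi.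
Proof.
move=> sP s1 hphi e0 nP iv; have /andP[phi0 phipi] := hphi.
have [d d0 hd] := interior_open_near 0 iv.
have ri t : rayint F v e t.
  have m0 : 0 < Num.min d e by rewrite lt_min d0.
  have : Num.min d e / 2 < Num.min d e by lra.
  rewrite lt_min => /andP[h1 h2]; exists (Num.min d e / 2); first by rewrite h2 divr_gt0.
  by apply: hd; rewrite addrC addKr enormZ enorm_dir mulr1 gtr0_norm // divr_gt0.
have [_ [h [hS hv ah]]] := walk_step fo sP (sgn1N s1) hphi e0 (looks_like_flip nP) (ri _).
move: ah; rewrite (_ : a + s * phi + - s * phi = a); last by ring.
move=> ah; have [k k0 hE] := orth_dir (fo_nz fo hS) ah.
have [j /andP[jA jB]] := reach_pi phi0.
exists j.+1; apply/eqP; rewrite eq_le jB andbT leNgt; apply/negP => jB'.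
have [Q [sQ nQ]] := walk_run fo (j := j) sP s1 hphi e0 nP (fun i _ => ri _).
have [x0 [_ /offlinesP ox0] defQ] := sQ.
have c0 : dotcv x0 h.1 - h.2 != 0 by rewrite subr_eq0; exact: ox0.
have side y : Q y -> 0 <= (dotcv x0 h.1 - h.2) * (dotcv y h.1 - h.2).
  by rewrite -defQ => /closure_cell_side; apply.
have e2 : 0 <= e / 2 < e by apply/andP; split; lra.
have hphi' : 0 <= phi <= pi by rewrite phipi ltW.
have q1 := side _ (looks_like_ray nQ e2 (wedge_start _ s1 hphi')).
have q2 := side _ (looks_like_ray nQ e2 (wedge_end _ s1 hphi')).
have val t : dotcv (v + (e / 2) *: dirv (a + s * t)) h.1 - h.2 = e / 2 * k * s * sin t.
  rewrite dotDl dotZl hv addrC addKr hE dotZr dot_nor cr_dir.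
  have -> : a + s * t - a = s * t by ring.
  rewrite sgn1_sinM //.
  by ring.
have E : a + s * (j%:R * phi) + s * phi = a + s * (j.+1%:R * phi) by rewrite -natr1; ring.
move: q1 q2; rewrite E !val; set c := dotcv x0 _ - _ in c0 *.
have AB : j.+1%:R * phi = j%:R * phi + phi by rewrite -natr1; ring.
have j0 : 0 < j%:R * phi.
  rewrite mulr_gt0 // ltr0n lt0n; apply/eqP => j0; move: jB'; rewrite j0 mul1r.
  by rewrite ltNge phipi.
have sA : 0 < sin (j%:R * phi) by apply: sin_gt0_pi; rewrite j0.
have sB : sin (j.+1%:R * phi) < 0 by apply: sin_lt0_pi2; rewrite jB' AB; lra.
have q0 : c * (e / 2 * k * s) != 0.
  apply: mulf_neq0 => //; apply: mulf_neq0; last exact: sgn1_neq0.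
  by apply: mulf_neq0 => //; rewrite gt_eqF // divr_gt0.
move: q0; move: (e / 2 * k * s) => q q0.
rewrite !(mulrA c) (pmulr_lge0 _ sA) (nmulr_lge0 _ sB) => h1 h2.
by move/eqP: q0; apply; apply: le_anti; rewrite h1 h2.
Qed.

(** The wedge is reflected in both directions until a ray no longer enters the interior. The two
    extreme rays support the figure, so the copies between them are all of it near [v]; the
    supporting half-planes keep their total angle within [pi]. *)
Lemma wedge_up_boundary P v (e : R) s a phi : F v -> subfigure S F P -> sgn1 s -> 0 < phi <= pi ->
  0 < e -> looks_like P v e (wedge s a phi) -> ~ interior F v ->
  exists m : nat, [/\ (0 < m)%N, m%:R * phi <= pi & corner_like v (m%:R * phi)].
Proof.
move=> Fv + + hphi e0 + nv; have /andP[phi0 phipi] := hphi.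
(* Walking backwards first, the initial ray may be assumed not to enter the interior. *)
wlog nra : P s a / ~ rayint F v e a.
  move=> W sP s1 nP.
  have ex : exists j : nat, `[< ~ rayint F v e (a + s * phi + - s * (j.+1%:R * phi)) >].
    have [[//|j] _ hj] := ray_exit e (a + s * phi) Fv nv (sgn1N s1) hphi.
    by exists j; exact/asboolP.
  case: (ex_minnP ex) => j /asboolP hj minj.
  have [|Q [sQ nQ]] := walk_run fo (j := j) sP (sgn1N s1) hphi e0 (looks_like_flip nP).
    move=> [//|i] /andP[_ ij]; apply: contrapT => nr.
    by have := minj i (asboolT nr); rewrite leqNgt ij.
  apply: W sQ _ (looks_like_flip nQ).
    move: hj; congr (~ rayint _ _ _ _); rewrite -natr1; ring.
  by rewrite opprK.
move=> sP s1 nP.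
have ex : exists j : nat, `[< ~ rayint F v e (a + s * (j.+1%:R * phi)) >].
  have [[//|j] _ hj] := ray_exit e a Fv nv s1 hphi.
  by exists j; exact/asboolP.
case: (ex_minnP ex) => m /asboolP hm minm.
have ri i : (0 < i <= m)%N -> rayint F v e (a + s * (i%:R * phi)).
  case: i => // i /andP[_ im]; apply: contrapT => nr.
  by have := minm i (asboolT nr); rewrite leqNgt im.
have run i : (i <= m)%N -> exists Q, subfigure S F Q /\
    looks_like Q v e (wedge s (a + s * (i%:R * phi)) phi).
  move=> im; apply: (walk_run fo sP s1 hphi e0 nP) => i' /andP[i0 ii]; apply: ri.
  by rewrite i0 (leq_trans ii).
have supA := ray_support Fv sP s1 hphi e0 nP nra.
have [Q [sQ nQ]] := run m (leqnn m).
have E : a + s * (m%:R * phi) + s * phi = a + s * (m.+1%:R * phi) by rewrite -natr1; ring.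
have supB x : F x -> 0 <= s * cr (x - v) (dirv (a + s * (m.+1%:R * phi))).
  have nQ' := looks_like_flip nQ; rewrite E in nQ'.
  have := ray_support Fv sQ (sgn1N s1) hphi e0 nQ' hm (x := x).
  by move=> H Fx; have := H Fx; rewrite crC mulrNN.
exists m.+1.
have mpi : m.+1%:R * phi <= pi.
  rewrite leNgt; apply/negP => mpi.
  have [j /andP[jA jB]] := reach_pi phi0.
  have AB : j.+1%:R * phi = j%:R * phi + phi by rewrite -natr1; ring.
  have jm : (j <= m)%N.
    by have := lt_trans jA mpi; rewrite ltr_pM2r // ltr_nat.
  have sgn x : s * cr (dirv a) (v + x - v) = s * cr (dirv a) x by rewrite addrC addKr.
  have s0 := sgn1_neq0 s1.
  (* [j] is the last index with [j phi < pi]. If it is below [m], an interior ray lies on or beyond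
     the supporting line of the first ray; if it equals [m], the final edge lies beyond it. *)
  have [jm'|jm'] := ltnP j m.
    have [k /andP[k0 _] iz] := ri j.+1 (introT andP (conj isT jm')).
    have n0 : - s *: norv a != 0 :> V.
      apply/eqP => n0; have := congr1 (dotcv (norv a)) n0.
      rewrite dotZr [dotcv _ 0]dotE !pE /= !mulr0 addr0 dot_nor /cr !pE /=.
      rewrite (_ : cos a * cos a - _ = 1); last by rewrite -(cos2Dsin2 a); ring.
      by move=> /eqP; rewrite mulr1 oppr_eq0 (negbTE s0).
    have Hs x : F x -> dotcv x (- s *: norv a) <= dotcv v (- s *: norv a).
      by move=> Fx; rewrite -subr_le0 -dotBl dotZr dot_nor mulNr oppr_le0; exact: supA.
    have := interior_strict n0 Hs iz.
    rewrite dotDl gtrDl dotZl dotZr dot_nor cr_dir pmulr_rlt0 // mulNr oppr_lt0.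
    rewrite (_ : a + _ - a = s * (j.+1%:R * phi)) ?sgn1_sin //; last by ring.
    by rewrite ltNge sin_le0_pi2 // jB AB; lra.
  have jE : j = m by apply/eqP; rewrite eqn_leq jm jm'.
  have hphi' : 0 <= phi <= pi by rewrite phipi ltW.
  have e2 : 0 <= e / 2 < e by apply/andP; split; lra.
  have := supA _ (subfigure_sub clF sQ (looks_like_ray nQ e2 (wedge_end _ s1 hphi'))).
  rewrite sgn crZr mulrCA cr_dir E (_ : a + _ - a = s * (m.+1%:R * phi)); last by ring.
  rewrite sgn1_sin // pmulr_rge0 ?divr_gt0 // leNgt sin_lt0_pi2 // mpi -jE AB; lra.
split=> //; exists e, s, a; split=> // x hx; split; first by move=> Fx; split; [exact: supA|exact: supB].
move=> /(wedge_split (ltn0Sn m)) [i im wi].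
have [Q' [sQ' nQ']] := run i im.
by apply: (subfigure_sub clF sQ'); apply/(nQ' _ hx).
Qed.

(** Follow the corner along the word. At [f v] it becomes a corner of a subfigure: if [f v] is
    interior, copies of it fill a half-turn; if not, they form a corner of the whole figure with a
    multiple of the angle, to which the rest of the word is applied. The word cannot run out, as a
    wedge of opening at most [pi] contains no ball about its tip. *)
Lemma wedge_angle v phi g : word F S r g -> 0 < phi <= pi -> corner_like v phi ->
  interior F (g v) -> exists m : nat, m%:R * phi = pi.
Proof.
move=> wg; elim: wg v phi => [|{}g f P wg IH sP sf fP] v phi hphi [e [s [a [e0 s1 nF]]]] iv.
  have /andP[phi0 phipi] := hphi; exfalso.
  move: iv => /nbhs_enormP [d d0 hd].
  have m0 : 0 < Num.min d e by rewrite lt_min d0.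
  have : Num.min d e / 2 < Num.min d e by lra.
  rewrite lt_min => /andP[h1 h2].
  set k := Num.min d e / 2 in h1 h2; have k0 : 0 < k by rewrite divr_gt0.
  have nn : enorm (norv a) = 1 by rewrite enormE !pE /= sqrrN addrC cos2Dsin2 sqrtr1.
  have nx : enorm (v + (- k * s) *: norv a - v) = k.
    rewrite addrC addKr enormZ nn mulr1 normrM normrN (gtr0_norm k0).
    by case: s1 => ->; rewrite ?normrN normr1 mulr1.
  have Fx : F (v + (- k * s) *: norv a) by apply: hd; rewrite nx.
  have /nF [/(_ Fx) [h3 _] _] : enorm (v + (- k * s) *: norv a - v) < e by rewrite nx.
  move: h3; rewrite addrC addKr crZr.
  have -> : cr (dirv a) (norv a) = 1 by rewrite /cr !pE /= -(cos2Dsin2 a); ring.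
  by have := sgn1_sqr s1; nra.
have r0 := fo_gt0 fo.
have [s' [a' [s1' nP]]] := simform_looks_like r0 sf s1 nF; rewrite fP in nP.
have e0' : 0 < r * e by rewrite mulr_gt0.
have [ifv|nfv] := pselect (interior F (f v)).
  exact: wedge_up_interior sP s1' hphi e0' nP ifv.
have Ffv : F (f v).
  apply: (subfigure_sub clF sP); apply/nP; first by rewrite subrr enorm0.
  by rewrite subrr -(scale0r (dirv a')); apply: wedgeZ => //; apply: wedge_start => //;
     case/andP: hphi => /ltW -> ->.
have [m [m0 mpi cm]] := wedge_up_boundary Ffv sP s1' hphi e0' nP nfv.
have [|m' hm'] := IH (f v) (m%:R * phi) _ cm iv.
  by rewrite mpi mulr_gt0 ?ltr0n //; case/andP: hphi.
by exists (m' * m)%N; rewrite natrM -mulrA.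
Qed.

End fixed.
End angles.

Section corners.
Context {R : realType}.
Local Notation V := 'cV[R]_2.
Implicit Types (u v w x y z n a b c d p q : V) (X Y P : set V) (f g : V -> V) (s t : R).

Definition perpv u : V := cv2 (- py u, px u).

(** Adding half-planes one at a time leaves the plane, a half-plane or a wedge narrower than [pi];
    the vector [w], strictly inside all of them, excludes intersections without interior. *)
Lemma cone_of_normals (N : seq V) w : (forall n, n \in N -> dotcv w n < 0) ->
  [\/ forall x, (forall n, n \in N -> dotcv x n <= 0),
      exists2 n, n != 0 & forall x, (forall n, n \in N -> dotcv x n <= 0) <-> dotcv x n <= 0 |
      exists a b, 0 < cr a b /\ forall x, (forall n, n \in N -> dotcv x n <= 0) <->
        0 <= cr a x /\ 0 <= cr x b].
Proof.
elim: N => [|n N IH] H; first by constructor 1 => x n; rewrite in_nil.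
have wn : dotcv w n < 0 by apply: H; rewrite mem_head.
have HN : forall n, n \in N -> dotcv w n < 0 by move=> m mN; apply: H; rewrite in_cons mN orbT.
have consE x : (forall m, m \in n :: N -> dotcv x m <= 0) <->
    dotcv x n <= 0 /\ forall m, m \in N -> dotcv x m <= 0.
  split=> [h|[h1 h2] m]; last by rewrite in_cons => /orP[/eqP ->|/h2].
  by split=> [|m mN]; apply: h; rewrite ?mem_head // in_cons mN orbT.
have n0 : n != 0 by apply: contraTneq wn => ->; rewrite dotE !pE !mulr0 addr0 ltxx.
have [hN|[n' n'0 hN]|[a [b [ab hN]]]] := IH HN.
- constructor 2; exists n => // x; rewrite consE; split=> [[]//|h]; split=> //; exact: hN.
- have wn' : dotcv w n' <= 0 by apply/hN => m /HN /ltW.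
  have hE x : (forall m, m \in n :: N -> dotcv x m <= 0) <-> dotcv x n <= 0 /\ dotcv x n' <= 0.
    by rewrite consE hN.
  have main k l : 0 < cr l k -> exists a b, 0 < cr a b /\ forall x,
      (dotcv x k <= 0 /\ dotcv x l <= 0) <-> 0 <= cr a x /\ 0 <= cr x b.
    move=> kl; exists (perpv k), (- perpv l); split.
      by move: kl; rewrite /cr !pE /=; lra.
    move=> x; rewrite (_ : cr (perpv k) x = - dotcv x k); last by rewrite /cr dotE !pE /=; ring.
    rewrite (_ : cr x (- perpv l) = - dotcv x l); last by rewrite /cr dotE !pE /=; ring.
    by rewrite !oppr_ge0.
  have [h0|h0|h0] := ltgtP (cr n n') 0.
  + constructor 3; have [|a [b [ab hab]]] := main n n'; first by rewrite crC; lra.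
    by exists a, b; split=> // x; rewrite hE hab.
  + constructor 3; have [|a [b [ab hab]]] := main n' n; first by [].
    by exists a, b; split=> // x; rewrite hE -hab and_comm.
  + constructor 2; exists n => // x; rewrite hE; split=> [[]//|xn]; split=> //.
    (* [n' = l n] with [l > 0] *)
    have nn : 0 < dotcv n n by rewrite -enorm_sqr exprn_gt0 // enorm_gt0.
    have E y : dotcv n n * dotcv y n' = dotcv n n' * dotcv y n.
      have e : px n * py n' = py n * px n' by move: h0; rewrite /cr => /eqP; rewrite subr_eq0 => /eqP.
      rewrite !dotE.
      transitivity ((px n * px n' + py n * py n') * (px y * px n + py y * py n)
        + (px n * py y - py n * px y) * (px n * py n' - py n * px n')); first by ring.
      by rewrite e; ring.
    have l0 : 0 <= dotcv n n'.
      rewrite leNgt; apply/negP => l0.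
      have : 0 < dotcv n n * dotcv w n' by rewrite E nmulr_rgt0.
      by rewrite pmulr_rgt0 // ltNge wn'.
    by rewrite -(pmulr_rle0 _ nn) E mulr_ge0_le0.
- have wab : 0 <= cr a w /\ 0 <= cr w b by apply/hN => m /HN /ltW.
  have hE x : (forall m, m \in n :: N -> dotcv x m <= 0) <->
     dotcv x n <= 0 /\ (0 <= cr a x /\ 0 <= cr x b) by rewrite consE hN.
  have dec x : dotcv x n * cr a b = cr x b * dotcv a n + cr a x * dotcv b n.
    by rewrite !dotE /cr; ring.
  have := dec w; move: wab => [w1 w2] decw.
  have decw' : cr w b * dotcv a n + cr a w * dotcv b n < 0 by rewrite -decw nmulr_rlt0.
  (* [a] and [b] are the edges of the old wedge. The new half-plane keeps both, or replaces one of
     them by the vector [e] on its boundary line, or would lose both and [w] with them. *)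
  have [an|an] := lerP (dotcv a n) 0; have [bn|bn] := lerP (dotcv b n) 0.
  + constructor 3; exists a, b; split=> // x; rewrite hE; split=> [[]//|[x1 x2]]; split=> //.
    rewrite -(pmulr_lle0 _ ab) dec.
    by have := mulr_ge0_le0 x2 an; have := mulr_ge0_le0 x1 bn; lra.
  + have an' : dotcv a n < 0.
      rewrite lt_neqAle an andbT; apply/eqP => a0; move: decw'; rewrite a0 mulr0 add0r.
      by rewrite ltNge mulr_ge0 // ltW.
    pose e := dotcv b n *: a - dotcv a n *: b.
    have xe x : cr x e = - (cr a b * dotcv x n).
      by rewrite mulrC dec /e /cr !pE; ring.
    constructor 3; exists a, e; split.
      by rewrite (_ : cr a e = - dotcv a n * cr a b); [rewrite mulr_gt0 // oppr_gt0|rewrite /e /cr !pE; ring].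
    move=> x; rewrite hE xe oppr_ge0 (pmulr_rle0 _ ab); split=> [[? []]//|[x1 x2]]; split=> //; split=> //.
    rewrite -(nmulr_lle0 _ an'); have := dec x; have := mulr_ge0 x1 (ltW bn).
    by have := mulr_ge0_le0 (ltW ab) x2; lra.
  + have bn' : dotcv b n < 0.
      rewrite lt_neqAle bn andbT; apply/eqP => b0; move: decw'; rewrite b0 mulr0 addr0.
      by rewrite ltNge mulr_ge0 // ltW.
    pose e := dotcv a n *: b - dotcv b n *: a.
    have xe x : cr e x = - (cr a b * dotcv x n).
      by rewrite mulrC dec /e /cr !pE; ring.
    constructor 3; exists e, b; split.
      by rewrite (_ : cr e b = - dotcv b n * cr a b); [rewrite mulr_gt0 // oppr_gt0|rewrite /e /cr !pE; ring].
    move=> x; rewrite hE xe oppr_ge0 (pmulr_rle0 _ ab); split=> [[? []]//|[x2 x1]]; split=> //; split=> //.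
    rewrite -(nmulr_lle0 _ bn'); have := dec x; have := mulr_ge0 x1 (ltW an).
    by have := mulr_ge0_le0 (ltW ab) x2; lra.
  + by exfalso; move: decw'; rewrite ltNge addr_ge0 // mulr_ge0 // ltW.
Qed.

Section fixed.
Variables (F : set V) (S : seq (V * R)) (r : R) (L : seq (V * R)).
Hypotheses (fo : folding F S r) (iF0 : interior F 0) (L0 : forall h, h \in L -> h.1 != 0)
  (FL : forall x, F x <-> inL L x).

Lemma F_convex x y t : F x -> F y -> 0 <= t <= 1 -> F (x + t *: (y - x)).
Proof.
move=> /FL Fx /FL Fy /andP[t0 t1]; apply/FL => h hL; rewrite dot_line.
have := Fx h hL; have := Fy h hL; move: (dotcv _ _) (dotcv _ _) h.2 => A B C.
by nra.
Qed.

(* The corner of [F] at [v] with unit edge directions [a] and [b]; [s = 1] when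
   [b] lies counterclockwise of [a], and [s = -1] otherwise. *)
Record corner s v a b : Prop := Corner {
  co_s : sgn1 s;
  co_F : F v;
  co_a : dotcv a a = 1;
  co_b : dotcv b b = 1;
  co_cr : 0 < s * cr a b;
  co_near : exists2 e : R, 0 < e & forall x, enorm (x - v) < e ->
    (F x <-> 0 <= s * cr a (x - v) /\ 0 <= s * cr (x - v) b) }.

Lemma corner_swap s v a b : corner s v a b -> corner (- s) v b a.
Proof.
move=> [s1 Fv ha hb hab [e e0 H]]; split=> //.
- exact: sgn1N.
- by rewrite crC mulrNN.
- exists e => // x hx; rewrite (H x hx) (crC b) (crC _ a) !mulrNN.
  by rewrite and_comm.
Qed.

Lemma corner_global s v a b x : corner s v a b -> F x ->
  0 <= s * cr a (x - v) /\ 0 <= s * cr (x - v) b.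
Proof.
move=> [_ Fv _ _ _ [e e0 H]] Fx.
pose k := 1 + enorm (x - v) + e.
have k0 : 0 < k by rewrite /k; have := enorm_ge0 (x - v); lra.
have t0 : 0 < e / k by rewrite divr_gt0.
have t1 : 0 <= e / k <= 1.
  by rewrite ltW //= ler_pdivrMr // /k; have := enorm_ge0 (x - v); lra.
have hx : enorm (v + (e / k) *: (x - v) - v) < e.
  rewrite addrC addKr enormZ gtr0_norm // mulrAC ltr_pdivrMr // ltr_pM2l // /k; lra.
have := (H _ hx).1 (F_convex Fv Fx t1).
by rewrite addrC addKr crZr crZl !(mulrCA s) !(pmulr_rge0 _ t0).
Qed.

Lemma corner_edge s v a b : corner s v a b -> exists2 e : R, 0 < e & forall k, 0 <= k < e -> F (v + k *: a).
Proof.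
move=> [s1 Fv ha hb hab [e e0 H]]; exists e => // k /andP[k0 ke].
apply/H; first by rewrite addrC addKr enormZ /enorm ha sqrtr1 mulr1 ger0_norm.
by rewrite addrC addKr crZr crZl cruu !mulr0; split=> //; rewrite mulrCA mulr_ge0 // ltW.
Qed.

(** A deep word sends the whole figure into its interior, so [wedge_angle] applies at any corner;
    [m = 1] would be a straight angle, against the positive [cr a b]. *)
Lemma corner_angle1 v a b : corner 1 v a b -> exists2 m : nat, (1 < m)%N & dotcv a b = cos (pi / m%:R).
Proof.
move=> [_ Fv ha hb hab [e e0 H]]; rewrite mul1r in hab.
have [t [ax ay]] : exists t, px a = cos t /\ py a = sin t.
  by apply: polar_unit; rewrite -ha dotE.
have D : dotcv a b ^+ 2 + cr a b ^+ 2 = 1.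
  by rewrite -[RHS]mulr1 -{1}ha -hb !dotE /cr; ring.
have c1 : -1 <= dotcv a b <= 1.
  rewrite -ler_norml -(@expr_le1 _ 2) // real_normK ?num_real //.
  by have := sqr_ge0 (cr a b); lra.
pose phi := acos (dotcv a b).
have cphi : cos phi = dotcv a b by apply: acosK; rewrite in_itv.
have sphi : sin phi = cr a b.
  rewrite /phi sin_acos //; rewrite (_ : 1 - _ = cr a b ^+ 2); last by rewrite -D; ring.
  by rewrite sqrtr_sqr gtr0_norm.
have phi0 : 0 < phi.
  rewrite lt_neqAle acos_ge0 // andbT; apply/eqP => h.
  by move: hab; rewrite -sphi -h sin0 ltxx.
have phipi : phi <= pi by exact: acos_lepi.
have aE : a = dirv t by apply: plane_ext; rewrite !pE.
have bE : b = dirv (t + 1 * phi).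
  have e1 : cos t ^+ 2 + sin t ^+ 2 = 1 by exact: cos2Dsin2.
  apply: plane_ext; rewrite !pE /= mul1r ?cosD ?sinD cphi sphi dotE /cr ax ay.
    by rewrite -[LHS]mul1r -e1; ring.
  by rewrite -[LHS]mul1r -e1; ring.
have cl : corner_like F v phi.
  exists e, 1, t; split=> //; first by left.
  by move=> x hx; rewrite (H x hx) aE bE.
have [g wg hg] := deep_word fo iF0.
have [|m hm] := wedge_angle fo L0 FL wg _ cl (hg v Fv); first by rewrite phi0.
have m0 : (0 < m)%N.
  by rewrite lt0n; apply/eqP => m0; move: hm; rewrite m0 mul0r => /esym/eqP; rewrite gt_eqF // pi_gt0.
have phiE : phi = pi / m%:R by rewrite -hm mulrC mulKf // pnatr_eq0 -lt0n.
exists m; last by rewrite -phiE cphi.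
rewrite ltn_neqAle m0 andbT; apply/eqP => m1; move: hab.
by rewrite -sphi phiE -m1 divr1 sinpi ltxx.
Qed.

Lemma corner_angle s v a b : corner s v a b -> exists2 m : nat, (1 < m)%N & dotcv a b = cos (pi / m%:R).
Proof.
move=> co; case: (co_s co) => s1; first by apply: (@corner_angle1 v); rewrite -s1.
rewrite dotcvC; apply: (@corner_angle1 v).
by rewrite (_ : 1 = - s); [exact: corner_swap|rewrite s1 opprK].
Qed.

Lemma cos_acute (m : nat) : (1 < m)%N -> 0 <= cos (pi / m%:R : R).
Proof.
move=> m1; have m0 : (0 : R) < m%:R by rewrite ltr0n ltnW.
apply: cos_ge0_pihalf; apply/andP; split.
  apply: le_trans (_ : 0 <= _); first by rewrite oppr_le0 divr_ge0 // pi_ge0.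
  by rewrite divr_ge0 ?pi_ge0 // ltW.
by rewrite ler_wpM2l ?pi_ge0 // lef_pV2 ?posrE // ler_nat.
Qed.

Lemma corner_acute s v a b : corner s v a b -> 0 <= dotcv a b.
Proof. by move=> /corner_angle [m m1 ->]; exact: cos_acute. Qed.

(* By convexity it is enough to exclude segments of [F] centred at [v]. *)
Lemma corner_exists v : F v ->
  (forall u, u != 0 -> forall e, 0 < e -> exists2 k : R, 0 < k < e & ~ (F (v + k *: u) /\ F (v - k *: u))) ->
  exists a b, corner 1 v a b.
Proof.
move=> Fv nseg.
(* Normals of the half-planes that are tight at [v]; near [v] only these matter. *)
pose act := [seq h.1 | h <- L & dotcv v h.1 == h.2].
have actP n : n \in act <-> exists2 h, h \in L & dotcv v h.1 = h.2 /\ n = h.1.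
  split; first by move/mapP => [h]; rewrite mem_filter => /andP[/eqP hv hL] ->; exists h.
  by move=> [h hL [hv ->]]; apply: map_f; rewrite mem_filter hv eqxx.
have Fh h x : h \in L -> F x -> dotcv x h.1 <= h.2 by move=> hL /FL; apply.
(* [0] is interior, so the direction from [v] to [0] is strictly inside all tight half-planes. *)
have hw n : n \in act -> dotcv (0 - v) n < 0.
  move=> /actP [h hL [hv ->]]; rewrite dotBl subr_lt0 hv.
  by apply: interior_strict (L0 hL) _ _ iF0 => x; exact: Fh.
have [e e0 hloc] : exists2 e : R, 0 < e & forall x, enorm (x - v) < e ->
    (F x <-> forall n, n \in act -> dotcv (x - v) n <= 0).
  have : interior (inL [seq h <- L | dotcv v h.1 != h.2]) v.
    apply: strict_interior => h; rewrite mem_filter => /andP[hv hL].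
    by rewrite lt_neqAle hv Fh.
  move=> /nbhs_enormP [e e0 he]; exists e => // x /he hx; split.
    by move=> Fx n /actP [h hL [hv ->]]; rewrite dotBl subr_le0 hv Fh.
  move=> hn; apply/FL => h hL; have [hv|hv] := eqVneq (dotcv v h.1) h.2.
    by rewrite -hv -subr_le0 -dotBl; apply: hn; apply/actP; exists h.
  by apply: hx; rewrite mem_filter hv.
have noline u : u != 0 -> ~ (forall k : R, forall n, n \in act -> dotcv (k *: u) n <= 0).
  move=> u0 H; have un := enorm_gt0 u0.
  have [k /andP[k0 ke]] := nseg u u0 (e / enorm u) (divr_gt0 e0 un); apply.
  have hk : enorm (k *: u) < e by rewrite enormZ gtr0_norm // -ltr_pdivlMr.
  split; apply/hloc; rewrite addrC addKr ?enormN //; first exact: H.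
  by rewrite -scaleNr; exact: H.
have [H|[n n0 H]|[a [b [ab H]]]] := cone_of_normals hw.
- exfalso; apply: (@noline (cv2 (1, 0))); last by move=> k; exact: H.
  by apply/eqP => /(congr1 px); rewrite !pE /= => /eqP; rewrite oner_eq0.
- exfalso; apply: (@noline (perpv n)).
    apply: contra_neq n0 => r0; apply: plane_ext.
      by have := congr1 py r0; rewrite !pE.
    by have := congr1 px r0; rewrite !pE /= => /eqP; rewrite oppr_eq0 => /eqP.
  move=> k; apply/H; rewrite dotZl (_ : dotcv (perpv n) n = 0) ?mulr0 //.
  by rewrite dotE !pE /=; ring.
have a0 : a != 0 by apply: contraTneq ab => ->; rewrite /cr !pE !mul0r subrr ltxx.
have b0 : b != 0 by apply: contraTneq ab => ->; rewrite /cr !pE !mulr0 subrr ltxx.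
have an := enorm_gt0 a0; have bn := enorm_gt0 b0.
have unit c : 0 < enorm c -> dotcv ((enorm c)^-1 *: c) ((enorm c)^-1 *: c) = 1.
  by move=> cn; rewrite dotZl dotZr -enorm_sqr; field; rewrite gt_eqF.
exists ((enorm a)^-1 *: a), ((enorm b)^-1 *: b); split; rewrite ?unit //; first by left.
  by rewrite mul1r crZl crZr !mulr_gt0 ?invr_gt0.
exists e => // x hx; rewrite (hloc x hx) H !mul1r crZl crZr !pmulr_rge0 ?invr_gt0 //.
Qed.

(** A point farthest from [0] is the midpoint of no segment in the figure, by the parallelogram
    law. *)
Lemma first_corner : exists v a b, corner 1 v a b.
Proof.
have F0 : F !=set0 by exists 0; exact: interior_sub iF0.
have [v Fv hv] := compact_max (fo_compact fo) F0 (enorm_lip 0).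
exists v; apply: corner_exists => // u u0 e e0; exists (e / 2); first by apply/andP; split; lra.
have sq x y : enorm x <= enorm y -> dotcv x x <= dotcv y y.
  by move=> h; rewrite -!enorm_sqr ler_pXn2r ?nnegrE ?enorm_ge0.
move=> [/hv h1 /hv h2]; move: h1 h2; rewrite !subr0 => /sq h1 /sq h2; move: h1 h2.
have : 0 < dotcv u u by rewrite -enorm_sqr exprn_gt0 // enorm_gt0.
have e2 : 0 < e / 2 by lra.
rewrite !dotE !pE; move: (e / 2) e2 (px u) (py u) (px v) (py v) => k k0 A B C D hu h1 h2.
have : 0 < k ^+ 2 * (A * A + B * B) by rewrite mulr_gt0 // exprn_gt0.
by lra.
Qed.

Lemma line_closed (n : V) (k : R) : closed [set x | dotcv x n = k].
Proof.
move=> x /closureE_enorm H /=; apply/eqP/negPn/negP => ne.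
have [C C0 hC] := dot_lip n.
have g0 : 0 < `|dotcv x n - k| by rewrite normr_gt0 subr_eq0.
have [y /= hy] := H _ (divr_gt0 g0 C0).
rewrite ltr_pdivlMr // mulrC => hxy; have := le_lt_trans (hC y x) hxy.
by rewrite hy distrC ltxx.
Qed.

Lemma unit_parallel s a u : sgn1 s -> dotcv a a = 1 -> s * cr a u = 0 -> u = dotcv u a *: a.
Proof.
move=> s1 ha /eqP; rewrite mulf_eq0 (negbTE (sgn1_neq0 s1)) /= => /eqP cu.
apply: plane_ext; rewrite !pE dotE.
  transitivity (dotcv a a * px u + 0 * py a); first by rewrite ha; ring.
  by rewrite -cu dotE /cr; ring.
transitivity (dotcv a a * py u - 0 * px a); first by rewrite ha; ring.
by rewrite -cu dotE /cr; ring.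
Qed.

(** The far end of an edge is the point of the figure farthest along the line of the edge. A segment
    centred there would lie on that line, since the line supports the figure, and would reach
    farther; so [corner_exists] applies, and one of the two edges found runs back along [- a]. *)
Lemma next_corner s v a b : corner s v a b -> exists t c, 0 < t /\ corner s (v + t *: a) c (- a).
Proof.
move=> co; have s1 := co_s co; have ha := co_a co; have s0 := sgn1_neq0 s1.
pose X := F `&` [set x | dotcv x (perpv a) = dotcv v (perpv a)].
have crE u : dotcv u (perpv a) = cr a u by rewrite dotE /cr /perpv !pE /=; ring.
have cX : compact X by apply: compact_closedI; [exact: fo_compact fo|exact: line_closed].
have Xv : X v by split=> //; exact: co_F co.
have XE x : X x -> x = v + dotcv (x - v) a *: a.
  move=> [_ /= hx]; rewrite -(unit_parallel s1 ha) ?subrKC //.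
  by rewrite -crE dotBl hx subrr mulr0.
have [p Xp hp] := compact_max cX (ex_intro _ v Xv) (dot_lip a).
set t := dotcv (p - v) a.
have pE' : p = v + t *: a by exact: XE.
have Xt k : F (v + k *: a) -> k <= t.
  move=> Fk; have Xk : X (v + k *: a).
    by split=> //=; rewrite dotDl dotZl (crE a) cruu mulr0 addr0.
  by have := hp _ Xk; rewrite /t dotDl dotZl ha mulr1 dotBl lerBrDl.
have t0 : 0 < t.
  have [e e0 he] := corner_edge co; have h : 0 <= e / 2 < e by apply/andP; split; lra.
  by have := Xt _ (he _ h); lra.
have Fp : F p by case: Xp.
have crp : cr a (p - v) = 0 by rewrite pE' addrC addKr crZr cruu mulr0.
have side x : F x -> 0 <= s * cr a (x - p).
  move=> Fx; have [h _] := corner_global co Fx.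
  rewrite (_ : cr a (x - p) = cr a (x - v) - cr a (p - v)); last by rewrite /cr !pE; ring.
  by rewrite crp subr0.
have [|a' [b' co']] := corner_exists Fp.
  move=> u u0 e e0; exists (e / 2); first by apply/andP; split; lra.
  have k0 : 0 < e / 2 by lra.
  move: (e / 2) k0 => k k0 [F1 F2].
  have := side _ F1; have := side _ F2; rewrite !(addrC p) !addrK -scaleNr !crZr => h2 h1.
  have /(unit_parallel s1 ha) uE : s * cr a u = 0.
    have h3 : 0 <= k * (s * cr a u) by rewrite mulrCA.
    have h4 : k * (s * cr a u) <= 0 by rewrite -oppr_ge0 -mulNr mulrCA.
    by move: h3 h4; rewrite pmulr_rge0 // pmulr_rle0 // => h3 h4; apply: le_anti; rewrite h3 h4.
  have d0 : dotcv u a != 0 by apply: contra_neq u0 => d0; rewrite uE d0 scale0r.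
  have G1 : t + k * dotcv u a <= t.
    by apply: Xt; move: F1; rewrite {1}uE pE' scalerA -addrA -scalerDl.
  have G2 : t - k * dotcv u a <= t.
    by apply: Xt; move: F2; rewrite {1}uE pE' scalerA -addrA -scalerBl.
  have /eqP : k * dotcv u a = 0 by lra.
  by rewrite mulf_eq0 (negbTE d0) gt_eqF.
have {co'} [a1 [b1 co1]] : exists a1 b1, corner s p a1 b1.
  case: s1 => se; first by exists a', b'; rewrite se.
  by exists b', a'; rewrite se; exact: corner_swap.
exists t, a1; split=> //; rewrite -pE'.
suff <- : b1 = - a by [].
have [e e0 he] := corner_edge (corner_swap co1).
have e2 : 0 <= e / 2 < e by apply/andP; split; lra.
have Fe := he _ e2; have k0 : 0 < e / 2 by lra.
have h1 : 0 <= s * cr a b1.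
  by have := side _ Fe; rewrite addrC addKr crZr mulrCA pmulr_rge0.
have h2 : s * cr a b1 <= 0.
  have [_] := corner_global co1 (co_F co).
  have -> : v - p = (- t) *: a by rewrite pE' opprD addNKr scaleNr.
  by rewrite crZl mulrCA mulNr oppr_ge0 pmulr_rle0.
have bE := unit_parallel s1 ha (le_anti (introT andP (conj h2 h1))).
have := co_b co1; rewrite {1 2}bE dotZl dotZr ha mulr1 -expr2 => /eqP.
rewrite sqrf_eq1 => /orP[/eqP d1|/eqP d1]; last by rewrite bE d1 scaleN1r.
exfalso; have := Xt (t + e / 2); rewrite scalerDl addrA -pE' => H.
have ba : b1 = a by rewrite bE d1 scale1r.
by move: Fe; rewrite ba => /H; lra.
Qed.

End fixed.
End corners.

(** * Classification of the shapes *)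

Section shapes.
Context {R : realType}.
Local Notation V := 'cV[R]_2.
Implicit Types (u v w x y z n a b c d p q : V) (X Y P F : set V) (s t : R).

Definition hull3 p0 p1 p2 : set V := [set x | exists i j k : R,
  [/\ 0 <= i, 0 <= j, 0 <= k, i + j + k = 1 & x = i *: p0 + j *: p1 + k *: p2]].

Definition box p u w : set V := [set x | exists k l : R,
  [/\ 0 <= k <= 1, 0 <= l <= 1 & x = p + k *: u + l *: w]].

Definition angle_at p q q' (m : nat) := (1 < m)%N /\
  dotcv (q - p) (q' - p) = enorm (q - p) * enorm (q' - p) * cos (pi / m%:R).

Definition triangle F p0 p1 p2 (m0 m1 m2 : nat) :=
  [/\ cr (p1 - p0) (p2 - p0) != 0, F = hull3 p0 p1 p2,
      angle_at p0 p1 p2 m0, angle_at p1 p0 p2 m1 & angle_at p2 p0 p1 m2].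

Lemma acute_sin (x y : R) : 0 < x <= pi / 2 -> 0 < y -> cos x ^+ 2 + y ^+ 2 = 1 -> y = sin x.
Proof.
move=> /andP[x0 x1] y0 e; have p0 := @pi_gt0 R.
have s0 : 0 < sin x by apply: sin_gt0_pi; rewrite x0 /=; lra.
have : y ^+ 2 = sin x ^+ 2 by rewrite sin2cos2 -e; ring.
by move/eqP; rewrite eqf_sqr => /orP[/eqP //|/eqP h]; lra.
Qed.

Lemma angle_of_cos (x y z : R) : 0 < x <= pi / 2 -> 0 < y <= pi / 2 -> 0 < z <= pi / 2 ->
  cos z = cos (pi - x - y) -> z = pi - x - y.
Proof.
have p0 := @pi_gt0 R.
move=> /andP[x0 x1] /andP[y0 y1] /andP[z0 z1]; apply: cos_inj; rewrite in_itv /=.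
  by apply/andP; split; lra.
by apply/andP; split; lra.
Qed.

(* [p = v + T a], [q = v + t b], [q' = p + t' c]; in the frame [a] the unit vectors
   are [b = (b1, b2)] and [c = (- c1, c2)]. *)
Lemma apex_numbers (b1 b2 c1 c2 T t t' : R) : b1 ^+ 2 + b2 ^+ 2 = 1 -> c1 ^+ 2 + c2 ^+ 2 = 1 ->
  0 < T -> 0 < b2 -> 0 < c2 ->
  let s := c1 * b2 + c2 * b1 in let k := b2 * c2 - b1 * c1 in
  0 < s -> t' * k + b1 * T <= t -> t * k + c1 * T <= t' ->
  t * s <= c2 * T -> t' * s <= b2 * T -> t * s = c2 * T /\ t' * s = b2 * T.
Proof.
move=> hb hc T0 b20 c20 s k s0 h1 h2 h3 h4.
have ks : k ^+ 2 + s ^+ 2 = 1.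
  by rewrite -[RHS]mulr1 -{1}hb -hc /k /s; ring.
have k1 : k < 1.
  by rewrite ltNge; apply/negP => k1; have := exprn_gt0 2 s0; have := sqr_ge0 (k - 1); nra.
(* The gaps in the last two inequalities. Each is at most [k] times the other, and [k < 1] because
   [k ^+ 2 + s ^+ 2 = 1], so both vanish. *)
pose xi := c2 * T - t * s; pose eta := b2 * T - t' * s.
have xi0 : 0 <= xi by rewrite subr_ge0.
have eta0 : 0 <= eta by rewrite subr_ge0.
have H1 : xi <= eta * k.
  have e : eta * k - xi = s * (t - (t' * k + b1 * T)) + T * c2 * (b1 ^+ 2 + b2 ^+ 2 - 1).
    by rewrite /eta /xi /s /k; ring.
  by rewrite -subr_ge0 e hb subrr mulr0 addr0 mulr_ge0 ?subr_ge0 // ltW.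
have H2 : eta <= xi * k.
  have e : xi * k - eta = s * (t' - (t * k + c1 * T)) + T * b2 * (c1 ^+ 2 + c2 ^+ 2 - 1).
    by rewrite /eta /xi /s /k; ring.
  by rewrite -subr_ge0 e hc subrr mulr0 addr0 mulr_ge0 ?subr_ge0 // ltW.
suff [e1 e2] : xi = 0 /\ eta = 0 by split; apply/eqP; rewrite eq_sym -subr_eq0 ?e1 ?e2; apply/eqP.
clearbody xi eta k; clear -xi0 eta0 H1 H2 k1.
have [k0|k0] := ltrP k 0; first by split; apply: le_anti; apply/andP; split=> //; nra.
have h : (xi + eta) * (1 - k) <= 0 by lra.
have : xi + eta <= 0 by rewrite -(pmulr_lle0 _ (_ : 0 < 1 - k)) // subr_gt0.
by split; lra.
Qed.

Section fixed.
Variables (F : set V) (S : seq (V * R)) (r : R) (L : seq (V * R)).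
Hypotheses (fo : folding F S r) (iF0 : interior F 0) (L0 : forall h, h \in L -> h.1 != 0)
  (FL : forall x, F x <-> inL L x).

Let FC := F_convex FL.

(** No angle exceeds [pi / 2], so the figure stays on one side of the perpendicular erected at the
    end of an edge. *)
Lemma acute_side s v a b x : corner F s v a b -> F x -> 0 <= dotcv (x - v) b.
Proof.
move=> co Fx; have [h1 h2] := corner_global FL co Fx.
have h3 := corner_acute fo iF0 L0 FL co; have := co_cr co => h4.
rewrite -(pmulr_lge0 _ h4).
rewrite (_ : dotcv (x - v) b * _ = s * cr (x - v) b * dotcv a b + s * cr a (x - v) * dotcv b b); last first.
  by rewrite !dotE /cr; ring.
by rewrite (co_b co) mulr1 addr_ge0 // mulr_ge0.
Qed.

Lemma cos_pi_sub (x y : R) : cos (pi - x - y) = sin x * sin y - cos x * cos y.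
Proof.
rewrite (_ : pi - x - y = - (x + y) + pi); last by ring.
by rewrite cosDpi cosN cosD; ring.
Qed.

Lemma angle_sum_nat (m0 m1 m2 : nat) : (1 < m0)%N -> (1 < m1)%N -> (1 < m2)%N ->
  pi / m2%:R = pi - pi / m0%:R - pi / m1%:R :> R ->
  (m1 * m2 + m0 * m2 + m0 * m1 = m0 * m1 * m2)%N.
Proof.
move=> h0 h1 h2 ga.
have nz (m : nat) : (1 < m)%N -> (m%:R : R) != 0 by move=> h; rewrite pnatr_eq0 -lt0n ltnW.
have n0 := nz _ h0; have n1 := nz _ h1; have n2 := nz _ h2.
apply/eqP; rewrite -(eqr_nat R) !natrD !natrM; apply/eqP.
have pi0 : pi != 0 :> R by rewrite gt_eqF // pi_gt0.
apply: (mulfI pi0).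
transitivity (m0%:R * m1%:R * m2%:R * ((pi : R) / m0%:R + pi / m1%:R + pi / m2%:R)).
  by field; rewrite n0 n1 n2.
by rewrite ga; field; rewrite n0 n1.
Qed.

Lemma dotNN u w : dotcv (- u) (- w) = dotcv w u.
Proof. by rewrite !dotE !pE; ring. Qed.

Lemma bary_sub v p q (j k : R) :
  (1 - j - k) *: v + j *: p + k *: q - v = j *: (p - v) + k *: (q - v).
Proof. by apply: plane_ext; rewrite !pE; ring. Qed.

Lemma bary_join v p q (j k : R) : j + k != 0 ->
  v + (j + k) *: (p + (k / (j + k)) *: (q - p) - v) = (1 - (j + k)) *: v + j *: p + k *: q.
Proof. by move=> jk; apply: plane_ext; rewrite !pE; field. Qed.

Lemma frame_dot a u w : dotcv a a = 1 -> dotcv u w = dotcv u a * dotcv w a + cr a u * cr a w.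
Proof. by move=> ha; rewrite -[LHS]mul1r -{1}ha !dotE /cr; ring. Qed.

Lemma frame_cr a u w : dotcv a a = 1 -> cr u w = dotcv u a * cr a w - cr a u * dotcv w a.
Proof. by move=> ha; rewrite -[LHS]mul1r -{1}ha !dotE /cr; ring. Qed.

Lemma frame_ext a u w : dotcv a a = 1 -> dotcv u a = dotcv w a -> cr a u = cr a w -> u = w.
Proof.
move=> ha h1 h2; apply/eqP; rewrite -subr_eq0.
have := unit_parallel (s := 1) (u := u - w) (or_introl erefl) ha.
rewrite mul1r (_ : cr a (u - w) = cr a u - cr a w); last by rewrite /cr !pE; ring.
by rewrite h2 subrr dotBl h1 subrr scale0r => /(_ erefl) ->.
Qed.

(** With [v], [p] the ends of one edge and [q], [q'] the other ends of the neighbouring edges,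
    everything is computed in the orthonormal frame of [a]. The number [s] is the sine of the sum of
    the angles at [v] and [p]. As no angle is obtuse, either both are right, or the inequalities
    from the four corners force [q = q']. *)
Lemma folding_shape :
  (exists p u w, [/\ dotcv u w = 0, cr u w != 0 & F = box p u w]) \/
  (exists p0 p1 p2 m0 m1 m2, triangle F p0 p1 p2 m0 m1 m2 /\
     (m1 * m2 + m0 * m2 + m0 * m1 = m0 * m1 * m2)%N).
Proof.
have [v [a [b co]]] := first_corner fo iF0 L0 FL.
have [T [c [T0 cop]]] := next_corner fo iF0 L0 FL co.
have [t [d [t0 coq]]] := next_corner fo iF0 L0 FL (corner_swap co).
have [t' [c' [t'0 coq']]] := next_corner fo iF0 L0 FL cop.
set p := v + T *: a in cop coq'; set q := v + t *: b in coq; set q' := p + t' *: c in coq'.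
have ha := co_a co; have hb := co_b co; have hc := co_a cop.
pose b1 := dotcv b a; pose b2 := cr a b; pose c1 := - dotcv c a; pose c2 := cr a c.
have b20 : 0 < b2 by have := co_cr co; rewrite mul1r.
have c20 : 0 < c2 by have := co_cr cop; rewrite mul1r -scaleN1r crZr crC mulN1r opprK.
have b10 : 0 <= b1 by rewrite /b1 dotcvC; exact: (corner_acute fo iF0 L0 FL co).
have c10 : 0 <= c1.
  have := corner_acute fo iF0 L0 FL cop; rewrite -scaleN1r dotZr mulN1r.
  by rewrite /c1.
have nb : b1 ^+ 2 + b2 ^+ 2 = 1 by have := frame_dot b b ha; rewrite hb /b1 /b2 => ->; ring.
have nc : c1 ^+ 2 + c2 ^+ 2 = 1 by have := frame_dot c c ha; rewrite hc /c1 /c2 => ->; ring.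
have Fv := co_F co; have Fp := co_F cop; have Fq := co_F coq; have Fq' := co_F coq'.
have Xp : dotcv (p - v) a = T by rewrite /p addrC addKr dotZl ha mulr1.
have Yp : cr a (p - v) = 0 by rewrite /p addrC addKr crZr cruu mulr0.
have Xq : dotcv (q - v) a = t * b1 by rewrite /q addrC addKr dotZl.
have Yq : cr a (q - v) = t * b2 by rewrite /q addrC addKr crZr.
have Xq' : dotcv (q' - v) a = T - t' * c1.
  by rewrite /q' addrAC dotDl Xp dotZl /c1; ring.
have Yq' : cr a (q' - v) = t' * c2 by rewrite /q' addrAC crDr Yp crZr add0r.
have g1 x : F x -> 0 <= cr a (x - v).
  by move=> /(corner_global FL co) []; rewrite mul1r.
have g2 x : F x -> 0 <= dotcv (x - v) a * b2 - cr a (x - v) * b1.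
  by move=> /(corner_global FL co) []; rewrite !mul1r (frame_cr _ b ha).
have g3 x : F x -> 0 <= c2 * T - c1 * cr a (x - v) - c2 * dotcv (x - v) a.
  move=> /(corner_global FL cop) []; rewrite !mul1r (frame_cr c _ ha) -/c2 => + _.
  rewrite (_ : x - p = (x - v) - (p - v)); last by rewrite opprB addrA subrK.
  rewrite (_ : cr a (x - v - (p - v)) = cr a (x - v) - cr a (p - v)); last by rewrite /cr !pE; ring.
  by rewrite dotBl Xp Yp /c1; lra.
have g4 x : F x -> b1 * dotcv (x - v) a + b2 * cr a (x - v) <= t.
  move=> /(acute_side coq).
  rewrite (_ : dotcv _ _ = t * dotcv b b - dotcv (x - v) b); last by rewrite /q !dotE !pE; ring.
  by rewrite hb mulr1 (frame_dot _ b ha) -/b1 -/b2; lra.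
have g5 x : F x -> c2 * cr a (x - v) - c1 * (dotcv (x - v) a - T) <= t'.
  move=> /(acute_side coq').
  rewrite (_ : dotcv _ _ = t' * dotcv c c - dotcv (x - v - (p - v)) c); last by rewrite /q' !dotE !pE; ring.
  rewrite hc mulr1 (frame_dot _ c ha) dotBl Xp -/c2.
  rewrite (_ : cr a (x - v - (p - v)) = cr a (x - v) - cr a (p - v)); last by rewrite /cr !pE; ring.
  by rewrite Yp /c1; lra.
have i1 := g4 _ Fq'; rewrite Xq' Yq' in i1.
have i2 := g5 _ Fq; rewrite Xq Yq in i2.
have i3 := g3 _ Fq; rewrite Xq Yq in i3.
have i4 := g2 _ Fq'; rewrite Xq' Yq' in i4.
have s0 : 0 <= c1 * b2 + c2 * b1 by rewrite addr_ge0 // mulr_ge0 // ltW.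
move: s0; rewrite le_eqVlt => /orP[/eqP s0|s0].
  left; have h1 : c1 * b2 = 0 by have := mulr_ge0 c10 (ltW b20); have := mulr_ge0 (ltW c20) b10; lra.
  have h2 : c2 * b1 = 0 by lra.
  have c1E : c1 = 0 by apply/eqP; move/eqP: h1; rewrite mulf_eq0 (gt_eqF b20) orbF.
  have b1E : b1 = 0 by apply/eqP; move/eqP: h2; rewrite mulf_eq0 (gt_eqF c20).
  have one (z : R) : 0 < z -> 0 ^+ 2 + z ^+ 2 = 1 -> z = 1.
    move=> z0; rewrite expr0n /= add0r => /eqP; rewrite sqrf_eq1 => /orP[/eqP //|/eqP ze].
    by move: z0; rewrite ze; lra.
  have b2E : b2 = 1 by apply: one => //; rewrite -b1E.
  have c2E : c2 = 1 by apply: one => //; rewrite -c1E.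
  rewrite b1E b2E c1E c2E in i1 i2 g2 g3 g4.
  have tt : t' = t by lra.
  have cb : c = b by apply: (frame_ext ha); [rewrite -/b1 b1E; move: c1E; rewrite /c1; lra|rewrite -/c2 -/b2 c2E b2E].
  exists v, (T *: a), (t *: b); split.
  - by rewrite dotZl dotZr dotcvC -/b1 b1E !mulr0.
  - by rewrite crZl crZr -/b2 b2E mulr1 mulf_neq0 // gt_eqF.
  - apply/seteqP; split=> x.
      move=> Fx; have := g1 x Fx; have := g2 x Fx; have := g3 x Fx; have := g4 x Fx.
      set A := dotcv _ a; set B := cr a _ => k1 k2 k3 k4.
      exists (A / T), (B / t); split.
      + by clear -T0 t0 k1 k2 k3 k4; apply/andP; split; [rewrite divr_ge0 //; lra|rewrite ler_pdivrMr //; lra].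
      + by clear -T0 t0 k1 k2 k3 k4; apply/andP; split; [rewrite divr_ge0 //; lra|rewrite ler_pdivrMr //; lra].
      + rewrite !scalerA !mulfVK ?gt_eqF //; transitivity (v + (x - v)); first by rewrite subrKC.
        rewrite -addrA; congr (_ + _); apply: (frame_ext ha).
          by rewrite -/A (dotDl (A *: a)) !dotZl ha -/b1 b1E; ring.
        by rewrite -/B (crDr (A *: a)) !crZr cruu -/b2 b2E; ring.
    move=> [k [l [hk hl ->]]].
    have Fk : F (v + k *: (p - v)) := FC Fv Fp hk.
    have Fl : F (q + k *: (q' - q)) := FC Fq Fq' hk.
    have := FC Fk Fl hl; congr F.
    by rewrite /q' /q /p tt cb; apply: plane_ext; rewrite !pE; ring.
right; have j1 : t' * (b2 * c2 - b1 * c1) + b1 * T <= t by move: i1; clearbody b1 b2 c1 c2; lra.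
have j2 : t * (b2 * c2 - b1 * c1) + c1 * T <= t' by move: i2; clearbody b1 b2 c1 c2; lra.
have j3 : t * (c1 * b2 + c2 * b1) <= c2 * T by move: i3; clearbody b1 b2 c1 c2; lra.
have j4 : t' * (c1 * b2 + c2 * b1) <= b2 * T by move: i4; clearbody b1 b2 c1 c2; lra.
have [e1 e2] := apex_numbers nb nc T0 b20 c20 s0 j1 j2 j3 j4.
set s := c1 * b2 + c2 * b1 in s0 e1 e2.
have qq : q' = q.
  apply: (addIr (- v)); apply: (frame_ext ha).
    rewrite Xq Xq'; apply: (mulIf (lt0r_neq0 s0)); rewrite mulrBl.
    rewrite (_ : t' * c1 * s = c1 * (t' * s)); last by ring.
    rewrite e2 (_ : t * b1 * s = b1 * (t * s)); last by ring.
    by rewrite e1 /s; ring.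
  rewrite Yq Yq'; apply: (mulIf (lt0r_neq0 s0)).
  rewrite (_ : t' * c2 * s = c2 * (t' * s)); last by ring.
  rewrite e2 (_ : t * b2 * s = b2 * (t * s)); last by ring.
  by rewrite e1; ring.
have qpE : q - p = t' *: c by rewrite -qq /q' addrC addKr.
have crbc : cr b c = s by rewrite (frame_cr b c ha) -/b1 -/b2 -/c2 /s /c1; ring.
(* The edge from [q] must stay inside the corner at [p], and [p] inside the corner at [q], so [d] is
   parallel to [c]; orientation fixes the sign. *)
have dE : d = - c.
  have d1 := co_a coq.
  have [e e0 he] := corner_edge coq.
  have k0 : 0 < e / 2 by rewrite divr_gt0.
  have h : 0 <= e / 2 < e by rewrite ltW //= gtr_pMr // invf_lt1 // ltr1n.
  have [+ _] := corner_global FL cop (he _ h); rewrite mul1r.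
  rewrite (_ : q + _ - p = t' *: c + (e / 2) *: d); last by rewrite -qpE addrAC.
  rewrite crDr !crZr cruu mulr0 add0r pmulr_rge0 // => z1.
  have [+ _] := corner_global FL coq Fp.
  rewrite (_ : p - q = (- t') *: c); last by rewrite -opprB qpE scaleNr.
  rewrite crZr mulN1r mulNr opprK pmulr_rge0 // crC oppr_ge0 => z2.
  have cd : 1 * cr c d = 0 by rewrite mul1r; apply: le_anti; rewrite z1 z2.
  have dc := unit_parallel (or_introl erefl) hc cd.
  move: d1; rewrite {1 2}dc dotZl dotZr hc mulr1 -expr2 => /eqP; rewrite sqrf_eq1.
  move=> /orP[/eqP de|/eqP de]; last by rewrite dc de scaleN1r.
  exfalso; move: (co_cr coq); rewrite dc de scale1r -(scaleN1r b) crZr crC crbc.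
  by lra.
have [m0 m0g h0] := corner_angle fo iF0 L0 FL co.
have [m1 m1g h1] := corner_angle fo iF0 L0 FL cop.
have [m2 m2g h2] := corner_angle fo iF0 L0 FL coq.
have ab1 : b1 = cos (pi / m0%:R) by rewrite -h0 dotcvC.
have ac1 : c1 = cos (pi / m1%:R) by rewrite -h1 -scaleN1r dotZr mulN1r.
have bc2 : dotcv b c = cos (pi / m2%:R).
  by rewrite -h2 dE dotNN.
have nn (x : V) : dotcv x x = 1 -> enorm x = 1 by move=> xx; rewrite /enorm xx sqrtr1.
exists v, p, q, m0, m1, m2; split.
  split.
  - rewrite /p /q !(addrC v) !addrK crZl crZr.
    by rewrite mulf_neq0 ?mulf_neq0 ?gt_eqF.
  - apply/seteqP; split=> x.
      move=> Fx; have := g1 x Fx; have := g2 x Fx; have := g3 x Fx.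
      set A := dotcv _ a; set B := cr a _ => k1 k2 k3.
      exists (1 - (A * b2 - B * b1) / (T * b2) - B / (t * b2)), ((A * b2 - B * b1) / (T * b2)), (B / (t * b2)).
      have tE : t = c2 * T / s by rewrite -e1 mulfK // gt_eqF.
      split.
      + rewrite (_ : _ - _ = (c2 * T - c1 * B - c2 * A) / (c2 * T)); last first.
          by rewrite tE /s; field; rewrite -/s !gt_eqF.
        by rewrite divr_ge0 // mulr_ge0 ?ltW.
      + by rewrite divr_ge0 // mulr_ge0 ?ltW.
      + by rewrite divr_ge0 // mulr_ge0 ?ltW.
      + by ring.
      + apply: (addIr (- v)).
        set j := _ / (T * b2); set k := B / _; rewrite bary_sub.
        apply: (frame_ext ha).
          by rewrite -/A (dotDl (j *: _)) !dotZl Xp Xq /j /k; field; rewrite !gt_eqF.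
        by rewrite -/B (crDr (j *: _)) !crZr Yp Yq /j /k; field; rewrite !gt_eqF.
    move=> [i [j [k [i0 j0 k0 ijk ->]]]].
    have [jk|jk] := eqVneq (j + k) 0.
      have [j00 k00] : j = 0 /\ k = 0 by lra.
      have i00 : i = 1 by lra.
      by rewrite i00 j00 k00 scale1r !scale0r !addr0.
    have jk0 : 0 < j + k by rewrite lt_neqAle eq_sym jk addr_ge0.
    have Fpq : F (p + (k / (j + k)) *: (q - p)).
      apply: FC => //; apply/andP; split; first exact: (divr_ge0 k0 (ltW jk0)).
      by rewrite ler_pdivrMr // mul1r lerDr.
    have iE : 1 - (j + k) = i by rewrite -ijk -[i + j + k]addrA addrK.
    have jk1 : 0 <= j + k <= 1 by rewrite (ltW jk0) /= -ijk -addrA lerDr.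
    by have := FC Fv Fpq jk1; rewrite bary_join // iE.
  - split=> //; rewrite /p /q !(addrC v) !addrK dotZl dotZr !enormZ !nn // -h0.
    by rewrite !gtr0_norm //; ring.
  - split=> //; rewrite qpE (_ : v - p = - T *: a); last by rewrite /p opprD addNKr scaleNr.
    rewrite dotZl dotZr !enormZ !nn // normrN !gtr0_norm // -ac1 /c1 dotcvC; ring.
  - split=> //; rewrite (_ : v - q = - t *: b); last by rewrite /q opprD addNKr scaleNr.
    rewrite (_ : p - q = - t' *: c); last by rewrite -opprB qpE scaleNr.
    by rewrite dotZl dotZr !enormZ !nn // !normrN !gtr0_norm // -bc2; ring.
have mp (m : nat) : (1 < m)%N -> 0 < (pi : R) / m%:R <= pi / 2.
  move=> m1'; have m0' : (0 : R) < m%:R by rewrite ltr0n ltnW.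
  by rewrite divr_gt0 ?pi_gt0 //= ler_wpM2l ?pi_ge0 // lef_pV2 ?posrE // ler_nat.
have sb : b2 = sin (pi / m0%:R) by apply: (acute_sin (mp _ m0g) b20); rewrite -ab1.
have sc : c2 = sin (pi / m1%:R) by apply: (acute_sin (mp _ m1g) c20); rewrite -ac1.
have ga : pi / m2%:R = pi - pi / m0%:R - pi / m1%:R :> R.
  apply: (angle_of_cos (mp _ m0g) (mp _ m1g) (mp _ m2g)).
  rewrite -bc2 (frame_dot b c ha) -/b1 -/b2 -/c2 -[dotcv c a]opprK -/c1 ab1 ac1 sb sc.
  by rewrite cos_pi_sub; ring.
exact: (angle_sum_nat m0g m1g m2g ga).
Qed.

End fixed.
End shapes.

(** * Frames and lattices *)

Section frames.
Context {R : realType}.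
Local Notation V := 'cV[R]_2.
Local Notation i1 := (lift ord0 ord0 : 'I_2).
Implicit Types (u v w x y z n a b c d p q : V) (X Y P F K C : set V) (s t : R) (f g : V -> V)
  (G : set (V -> V)) (A B : 'M[R]_2).

Definition coordx p u w x : R := cr (x - p) w / cr u w.
Definition coordy p u w x : R := cr u (x - p) / cr u w.
Definition frame_pt p u w (s t : R) : V := p + s *: u + t *: w.

Lemma fxpt p u w s t : cr u w != 0 -> coordx p u w (frame_pt p u w s t) = s.
Proof.
move=> uw; apply: (mulIf uw); rewrite /coordx mulfVK // /frame_pt /cr !pE; ring.
Qed.

Lemma fypt p u w s t : cr u w != 0 -> coordy p u w (frame_pt p u w s t) = t.
Proof.
move=> uw; apply: (mulIf uw); rewrite /coordy mulfVK // /frame_pt /cr !pE; ring.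
Qed.

Lemma ptK p u w x : cr u w != 0 -> frame_pt p u w (coordx p u w x) (coordy p u w x) = x.
Proof.
move=> uw; rewrite /frame_pt /coordx /coordy; move: uw; rewrite /cr => uw.
by apply: plane_ext; rewrite !pE; field.
Qed.

Lemma fix_null g : affine_bij g -> g <> id -> lebesgue_null [set x | g x = x].
Proof.
move=> [a [b [c [d [e [h [D E]]]]]]] gid.
have lin (k l m : R) (N : set V) : (forall x, N x -> k * px x + l * py x = m) ->
    ~ (k = 0 /\ l = 0) -> lebesgue_null N.
  move=> H kl; apply: (@nullS _ _ [set x | dotcv x (cv2 (k, l)) = m]).
    by move=> x /H /= <-; rewrite dotE !pE /=; ring.
  apply: null_line; apply/eqP => n0; apply: kl.
  by have := congr1 px n0; have := congr1 py n0; rewrite !pE.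
have gE x : g x = x -> a * px x + b * py x + e = px x /\ c * px x + d * py x + h = py x.
  by rewrite E => gx; have := congr1 px gx; have := congr1 py gx; rewrite !pE.
have [h1|h1] := pselect (a - 1 = 0 /\ b = 0); last first.
  by apply: (lin (a - 1) b (- e) _ _ h1) => x /= /gE []; lra.
have [h2|h2] := pselect (c = 0 /\ d - 1 = 0); last first.
  by apply: (lin c (d - 1) (- h) _ _ h2) => x /= /gE []; lra.
have [a1 b0] : a = 1 /\ b = 0 by lra.
have [d1 c0] : d = 1 /\ c = 0 by lra.
apply: nullS (null_set0 (R := R)) => x /= /gE []; rewrite a1 b0 c0 d1 => x1 x2.
apply: gid; apply/funext => y; rewrite E a1 b0 c0 d1; apply: plane_ext; rewrite !pE /=; lra.
Qed.

(** [Z] absorbs the points where representatives may fail to be unique. Elsewhere an overlap of [C]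
    with its image under [g] consists of fixed points of [g], which form a null set. *)
Lemma tile_of_folding G C Z : affine_group G -> lebesgue_null Z ->
  (forall g x, G g -> C x -> C (g x) -> ~ Z x -> ~ Z (g x) -> g x = x) ->
  (forall x, exists2 g, G g & C (g x)) -> tile G C.
Proof.
move=> aG nZ U cov; split.
- move=> g Gg gid; apply: nullS (nullU (nullU nZ (null_affine (aG.2 g Gg) nZ)) (fix_null (aG.2 g Gg) gid)).
  move=> _ [[x Cx <-] Cgx].
  have [Zgx|Zgx] := pselect (Z (g x)); first by left; left.
  have [Zx|Zx] := pselect (Z x); first by left; right; exists x.
  by right; rewrite /= !(U g x Gg Cx Cgx Zx Zgx).
- apply: nullS (null_set0 (R := R)) => x; apply.
  have [g Gg Cg] := cov x; have [h [Gh gK hK]] := agroup_inv aG Gg.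
  by exists h => //; exists (g x).
Qed.

Lemma lattice_cols B Gamma : lattice_basis B Gamma -> exists u w, [/\ cr u w != 0,
  Gamma = [set x | exists i j : int, x = i%:~R *: u + j%:~R *: w] &
  parallelepiped B = [set x | exists s t : R, [/\ 0 <= s < 1, 0 <= t < 1 & x = s *: u + t *: w]]].
Proof.
move=> [Bu ->]; exists (col ord0 B), (col i1 B); split.
- move: Bu; rewrite unitmxE unitfE det2 /cr /px /py !mxE; rewrite (mulrC (B i1 ord0)) //.
- apply/seteqP; split=> x.
    by move=> [k _ <-]; exists (k ord0), (k i1); rewrite big2.
  move=> [i [j ->]]; exists (fun l => if l == ord0 then i else j) => //.
  by rewrite big2.
- apply/seteqP; split=> x.
    by move=> [k /= hk <-]; exists (k ord0), (k i1); rewrite big2; split.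
  move=> [s [t [hs ht ->]]]; exists (fun l => if l == ord0 then s else t) => /=.
    by move=> l; case: ifP.
  by rewrite big2.
Qed.

Lemma lattice_of_cols u w : cr u w != 0 -> exists B,
  lattice_basis B [set x | exists i j : int, x = i%:~R *: u + j%:~R *: w].
Proof.
move=> uw; pose B : 'M[R]_2 := \matrix_(i, j) (if j == ord0 then u i ord0 else w i ord0).
have c0 : col ord0 B = u by apply/colP => i; rewrite !mxE.
have c1 : col i1 B = w by apply/colP => i; rewrite !mxE.
exists B; split.
  by rewrite unitmxE unitfE det2 !mxE /= (mulrC (w _ _)).
apply/seteqP; split=> x.
  move=> [i [j ->]]; exists (fun l => if l == ord0 then i else j) => //.
  by rewrite big2 c0 c1.
by move=> [k _ <-]; exists (k ord0), (k i1); rewrite big2 c0 c1.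
Qed.

Definition lat u w : set V := [set x | exists i j : int, x = i%:~R *: u + j%:~R *: w].

Lemma translation_affine c : affine_bij (fun x => x + c).
Proof.
exists 1, 0, 0, 1, (px c), (py c); split; first by rewrite mulr1 mulr0 subr0 oner_eq0.
by move=> x; apply: plane_ext; rewrite !pE /=; ring.
Qed.

Lemma lat_group u w : affine_group (translations (lat u w)).
Proof.
split; last by move=> _ [c _ <-]; exact: translation_affine.
split.
- exists 0; last by apply/funext => x; rewrite addr0.
  by exists 0, 0; rewrite !scale0r addr0.
- move=> _ _ [c [i [j ->]] <-] [d [k [l ->]] <-].
  exists ((i + k)%:~R *: u + (j + l)%:~R *: w); first by exists (i + k), (j + l).
  by apply/funext => x /=; rewrite !rmorphD /=; apply: plane_ext; rewrite !pE; ring.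
- move=> _ [c [i [j ->]] <-]; exists (fun x => x + ((- i)%:~R *: u + (- j)%:~R *: w)).
  split; [by exists ((- i)%:~R *: u + (- j)%:~R *: w) => //; exists (- i), (- j)| |];
    by move=> x /=; rewrite !rmorphN /=; apply: plane_ext; rewrite !pE; ring.
Qed.

Lemma lat_countable u w : countable (translations (lat u w)).
Proof.
have -> : translations (lat u w) =
    (fun ij : int * int => (fun x => x + (ij.1%:~R *: u + ij.2%:~R *: w))) @` setT.
  apply/seteqP; split=> f.
    by move=> [c [i [j ->]] <-]; exists (i, j).
  by move=> [[i j] _ <-]; exists (i%:~R *: u + j%:~R *: w) => //; exists i, j.
by apply: sub_countable (card_image_le _ _) _; exact: countableP.
Qed.

Lemma unit_shift (k : int) (a b : R) : 0 <= a < 1 -> 0 <= b < 1 -> a + k%:~R = b -> k = 0.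
Proof.
move=> /andP[a0 a1] /andP[b0 b1] ab.
have : (-1)%:~R < k%:~R :> R by rewrite mulrN1z; lra.
have : k%:~R < 1%:~R :> R by rewrite mulr1z; lra.
by rewrite !ltr_int; clear; lia.
Qed.

Lemma half_open_tile p u w : cr u w != 0 -> tile (translations (lat u w))
  [set x | exists s t : R, [/\ 0 <= s < 1, 0 <= t < 1 & x = p + s *: u + t *: w]].
Proof.
move=> uw; split.
- move=> _ [c [i [j ->]] <-] fid; apply: nullS (null_set0 (R := R)).
  move=> _ [[_ [s [t [hs ht ->]]] <-] [s' [t' [hs' ht']]]].
  have inj (s1 t1 s2 t2 : R) : p + s1 *: u + t1 *: w = p + s2 *: u + t2 *: w -> s1 = s2 /\ t1 = t2.
    move=> e; have e' : frame_pt p u w s1 t1 = frame_pt p u w s2 t2 by [].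
    by split; [rewrite -(fxpt p s1 t1 uw) e' fxpt|rewrite -(fypt p s1 t1 uw) e' fypt].
  have -> : p + s *: u + t *: w + (i%:~R *: u + j%:~R *: w) = p + (s + i%:~R) *: u + (t + j%:~R) *: w.
    by apply: plane_ext; rewrite !pE; ring.
  move=> /inj [si tj]; apply: fid.
  rewrite (unit_shift hs hs' si) (unit_shift ht ht' tj).
  by apply/funext => x; rewrite !scale0r !addr0.
- apply: nullS (null_set0 (R := R)) => x; apply.
  pose s := coordx p u w x; pose t := coordy p u w x.
  exists (fun x => x + ((Num.floor s)%:~R *: u + (Num.floor t)%:~R *: w)).
    by exists ((Num.floor s)%:~R *: u + (Num.floor t)%:~R *: w) => //; exists (Num.floor s), (Num.floor t).
  exists (p + (s - (Num.floor s)%:~R) *: u + (t - (Num.floor t)%:~R) *: w).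
    have fl (a : R) : 0 <= a - (Num.floor a)%:~R < 1.
      by have /andP[h1 h2] := real_floor_itv (num_real a); move: h2; rewrite intrD => h2; apply/andP; split; lra.
    by exists (s - (Num.floor s)%:~R), (t - (Num.floor t)%:~R).
  rewrite -[RHS](ptK p x uw) -/s -/t /frame_pt; apply: plane_ext; rewrite !pE; ring.
Qed.

End frames.

(** * Weyl groups of triangles and rectangles *)

Section mirrors.
Context {R : realType}.
Local Notation V := 'cV[R]_2.
Implicit Types (u v w x y z n a b c d p q : V) (X Y P F K C : set V) (s t : R) (f g : V -> V)
  (G : set (V -> V)).

(** The reflection in the line through [p] along [d], written with a direction instead of a normal
    because edges are known by their vertices. *)
Definition mirror p d z : V := p - (z - p) + (2 * dotcv (z - p) d / dotcv d d) *: d.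

Lemma dot_self_neq0 d : d != 0 -> dotcv d d != 0.
Proof. by move=> d0; rewrite -enorm_sqr expf_neq0 // gt_eqF // enorm_gt0. Qed.

Lemma orth_plane (d1 d2 k l : R) : d1 * d1 + d2 * d2 != 0 -> d1 * k + d2 * l = 0 ->
  k = (d1 * l - d2 * k) / (d1 * d1 + d2 * d2) * - d2 /\ l = (d1 * l - d2 * k) / (d1 * d1 + d2 * d2) * d1.
Proof.
move=> dd e; split; apply: (mulIf dd).
  transitivity (k * (d1 * d1 + d2 * d2) - d1 * (d1 * k + d2 * l)); first by rewrite e; ring.
  by field.
transitivity (l * (d1 * d1 + d2 * d2) - d2 * (d1 * k + d2 * l)); first by rewrite e; ring.
by field.
Qed.

Lemma reflect_coord (x1 x2 p1 p2 d1 d2 k : R) : k != 0 -> d1 * d1 + d2 * d2 != 0 ->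
  let c := 2 * (x1 * (k * - d2) + x2 * (k * d1) - (p1 * (k * - d2) + p2 * (k * d1))) /
    ((k * - d2) * (k * - d2) + (k * d1) * (k * d1)) in
  let e := 2 * ((x1 - p1) * d1 + (x2 - p2) * d2) / (d1 * d1 + d2 * d2) in
  x1 - c * (k * - d2) = p1 - (x1 - p1) + e * d1 /\ x2 - c * (k * d1) = p2 - (x2 - p2) + e * d2.
Proof.
move=> k0 dd c e.
have cE : c = 2 * ((x2 - p2) * d1 - (x1 - p1) * d2) / (k * (d1 * d1 + d2 * d2)).
  rewrite /c; field; rewrite k0 dd /=.
  by have -> : (k * - d2) ^+ 2 + (k * d1) ^+ 2 = k ^+ 2 * (d1 * d1 + d2 * d2); [ring|rewrite mulf_neq0 // expf_neq0].
by rewrite cE /e; split; field; rewrite k0 dd.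
Qed.

Lemma reflection_mirror (h : V * R) p d : h.1 != 0 -> d != 0 -> dotcv p h.1 = h.2 ->
  dotcv d h.1 = 0 -> reflection h = mirror p d.
Proof.
move=> h0 d0 hp hd; apply/funext => z; rewrite /reflection /mirror -hp.
have dd := dot_self_neq0 d0.
have [k k0 hE] : exists2 k, k != 0 & h.1 = k *: perpv d.
  move: dd hd; rewrite !dotE => dd /(orth_plane dd) [e1 e2].
  exists ((px d * py h.1 - py d * px h.1) / (px d * px d + py d * py d)); last first.
    by apply: plane_ext; rewrite /perpv !pE.
  apply: contra_neq h0 => k0; rewrite k0 !mul0r in e1 e2.
  by apply: plane_ext; rewrite pE.
rewrite hE; move: dd; rewrite !dotE /perpv !pE => dd.
by apply: plane_ext; rewrite !pE; have [] := reflect_coord (px z) (py z) (px p) (py p) k0 dd.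
Qed.

Lemma bounding_two_points C (h : V * R) : h.1 != 0 -> bounding C h ->
  ((forall x, C x -> dotcv x h.1 <= h.2) \/ (forall x, C x -> h.2 <= dotcv x h.1)) /\
  exists z z', [/\ z <> z', C z, C z', dotcv z h.1 = h.2 & dotcv z' h.1 = h.2].
Proof.
move=> h0 [side [U [oU [z [hz Uz]] HU]]]; split=> //.
have [e e0 he] := (openE_enorm U).1 oU z Uz.
have r0 : perpv h.1 != 0.
  apply: contra_neq h0 => r0; apply: plane_ext.
    by have := congr1 py r0; rewrite /perpv !pE.
  by have := congr1 px r0; rewrite /perpv !pE /= => /eqP; rewrite oppr_eq0 => /eqP.
have rn := enorm_gt0 r0.
pose z' := z + (e / 2 / enorm (perpv h.1)) *: perpv h.1.
have k0 : 0 < e / 2 / enorm (perpv h.1) by rewrite !divr_gt0.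
have hz' : dotcv z' h.1 = h.2.
  by rewrite /z' dotDl dotZl (_ : dotcv (perpv _) _ = 0) ?mulr0 ?addr0 // dotE /perpv !pE /=; ring.
exists z, z'; split=> //.
- move=> /eqP; rewrite /z' -subr_eq0 opprD addNKr oppr_eq0 scaler_eq0 (negbTE r0) orbF.
  by rewrite gt_eqF.
- by apply: HU.
- apply: HU; split=> //; apply: he; rewrite /z' addrC addKr enormZ gtr0_norm // mulfVK ?gt_eqF //; lra.
Qed.

Lemma bounding_by C (h : V * R) (L : seq (V * R)) z0 :
  (forall x, C x -> h.2 <= dotcv x h.1) -> dotcv z0 h.1 = h.2 ->
  (forall k, k \in L -> dotcv z0 k.1 < k.2) ->
  (forall x, dotcv x h.1 = h.2 -> inL L x -> C x) -> bounding C h.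
Proof.
move=> side hz0 Lz0 HC; split; first by right.
exists (interior (inL L)); split.
- exact: open_interior.
- by exists z0; split=> //; exact: strict_interior.
- by move=> x [hx /interior_sub Lx]; exact: HC.
Qed.

Section frame.
Variables (p u w : V).
Hypothesis uw : cr u w != 0.
Local Notation fx := (coordx p u w).
Local Notation fy := (coordy p u w).
Local Notation pt := (frame_pt p u w).

Definition hfr (a b c : R) : V * R :=
  ((a / cr u w) *: - perpv w + (b / cr u w) *: perpv u,
   (a / cr u w) * dotcv p (- perpv w) + (b / cr u w) * dotcv p (perpv u) - c).

Lemma hfrE (a b c : R) z : dotcv z (hfr a b c).1 - (hfr a b c).2 = a * fx z + b * fy z + c.
Proof.
rewrite /hfr /= /coordx /coordy; move: uw; rewrite !dotE /perpv /cr => uw'.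
by rewrite !pE /=; field.
Qed.

Lemma hfr_neq0 (a b c : R) : (a, b) != (0, 0) -> (hfr a b c).1 != 0.
Proof.
apply: contra_neq => h0.
have H z : a * fx z + b * fy z + c = - (hfr a b c).2.
  by rewrite -hfrE h0 dotE !pE !mulr0 addr0 sub0r.
have h00 := H (pt 0 0); have h10 := H (pt 1 0); have h01 := H (pt 0 1).
rewrite !fxpt // !fypt // in h00 h10 h01.
move: h00 h10 h01; move: (- _) => m {H h0} h00 h10 h01.
have -> : a = 0 by lra.
by have -> : b = 0 by lra.
Qed.

Lemma functionalE (h : V * R) z : dotcv z h.1 - h.2 =
  dotcv u h.1 * fx z + dotcv w h.1 * fy z + (dotcv p h.1 - h.2).
Proof.
rewrite -{1}(ptK p z uw) /frame_pt !dotDl !dotZl; ring.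
Qed.

Lemma frame_eq z z' : fx z = fx z' -> fy z = fy z' -> z = z'.
Proof. by move=> h1 h2; rewrite -(ptK p z uw) -(ptK p z' uw) h1 h2. Qed.

(** In frame coordinates only the Gram matrix of [u] and [w] enters, so the shapes of triangle
    differ here by their scalar products alone. *)
Lemma mirror_act (i0 j0 i j : R) d z : d = i *: u + j *: w ->
  let c := 2 * ((fx z - i0) * (i * dotcv u u + j * dotcv u w) +
                (fy z - j0) * (i * dotcv u w + j * dotcv w w)) /
    (i ^+ 2 * dotcv u u + 2 * i * j * dotcv u w + j ^+ 2 * dotcv w w) in
  mirror (pt i0 j0) d z = pt (2 * i0 - fx z + c * i) (2 * j0 - fy z + c * j).
Proof.
move=> dE c; rewrite /mirror.
have zE : z - pt i0 j0 = (fx z - i0) *: u + (fy z - j0) *: w.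
  by rewrite -{1}(ptK p z uw) /frame_pt; apply: plane_ext; rewrite !pE; ring.
have -> : 2 * dotcv (z - pt i0 j0) d / dotcv d d = c.
  by rewrite zE dE /c; congr (_ * _ / _); rewrite !dotE !pE; ring.
by rewrite zE dE /frame_pt; apply: plane_ext; rewrite !pE; ring.
Qed.

Lemma uw_neq0 : u != 0 /\ w != 0 /\ w - u != 0.
Proof.
split; [|split]; apply: contra_neq uw => h0.
- by rewrite h0 /cr !pE; ring.
- by rewrite h0 /cr !pE; ring.
- have -> : w = u by apply/eqP; rewrite -subr_eq0 h0.
  by rewrite /cr; ring.
Qed.

Definition tri : set V := [set z | [/\ 0 <= fx z, 0 <= fy z & fx z + fy z <= 1]].
Definition quad : set V := [set z | 0 <= fx z <= 1 /\ 0 <= fy z <= 1].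

Definition reflections C := [set reflection h | h in [set h : V * R | h.1 != 0 /\ bounding C h]].

Lemma edge_reflection C (a b c : R) q d (x0 y0 : R) (ks : seq (R * R * R)) :
  (a, b) != (0, 0) -> d != 0 -> a * fx q + b * fy q + c = 0 ->
  a * fx (q + d) + b * fy (q + d) + c = 0 ->
  (forall x, C x -> 0 <= a * fx x + b * fy x + c) -> a * x0 + b * y0 + c = 0 ->
  (forall k, k \in ks -> k.1.1 * x0 + k.1.2 * y0 + k.2 < 0) ->
  (forall x, a * fx x + b * fy x + c = 0 ->
    (forall k, k \in ks -> k.1.1 * fx x + k.1.2 * fy x + k.2 <= 0) -> C x) ->
  reflections C (mirror q d).
Proof.
move=> ab d0 hq hqd side h0 hks HC; have hn := hfr_neq0 c ab.
have qE : dotcv q (hfr a b c).1 = (hfr a b c).2 by apply/eqP; rewrite -subr_eq0 hfrE hq.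
exists (hfr a b c); last first.
  apply: reflection_mirror => //.
  have : dotcv (q + d) (hfr a b c).1 - (hfr a b c).2 = 0 by rewrite hfrE.
  by rewrite dotDl qE addrAC subrr add0r.
split=> //; apply: (@bounding_by _ _ [seq hfr k.1.1 k.1.2 k.2 | k <- ks] (pt x0 y0)).
- by move=> x Cx; rewrite -subr_ge0 hfrE; exact: side.
- by apply/eqP; rewrite -subr_eq0 hfrE fxpt // fypt // h0.
- by move=> _ /mapP [k kks ->]; rewrite -subr_lt0 hfrE fxpt // fypt //; exact: hks.
- move=> x hx Lx; apply: HC; first by rewrite -hfrE hx subrr.
  by move=> k kks; rewrite -hfrE subr_le0; apply: Lx; exact: map_f.
Qed.

(** A functional of constant sign on the triangle that vanishes at two distinct points of it
    vanishes at two vertices, as its value is a barycentric mean of vertex values of the same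
    sign. *)
Lemma tri_reflections : reflections tri =
  [set f | f = mirror p u \/ f = mirror p w \/ f = mirror (p + u) (w - u)].
Proof.
have [u0 [w0 wu0]] := uw_neq0.
apply/seteqP; split=> f.
  move=> [h [h0 /(bounding_two_points h0) [side [z [z' [zz' Cz Cz' hz hz']]]]] <-].
  pose a := dotcv u h.1; pose b := dotcv w h.1; pose c := dotcv p h.1 - h.2.
  have [t [t1 ht]] : exists t : R, t != 0 /\ forall x, tri x -> 0 <= t * (a * fx x + b * fy x + c).
    case: side => side; [exists (-1)|exists 1]; rewrite ?oppr_eq0 oner_neq0; split=> // x Cx;
      by rewrite -functionalE ?mulN1r ?mul1r ?oppr_ge0 ?subr_le0 ?subr_ge0; exact: side.
  have Cv (s0 t0 : R) : 0 <= s0 -> 0 <= t0 -> s0 + t0 <= 1 -> tri (pt s0 t0).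
    by move=> *; split; rewrite ?fxpt ?fypt.
  have v0 := ht _ (Cv 0 0 (lexx _) (lexx _) (ltac:(by rewrite addr0 ler01))).
  have v1 := ht _ (Cv 1 0 ler01 (lexx _) (ltac:(by rewrite addr0))).
  have v2 := ht _ (Cv 0 1 (lexx _) ler01 (ltac:(by rewrite add0r))).
  rewrite !fxpt // !fypt // !mulr0 !mulr1 ?addr0 ?add0r in v0 v1 v2.
  have zE x : dotcv x h.1 = h.2 ->
      (1 - fx x - fy x) * (t * c) + fx x * (t * (a + c)) + fy x * (t * (b + c)) = 0.
    move=> hx; transitivity (t * (a * fx x + b * fy x + c)); first by ring.
    by rewrite -functionalE hx subrr mulr0.
  have pick (A B D : R) (X Y Z : R) : 0 <= X -> 0 <= Y -> 0 <= Z -> 0 <= A -> 0 <= B -> 0 <= D ->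
      X * A + Y * B + Z * D = 0 -> [/\ A = 0 \/ X = 0, B = 0 \/ Y = 0 & D = 0 \/ Z = 0].
    move=> X0 Y0 Z0 A0 B0 D0 e.
    have h1 := mulr_ge0 X0 A0; have h2 := mulr_ge0 Y0 B0; have h3 := mulr_ge0 Z0 D0.
    have z0 (k l : R) : k * l = 0 -> l = 0 \/ k = 0.
      by move=> /eqP; rewrite mulf_eq0 => /orP[/eqP ->|/eqP ->]; [right|left].
    by split; apply: z0; lra.
  have coords x : tri x -> [/\ 0 <= 1 - fx x - fy x, 0 <= fx x & 0 <= fy x].
    by move=> [x1 x2 x3]; split=> //; lra.
  have [zx0 zx1 zx2] := coords _ Cz; have [zy0 zy1 zy2] := coords _ Cz'.
  have [p0 p1 p2] := pick _ _ _ _ _ _ zx0 zx1 zx2 v0 v1 v2 (zE _ hz).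
  have [q0 q1 q2] := pick _ _ _ _ _ _ zy0 zy1 zy2 v0 v1 v2 (zE _ hz').
  have tz (k : R) : t * k = 0 -> k = 0.
    by move=> /eqP; rewrite mulf_eq0 (negbTE t1) => /eqP.
  have m1 : c = 0 -> a + c = 0 -> reflection h = mirror p u.
    move=> c0 ac0; apply: reflection_mirror => //; first by apply/eqP; rewrite -subr_eq0 -/c c0.
    by rewrite -/a; lra.
  have m2 : c = 0 -> b + c = 0 -> reflection h = mirror p w.
    move=> c0 bc0; apply: reflection_mirror => //; first by apply/eqP; rewrite -subr_eq0 -/c c0.
    by rewrite -/b; lra.
  have m3 : a + c = 0 -> b + c = 0 -> reflection h = mirror (p + u) (w - u).
    move=> ac0 bc0; apply: reflection_mirror => //.
      by apply/eqP; rewrite -subr_eq0 dotDl addrAC -/c -/a addrC ac0.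
    by rewrite dotBl -/a -/b; lra.
  have ne : ~ (fx z = fx z' /\ fy z = fy z') by move=> [h1 h2]; apply: zz'; exact: frame_eq.
  (* The cases list the vertices at which the functional vanishes; with at most one of them it would
     have at most one zero. *)
  have [c0|c0] := eqVneq (t * c) 0; have [a0|a0] := eqVneq (t * (a + c)) 0;
    have [b0|b0] := eqVneq (t * (b + c)) 0.
  - by left; apply: m1; exact: tz.
  - by left; apply: m1; exact: tz.
  - by right; left; apply: m2; exact: tz.
  - exfalso; apply: ne; case: p1 p2 q1 q2 => [/eqP|->]; first by rewrite (negbTE a0).
    by case=> [/eqP|->]; [rewrite (negbTE b0)|case=> [/eqP|->]; [rewrite (negbTE a0)|
      case=> [/eqP|->]; [rewrite (negbTE b0)|]]].
  - by right; right; apply: m3; exact: tz.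
  - exfalso; apply: ne; case: p0 p2 q0 q2 => [/eqP|e1]; first by rewrite (negbTE c0).
    case=> [/eqP|e2]; first by rewrite (negbTE b0).
    case=> [/eqP|e3]; first by rewrite (negbTE c0).
    by case=> [/eqP|e4]; [rewrite (negbTE b0)|clear -e1 e2 e3 e4; split; lra].
  - exfalso; apply: ne; case: p0 p1 q0 q1 => [/eqP|e1]; first by rewrite (negbTE c0).
    case=> [/eqP|e2]; first by rewrite (negbTE a0).
    case=> [/eqP|e3]; first by rewrite (negbTE c0).
    by case=> [/eqP|e4]; [rewrite (negbTE a0)|clear -e1 e2 e3 e4; split; lra].
  - exfalso; case: p0 p1 p2 => [/eqP|e1]; first by rewrite (negbTE c0).
    case=> [/eqP|e2]; first by rewrite (negbTE a0).
    by case=> [/eqP|e3]; [rewrite (negbTE b0)|clear -e1 e2 e3; lra].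
have pE : p = pt 0 0 by rewrite /frame_pt !scale0r !addr0.
have xp : fx p = 0 by rewrite {2}pE fxpt.
have yp : fy p = 0 by rewrite {2}pE fypt.
have puE : p + u = pt 1 0 by rewrite /frame_pt scale1r scale0r addr0.
have pwE : p + w = pt 0 1 by rewrite /frame_pt scale1r scale0r addr0.
have puwE : p + u + (w - u) = pt 0 1 by rewrite -pwE addrA addrAC addrK.
have half : (0 : R) < 1 / 2 by lra.
have case3 (P : R * R * R -> Prop) (k1 k2 : R * R * R) : P k1 -> P k2 -> forall k, k \in [:: k1; k2] -> P k.
  by move=> P1 P2 k; rewrite !inE => /orP[/eqP ->|/eqP ->].
case=> [->|[->|->]].
- apply: (@edge_reflection _ 0 1 0 _ _ (1 / 2) 0 [:: (-1, 0, 0); (1, 0, -1)]) => //.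
  + by apply/eqP => -[/eqP]; rewrite oner_eq0.
  + by rewrite xp yp; ring.
  + by rewrite puE fxpt // fypt //; ring.
  + by move=> x [] ? ? ?; lra.
  + by ring.
  + by apply: case3 => /=; lra.
  + move=> x hx hk; have := hk _ (mem_head _ _); have := hk (1, 0, -1); rewrite !inE eqxx orbT => /(_ isT) /=.
    by split; lra.
- apply: (@edge_reflection _ 1 0 0 _ _ 0 (1 / 2) [:: (0, -1, 0); (0, 1, -1)]) => //.
  + by apply/eqP => -[/eqP]; rewrite oner_eq0.
  + by rewrite xp yp; ring.
  + by rewrite pwE fxpt // fypt //; ring.
  + by move=> x [] ? ? ?; lra.
  + by ring.
  + by apply: case3 => /=; lra.
  + move=> x hx hk; have := hk _ (mem_head _ _); have := hk (0, 1, -1); rewrite !inE eqxx orbT => /(_ isT) /=.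
    by split; lra.
- apply: (@edge_reflection _ (-1) (-1) 1 _ _ (1 / 2) (1 / 2) [:: (-1, 0, 0); (0, -1, 0)]) => //.
  + by apply/eqP => -[/eqP]; rewrite oppr_eq0 oner_eq0.
  + by rewrite puE fxpt // fypt //; ring.
  + by rewrite puwE fxpt // fypt //; ring.
  + by move=> x [] ? ? ?; lra.
  + by field.
  + by apply: case3 => /=; lra.
  + move=> x hx hk; have := hk _ (mem_head _ _); have := hk (0, -1, 0); rewrite !inE eqxx orbT => /(_ isT) /=.
    by split; lra.
Qed.

End frame.
End mirrors.

(** * Mirrors of a rectangle *)

Section quads.
Context {R : realType}.
Local Notation V := 'cV[R]_2.
Implicit Types (u v w x y z n a b c d p q : V) (X Y P F K C : set V) (s t : R) (f g : V -> V)
  (G : set (V -> V)).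

Lemma box_face_pos (a b c x y x' y' : R) : 0 < a -> (x, y) <> (x', y') ->
  0 <= c -> 0 <= a + c -> 0 <= b + c -> 0 <= a + b + c ->
  0 <= x <= 1 -> 0 <= y <= 1 -> 0 <= x' <= 1 -> 0 <= y' <= 1 ->
  a * x + b * y + c = 0 -> a * x' + b * y' + c = 0 -> b = 0 /\ c = 0.
Proof.
move=> a0 ne c0 ac bc abc /andP[x0 x1] /andP[y0 y1] /andP[x'0 x'1] /andP[y'0 y'1] e e'.
have h1 := mulr_ge0 (ltW a0) x0; have h2 := mulr_ge0 (ltW a0) x'0.
have z0 (k : R) : a * k = 0 -> k = 0 by move=> /eqP; rewrite mulf_eq0 gt_eqF //= => /eqP.
have [b0|b0|b0] := ltrgt0P b.
- exfalso; apply: ne.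
  have h3 := mulr_ge0 (ltW b0) y0; have h4 := mulr_ge0 (ltW b0) y'0.
  have z1 (k : R) : b * k = 0 -> k = 0 by move=> /eqP; rewrite mulf_eq0 gt_eqF //= => /eqP.
  have -> : x = 0 by apply: z0; lra.
  have -> : x' = 0 by apply: z0; lra.
  have -> : y = 0 by apply: z1; lra.
  by have -> : y' = 0 by apply: z1; lra.
- exfalso; apply: ne.
  have b0' : 0 < - b by lra.
  have y1' : 0 <= 1 - y by lra.
  have y1'' : 0 <= 1 - y' by lra.
  have h3 := mulr_ge0 (ltW b0') y1'; have h4 := mulr_ge0 (ltW b0') y1''.
  have z1 (k : R) : - b * k = 0 -> k = 0 by move=> /eqP; rewrite mulf_eq0 gt_eqF //= => /eqP.
  have e1 : 1 - y = 0 by apply: z1; lra.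
  have e2 : 1 - y' = 0 by apply: z1; lra.
  have -> : x = 0 by apply: z0; lra.
  have -> : x' = 0 by apply: z0; lra.
  by have -> : y = y' by lra.
- by split=> //; move: e; rewrite b0 mul0r addr0; clear -c0 h1; lra.
Qed.

Lemma box_face (a b c x y x' y' : R) : (x, y) <> (x', y') ->
  0 <= c -> 0 <= a + c -> 0 <= b + c -> 0 <= a + b + c ->
  0 <= x <= 1 -> 0 <= y <= 1 -> 0 <= x' <= 1 -> 0 <= y' <= 1 ->
  a * x + b * y + c = 0 -> a * x' + b * y' + c = 0 ->
  a = 0 /\ (c = 0 \/ b + c = 0) \/ b = 0 /\ (c = 0 \/ a + c = 0).
Proof.
move=> ne c0 ac bc abc hx hy hx' hy' e e'.
have flip (k l : R) : 1 - k = 1 - l -> k = l by move=> h; lra.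
have fl (k : R) : 0 <= k <= 1 -> 0 <= 1 - k <= 1 by move=> /andP[? ?]; apply/andP; split; lra.
have [a0|a0|a0] := ltrgt0P a.
- by right; have [-> ->] := box_face_pos a0 ne c0 ac bc abc hx hy hx' hy' e e'; split; [|left].
- suff: b = 0 /\ a + c = 0 by move=> [-> h]; right; split=> //; right.
  have ne1 : (1 - x, y) <> (1 - x', y') by move=> [/flip h1 h2]; apply: ne; rewrite h1 h2.
  by apply: (@box_face_pos (- a) b (a + c) _ _ _ _ _ ne1) => //; try exact: fl; lra.
- left; split=> //; rewrite a0 mul0r !add0r in e e' abc.
  have [b0|b0|b0] := ltrgt0P b.
  + left; suff: (0 : R) = 0 /\ c = 0 by case.
    have ne1 : (y, x) <> (y', x') by move=> [h1 h2]; apply: ne; rewrite h1 h2.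
    by apply: (@box_face_pos b 0 c _ _ _ _ b0 ne1) => //; lra.
  + right; suff: (0 : R) = 0 /\ b + c = 0 by case.
    have ne1 : (1 - y, x) <> (1 - y', x') by move=> [/flip h1 h2]; apply: ne; rewrite h1 h2.
    by apply: (@box_face_pos (- b) 0 (b + c) _ _ _ _ _ ne1) => //; try exact: fl; lra.
  + by left; move: e; rewrite b0 mul0r add0r.
Qed.

Section frame.
Variables (p u w : V).
Hypothesis uw : cr u w != 0.
Local Notation fx := (coordx p u w).
Local Notation fy := (coordy p u w).
Local Notation pt := (frame_pt p u w).

Lemma quad_reflections : reflections (quad p u w) =
  [set f | f = mirror p u \/ f = mirror (p + w) u \/ f = mirror p w \/ f = mirror (p + u) w].
Proof.
have [u0 [w0 wu0]] := uw_neq0 uw.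
apply/seteqP; split=> f.
  move=> [h [h0 /(bounding_two_points h0) [side [z [z' [zz' Cz Cz' hz hz']]]]] <-].
  pose a := dotcv u h.1; pose b := dotcv w h.1; pose c := dotcv p h.1 - h.2.
  have [t [t1 ht]] : exists t : R, t != 0 /\ forall x, quad p u w x -> 0 <= t * (a * fx x + b * fy x + c).
    case: side => side; [exists (-1)|exists 1]; rewrite ?oppr_eq0 oner_neq0; split=> // x Cx;
      by rewrite -functionalE // ?mulN1r ?mul1r ?oppr_ge0 ?subr_le0 ?subr_ge0; exact: side.
  have Cv (s0 t0 : R) : 0 <= s0 <= 1 -> 0 <= t0 <= 1 -> quad p u w (pt s0 t0).
    by move=> *; split; rewrite ?fxpt ?fypt.
  have i0 : 0 <= (0 : R) <= 1 by rewrite lexx ler01.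
  have i1 : 0 <= (1 : R) <= 1 by rewrite lexx ler01.
  have v0 : 0 <= t * c.
    by have := ht _ (Cv 0 0 i0 i0); rewrite !fxpt // !fypt // !mulr0 !add0r.
  have v1 : 0 <= t * a + t * c.
    by have := ht _ (Cv 1 0 i1 i0); rewrite !fxpt // !fypt // mulr0 mulr1 addr0 mulrDr.
  have v2 : 0 <= t * b + t * c.
    by have := ht _ (Cv 0 1 i0 i1); rewrite !fxpt // !fypt // mulr0 mulr1 add0r mulrDr.
  have v3 : 0 <= t * a + t * b + t * c.
    by have := ht _ (Cv 1 1 i1 i1); rewrite !fxpt // !fypt // !mulr1 !mulrDr.
  have zE x : dotcv x h.1 = h.2 -> (t * a) * fx x + (t * b) * fy x + t * c = 0.
    by move=> hx; rewrite -!mulrA -!mulrDr -functionalE // hx subrr mulr0.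
  have tz (k : R) : t * k = 0 -> k = 0.
    by move=> /eqP; rewrite mulf_eq0 (negbTE t1) => /eqP.
  have ne : (fx z, fy z) <> (fx z', fy z') by move=> [h1 h2]; apply: zz'; exact: (frame_eq uw h1 h2).
  have [hx hy] := Cz; have [hx' hy'] := Cz'.
  have := box_face ne v0 v1 v2 v3 hx hy hx' hy' (zE _ hz) (zE _ hz').
  have pE : c = 0 -> dotcv p h.1 = h.2 by move=> h1; apply/eqP; rewrite -subr_eq0 -/c h1.
  rewrite -!mulrDr => -[[/tz h1 [/tz h2|/tz h2]]|[/tz h1 [/tz h2|/tz h2]]].
  - by left; apply: reflection_mirror => //; exact: pE.
  - right; left; apply: reflection_mirror => //.
    by apply/eqP; rewrite -subr_eq0 dotDl addrAC -/c -/b addrC h2.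
  - by right; right; left; apply: reflection_mirror => //; exact: pE.
  - right; right; right; apply: reflection_mirror => //.
    by apply/eqP; rewrite -subr_eq0 dotDl addrAC -/c -/a addrC h2.
have pE : p = pt 0 0 by rewrite /frame_pt !scale0r !addr0.
have xp : fx p = 0 by rewrite {2}pE fxpt.
have yp : fy p = 0 by rewrite {2}pE fypt.
have puE : p + u = pt 1 0 by rewrite /frame_pt scale1r scale0r addr0.
have pwE : p + w = pt 0 1 by rewrite /frame_pt scale1r scale0r addr0.
have pwuE : p + w + u = pt 1 1 by rewrite /frame_pt !scale1r addrAC.
have puwE : p + u + w = pt 1 1 by rewrite /frame_pt !scale1r.
have case3 (P : R * R * R -> Prop) (k1 k2 : R * R * R) : P k1 -> P k2 -> forall k, k \in [:: k1; k2] -> P k.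
  by move=> P1 P2 k; rewrite !inE => /orP[/eqP ->|/eqP ->].
have n10 : ((1 : R), (0 : R)) != (0, 0) by apply/eqP => -[/eqP]; rewrite oner_eq0.
have n01 : ((0 : R), (1 : R)) != (0, 0) by apply/eqP => -[/eqP]; rewrite oner_eq0.
have m10 : (- (1 : R), (0 : R)) != (0, 0) by apply/eqP => -[/eqP]; rewrite oppr_eq0 oner_eq0.
have m01 : ((0 : R), - (1 : R)) != (0, 0) by apply/eqP => -[/eqP]; rewrite oppr_eq0 oner_eq0.
case=> [->|[->|[->|->]]].
- apply: (@edge_reflection _ p u w uw _ 0 1 0 _ _ (1 / 2) 0 [:: (-1, 0, 0); (1, 0, -1)]) => //.
  + by rewrite xp yp; ring.
  + by rewrite puE fxpt // fypt //; ring.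
  + by move=> x [/andP[? ?] /andP[? ?]]; lra.
  + by ring.
  + by apply: case3 => /=; lra.
  + move=> x hx hk; have := hk _ (mem_head _ _); have := hk (1, 0, -1); rewrite !inE eqxx orbT => /(_ isT) /=.
    by move=> h1 h2; split; apply/andP; split; lra.
- apply: (@edge_reflection _ p u w uw _ 0 (-1) 1 _ _ (1 / 2) 1 [:: (-1, 0, 0); (1, 0, -1)]) => //.
  + by rewrite pwE fxpt // fypt //; ring.
  + by rewrite pwuE fxpt // fypt //; ring.
  + by move=> x [/andP[? ?] /andP[? ?]]; lra.
  + by ring.
  + by apply: case3 => /=; lra.
  + move=> x hx hk; have := hk _ (mem_head _ _); have := hk (1, 0, -1); rewrite !inE eqxx orbT => /(_ isT) /=.
    by move=> h1 h2; split; apply/andP; split; lra.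
- apply: (@edge_reflection _ p u w uw _ 1 0 0 _ _ 0 (1 / 2) [:: (0, -1, 0); (0, 1, -1)]) => //.
  + by rewrite xp yp; ring.
  + by rewrite pwE fxpt // fypt //; ring.
  + by move=> x [/andP[? ?] /andP[? ?]]; lra.
  + by ring.
  + by apply: case3 => /=; lra.
  + move=> x hx hk; have := hk _ (mem_head _ _); have := hk (0, 1, -1); rewrite !inE eqxx orbT => /(_ isT) /=.
    by move=> h1 h2; split; apply/andP; split; lra.
- apply: (@edge_reflection _ p u w uw _ (-1) 0 1 _ _ 1 (1 / 2) [:: (0, -1, 0); (0, 1, -1)]) => //.
  + by rewrite puE fxpt // fypt //; ring.
  + by rewrite puwE fxpt // fypt //; ring.
  + by move=> x [/andP[? ?] /andP[? ?]]; lra.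
  + by ring.
  + by apply: case3 => /=; lra.
  + move=> x hx hk; have := hk _ (mem_head _ _); have := hk (0, 1, -1); rewrite !inE eqxx orbT => /(_ isT) /=.
    by move=> h1 h2; split; apply/andP; split; lra.
Qed.

End frame.

Lemma hull3_tri p0 p1 p2 : cr (p1 - p0) (p2 - p0) != 0 ->
  hull3 p0 p1 p2 = tri p0 (p1 - p0) (p2 - p0).
Proof.
move=> uw; apply/seteqP; split=> x.
  move=> [i [j [k [i0 j0 k0 ijk xE]]]].
  have -> : x = frame_pt p0 (p1 - p0) (p2 - p0) j k.
    have -> : x = (1 - j - k) *: p0 + j *: p1 + k *: p2 by rewrite xE; congr (_ *: _ + _ + _); lra.
    by rewrite /frame_pt; apply: plane_ext; rewrite !pE; ring.
  by split; rewrite ?fxpt ?fypt //; lra.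
move=> [h1 h2 h3]; move: (ptK p0 x uw) h1 h2 h3; move: (coordx _ _ _ x) (coordy _ _ _ x) => j k xE j0 k0 jk.
exists (1 - j - k), j, k; split=> //; [lra|ring|].
by rewrite -xE /frame_pt; apply: plane_ext; rewrite !pE; ring.
Qed.

Lemma box_quad p u w : cr u w != 0 -> box p u w = quad p u w.
Proof.
move=> uw; apply/seteqP; split=> x.
  by move=> [k [l [hk hl ->]]]; split; rewrite ?(fxpt p k l uw) ?(fypt p k l uw).
by move=> [h1 h2]; exists (coordx p u w x), (coordy p u w x); split=> //; rewrite -{1}(ptK p x uw).
Qed.

End quads.

(** * Folding the plane in coordinates, and invariants of the mirrors *)

Section orbits.
Context {R : realType}.
Implicit Types (x y a b m t : R) (k : int).

Lemma floor_bounds x : (Num.floor x)%:~R <= x < (Num.floor x)%:~R + 1.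
Proof. by have := real_floor_itv (num_real x); rewrite intrD. Qed.

Lemma shift_into m x : 0 < m -> exists k, 0 <= x + k%:~R * m < m.
Proof.
move=> m0; exists (- Num.floor (x / m)).
have /andP[h1 h2] := floor_bounds (x / m).
move: h1 h2; rewrite ler_pdivlMr // ltr_pdivrMr // rmorphN /= mulNr mulrDl mul1r => h1 h2.
by apply/andP; split; lra.
Qed.

Section relation.
Variable O : R * R -> R * R -> Prop.
Hypothesis Orefl : forall z, O z z.
Hypothesis Osym : forall z z', O z z' -> O z' z.
Hypothesis Otrans : forall z1 z2 z3, O z1 z2 -> O z2 z3 -> O z1 z3.

Lemma orbit_cast z x y x' y' : O z (x, y) -> x = x' -> y = y' -> O z (x', y').
Proof. by move=> h <- <-. Qed.

Lemma orbit_shift a b : (forall x y, O (x, y) (x + a, y + b)) ->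
  forall k x y, O (x, y) (x + k%:~R * a, y + k%:~R * b).
Proof.
move=> H; have P (n : nat) x y : O (x, y) (x + n%:R * a, y + n%:R * b).
  elim: n => [|n IH]; first by rewrite !mul0r !addr0.
  apply: (Otrans IH); have := H (x + n%:R * a) (y + n%:R * b).
  by rewrite -natr1 !mulrDl !mul1r !addrA.
move=> k x y; case: (intP k) => [|n|n].
- by have := P 0%N x y.
- by have := P n.+1 x y.
- apply: Osym; have := P n.+1 (x + (- n.+1%:Z)%:~R * a) (y + (- n.+1%:Z)%:~R * b).
  by rewrite !rmorphN /= !mulNr !subrK.
Qed.

Lemma fold_line : (forall x y, O (x, y) (- x, y)) -> (forall x y, O (x, y) (2 - x, y)) ->
  forall x y, exists2 x', 0 <= x' <= 1 & O (x, y) (x', y).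
Proof.
move=> sx sx1 x y.
have T x' y' : O (x', y') (x' + 2, y' + 0).
  by apply: Otrans (sx _ _) _; have := sx1 (- x') y'; rewrite opprK addr0 addrC.
have [k /andP[h1 h2]] := shift_into x (ltr0Sn R 1).
have := orbit_shift T k x y; rewrite mulr0 addr0; move: h1 h2; move: (x + _) => x' h1 h2 h.
have [x1|x1] := leP x' 1; first by exists x' => //; rewrite h1.
by exists (2 - x'); [apply/andP; split; lra|exact: Otrans h (sx1 _ _)].
Qed.

Lemma fold_square : (forall x y, O (x, y) (- x, y)) -> (forall x y, O (x, y) (2 - x, y)) ->
  (forall x y, O (x, y) (x, - y)) -> (forall x y, O (x, y) (x, 2 - y)) ->
  forall x y, exists x' y', [/\ 0 <= x' <= 1, 0 <= y' <= 1 & O (x, y) (x', y')].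
Proof.
move=> s1 s2 s3 s4 x y; have [x' hx O1] := fold_line s1 s2 x y.
have T (y' : R) : O (x', y') (x', y' + 2).
  by apply: Otrans (s3 _ _) _; have := s4 x' (- y'); rewrite opprK addrC.
have [k /andP[h1 h2]] := shift_into y (ltr0Sn R 1).
have T2 x1 y1 : O (x1, y1) (x1 + 0, y1 + 2).
  by apply: Otrans (s3 _ _) _; have := s4 x1 (- y1); rewrite opprK addr0 addrC.
have := orbit_shift T2 k x' y; rewrite mulr0 addr0; move: h1 h2; move: (y + _) => y' h1 h2 h.
have O2 := Otrans O1 h.
have [y1|y1] := leP y' 1; first by exists x', y'; split=> //; rewrite h1.
by exists x', (2 - y'); split=> //; [apply/andP; split; lra|exact: Otrans O2 (s4 _ _)].
Qed.

Lemma fold_right_isosceles : (forall x y, O (x, y) (- x, y)) -> (forall x y, O (x, y) (x, - y)) ->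
  (forall x y, O (x, y) (1 - y, 1 - x)) ->
  forall x y, exists x' y', [/\ 0 <= x', 0 <= y', x' + y' <= 1 & O (x, y) (x', y')].
Proof.
move=> s1 s2 s3 x y.
(* Conjugating the mirrors of the legs by that of the hypotenuse gives the mirrors in [x = 1] and
   [y = 1] of a square, of which the triangle is one half. *)
have s4 x1 y1 : O (x1, y1) (2 - x1, y1).
  apply: orbit_cast (Otrans (s3 _ _) (Otrans (s2 _ _) (s3 _ _))) _ _; ring.
have s5 x1 y1 : O (x1, y1) (x1, 2 - y1).
  apply: orbit_cast (Otrans (s3 _ _) (Otrans (s1 _ _) (s3 _ _))) _ _; ring.
have [x' [y' [/andP[a1 a2] /andP[b1 b2] h]]] := fold_square s1 s4 s2 s5 x y.
have [c|c] := leP (x' + y') 1; first by exists x', y'.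
by exists (1 - y'), (1 - x'); split; [lra|lra|lra|exact: Otrans h (s3 _ _)].
Qed.

(** Translations by [(1, 1)] and [(3, 0)] bring a point into [0 <= x < 3], [0 <= y < 1], a strip of
    six triangles; at most five successive mirrors fold them onto the first. *)
Lemma fold_equilateral : (forall x y, O (x, y) (- x, x + y)) -> (forall x y, O (x, y) (x + y, - y)) ->
  (forall x y, O (x, y) (1 - y, 1 - x)) ->
  forall x y, exists x' y', [/\ 0 <= x', 0 <= y', x' + y' <= 1 & O (x, y) (x', y')].
Proof.
move=> s1 s2 s3 x y.
have T1 x1 y1 : O (x1, y1) (x1 + 1, y1 + 1).
  apply: orbit_cast (Otrans (s1 _ _) (Otrans (s2 _ _) (Otrans (s1 _ _) (s3 _ _)))) _ _; ring.
have T2 x1 y1 : O (x1, y1) (x1 + 3, y1 + 0).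
  have T3' : O (x1, y1) (x1 + 1, y1 - 2).
    apply: Otrans (s1 _ _) _.
    have := Osym (T1 (- x1 - 1) (x1 + y1 - 1)); rewrite !subrK => T4.
    apply: orbit_cast (Otrans T4 (s1 _ _)) _ _; ring.
  apply: orbit_cast (Otrans T3' (Otrans (T1 _ _) (T1 _ _))) _ _; ring.
have [k /andP[h1 h2]] := shift_into y (ltr01 : 0 < 1 :> R).
have := orbit_shift T1 k x y; move: h1 h2; rewrite mulr1; move: (y + _) (x + _) => y1 x1 y0 y11 O1.
have [l] := shift_into x1 (ltr0Sn R 2).
have := orbit_shift T2 l x1 y1; rewrite mulr0 addr0; move: (x1 + _) => x2 O2' /andP[x20 x23].
have O2 := Otrans O1 O2'.
have w1 := Otrans O2 (s3 _ _); have w2 := Otrans w1 (s2 _ _); have w3 := Otrans w2 (s1 _ _).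
have w4 := Otrans w3 (s3 _ _); have w5 := Otrans w4 (s2 _ _).
have [c1|c1] := leP (x2 + y1) 1; first by exists x2, y1.
have [c2|c2] := leP x2 1.
  by eexists; eexists; split; last exact: w1; lra.
have [c3|c3] := leP (x2 + y1) 2.
  by eexists; eexists; split; last exact: w2; lra.
have [c4|c4] := leP x2 2.
  by eexists; eexists; split; last exact: w3; lra.
have [c5|c5] := leP (x2 + y1) 3.
  by eexists; eexists; split; last exact: w4; lra.
by eexists; eexists; split; last exact: w5; lra.
Qed.

End relation.

Lemma fold_half_equilateral (O : R * R -> R * R -> Prop) : (forall z, O z z) ->
  (forall z z', O z z' -> O z' z) -> (forall z1 z2 z3, O z1 z2 -> O z2 z3 -> O z1 z3) ->
  (forall x y, O (x, y) (- x, y)) -> (forall x y, O (x, y) (x, - y)) ->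
  (forall x y, O (x, y) ((3 - x - 3 * y) / 2, (1 - x + y) / 2)) ->
  forall x y, exists x' y', [/\ 0 <= x', 0 <= y', x' + y' <= 1 & O (x, y) (x', y')].
Proof.
move=> O1 O2 O3 s1 s2 s3 x y.
(* [e] passes from coordinates of the doubled, equilateral triangle to those of its half; the mirror
   between the two halves is used at the end. *)
pose e (z : R * R) := (2 * z.1 + z.2 - 1, z.2).
pose P z z' := O (e z) (e z').
have g1 x3 y3 : P (x3, y3) (- x3, x3 + y3).
  rewrite /P /e /=; have h := O3 _ _ _ (s1 (2 * x3 + y3 - 1) y3) (O3 _ _ _ (s3 _ _) (s1 _ _)).
  by apply: (orbit_cast h); field.
have g2 x3 y3 : P (x3, y3) (x3 + y3, - y3).
  by rewrite /P /e /=; apply: (orbit_cast (s2 _ _)); ring.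
have g3 x3 y3 : P (x3, y3) (1 - y3, 1 - x3).
  by rewrite /P /e /=; apply: (orbit_cast (s3 _ _)); field.
have := fold_equilateral (fun z => O1 (e z)) (fun z z' => O2 (e z) (e z'))
  (fun z1 z2 z3 => O3 (e z1) (e z2) (e z3)) g1 g2 g3 ((x + 1 - y) / 2) y.
move=> [x' [y' [x0 y0 xy]]]; rewrite /P /e /=.
have -> : 2 * ((x + 1 - y) / 2) + y - 1 = x by field.
move=> h; have [c|c] := leP 0 (2 * x' + y' - 1).
  by eexists; eexists; split; last exact: h; lra.
by eexists; eexists; split; last exact: (O3 _ _ _ h (s1 _ _)); lra.
Qed.

Lemma cos_pi_inj x y : 0 <= x <= 1 -> 0 <= y <= 1 -> cos (pi * x) = cos (pi * y) -> x = y.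
Proof.
have p0 := pi_gt0 R.
have I (z : R) : 0 <= z <= 1 -> pi * z \in `[0, pi].
  by move=> /andP[z0 z1]; rewrite in_itv /=; apply/andP; split; [exact: (mulr_ge0 (ltW p0) z0)|by rewrite /= ler_piMr // ltW].
move=> hx hy /(cos_inj (I x hx) (I y hy)) /(mulfI _) -> //.
by rewrite gt_eqF.
Qed.

(* A point of the plane [a + b + c = 0] is recovered, up to permutations and integer
   translations of the coordinates, from the nonincreasing step function [alcove_count]
   of [t], which drops by one at each [a + i], [b + i], [c + i]. *)
Definition alcove_count x y t : int :=
  Num.floor ((2 * x + y) / 3 - t) + Num.floor ((y - x) / 3 - t) + Num.floor (- (x + 2 * y) / 3 - t).

(** In terms of [a], [b], [c] this mirror exchanges the first two; that of [alcove_count_sy]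
    exchanges the last two. *)
Lemma alcove_count_sx x y : alcove_count (- x) (x + y) = alcove_count x y.
Proof.
apply/funext => t; rewrite /alcove_count.
have -> : (2 * - x + (x + y)) / 3 = (y - x) / 3 :> R by field.
have -> : (x + y - - x) / 3 = (2 * x + y) / 3 :> R by field.
have -> : - (- x + 2 * (x + y)) / 3 = - (x + 2 * y) / 3 :> R by field.
by rewrite [X in X + _]addrC.
Qed.

Lemma alcove_count_sy x y : alcove_count (x + y) (- y) = alcove_count x y.
Proof.
apply/funext => t; rewrite /alcove_count.
have -> : (2 * (x + y) + - y) / 3 = (2 * x + y) / 3 :> R by field.
have -> : (- y - (x + y)) / 3 = - (x + 2 * y) / 3 :> R by field.
have -> : - (x + y + 2 * - y) / 3 = (y - x) / 3 :> R by field.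
by rewrite addrAC.
Qed.

Lemma floor_shift x k : Num.floor (x + k%:~R) = Num.floor x + k.
Proof.
have /andP[h1 h2] := floor_bounds x.
by apply: floor_def; rewrite !intrD; apply/andP; split; lra.
Qed.

(** Here the outer two are exchanged and shifted by [1] and [-1], so the changes of the floors
    cancel. *)
Lemma alcove_count_h x y : alcove_count (1 - y) (1 - x) = alcove_count x y.
Proof.
apply/funext => t; rewrite /alcove_count.
have -> : (2 * (1 - y) + (1 - x)) / 3 - t = - (x + 2 * y) / 3 - t + 1%:~R by rewrite mulr1z; field.
have -> : (1 - x - (1 - y)) / 3 = (y - x) / 3 :> R by field.
have -> : - (1 - y + 2 * (1 - x)) / 3 - t = (2 * x + y) / 3 - t + (- 1)%:~R.
  by rewrite mulrN1z; field.
rewrite !floor_shift; ring.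
Qed.

Lemma floor_le k (v : R) : v < (k + 1)%:~R -> Num.floor v <= k.
Proof.
move=> h; have /andP[h1 _] := floor_bounds v.
by have := le_lt_trans h1 h; rewrite ltr_int; clear; lia.
Qed.

Lemma floor_ge k (v : R) : k%:~R <= v -> k <= Num.floor v.
Proof.
move=> h; have /andP[_ h1] := floor_bounds v.
by have := le_lt_trans h h1; rewrite -[1]/(1%:~R) -intrD ltr_int; clear; lia.
Qed.

(** The largest and the smallest number are read off by testing at [t = a'] and [t = c]: in the
    wrong order the two counts would differ there by at least one. *)
Lemma floor3_le (a b c a' b' c' : R) : b < a -> c < b -> a < c + 1 -> b' < a' -> c' < b' -> a' < c' + 1 ->
  (forall t, Num.floor (a - t) + Num.floor (b - t) + Num.floor (c - t) =
             Num.floor (a' - t) + Num.floor (b' - t) + Num.floor (c' - t)) ->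
  a' <= a /\ c <= c'.
Proof.
move=> ba cb ac ba' cb' ac' e; split; rewrite leNgt; apply/negP => h.
- have := e a'.
  have h1 : Num.floor (a - a') <= -1 by apply: floor_le; rewrite addNr; lra.
  have h2 : Num.floor (b - a') <= -1 by apply: floor_le; rewrite addNr; lra.
  have h3 : Num.floor (c - a') <= -1 by apply: floor_le; rewrite addNr; lra.
  have h4 : 0 <= Num.floor (a' - a') by apply: floor_ge; rewrite subrr.
  have h5 : -1 <= Num.floor (b' - a') by apply: floor_ge; rewrite rmorphN /= mulr1z; lra.
  have h6 : -1 <= Num.floor (c' - a') by apply: floor_ge; rewrite rmorphN /= mulr1z; lra.
  by move: h1 h2 h3 h4 h5 h6; clear; lia.
- have := e c.
  have h1 : 0 <= Num.floor (a - c) by apply: floor_ge; rewrite mulr0z; lra.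
  have h2 : 0 <= Num.floor (b - c) by apply: floor_ge; rewrite mulr0z; lra.
  have h3 : 0 <= Num.floor (c - c) by apply: floor_ge; rewrite subrr.
  have h4 : Num.floor (a' - c) <= 0 by apply: floor_le; rewrite add0r mulr1z; lra.
  have h5 : Num.floor (b' - c) <= 0 by apply: floor_le; rewrite add0r mulr1z; lra.
  have h6 : Num.floor (c' - c) <= -1 by apply: floor_le; rewrite addNr; lra.
  by move: h1 h2 h3 h4 h5 h6; clear; lia.
Qed.

Lemma alcove_count_inj x y x' y' : 0 < x -> 0 < y -> x + y < 1 -> 0 < x' -> 0 < y' -> x' + y' < 1 ->
  alcove_count x y = alcove_count x' y' -> x = x' /\ y = y'.
Proof.
move=> x0 y0 xy x'0 y'0 xy' /funeqP e.
have e' t : alcove_count x' y' t = alcove_count x y t by rewrite e.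
have [h1 h2] : (2 * x' + y') / 3 <= (2 * x + y) / 3 /\ - (x + 2 * y) / 3 <= - (x' + 2 * y') / 3.
  by apply: floor3_le e; lra.
have [h3 h4] : (2 * x + y) / 3 <= (2 * x' + y') / 3 /\ - (x' + 2 * y') / 3 <= - (x + 2 * y) / 3.
  by apply: floor3_le e'; lra.
by clear -h1 h2 h3 h4; split; lra.
Qed.

End orbits.

(** * Figures as fundamental domains of their Weyl groups *)

Section weyl_tiles.
Context {R : realType}.
Local Notation V := 'cV[R]_2.
Implicit Types (u v w x y z n a b c d p q : V) (X Y P K C : set V) (s t : R) (f g : V -> V)
  (G : set (V -> V)) (F : R * R -> R * R) (o : R * R).

Lemma weyl_affine C : affine_group (affine_weyl_group C).
Proof.
apply: generated_affine_group => _ [h [h0 _] <-].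
exact: simform_affine (oner_neq0 _) (reflection_simform h0).
Qed.

Lemma weyl_invariant C (T : Type) (inv : V -> T) :
  (forall f, reflections C f -> forall z, inv (f z) = inv z) ->
  forall g, affine_weyl_group C g -> forall z, inv (g z) = inv z.
Proof.
move=> H g Gg; suff [] : [set g | affine_bij g /\ forall z, inv (g z) = inv z] g by [].
apply: generated_sub Gg; last first.
  move=> f Sf; split; last exact: H.
  by apply: (weyl_affine C).2; apply: sub_generated.
split.
- by split=> //; exact: affine_bij_id.
- move=> f1 f2 [a1 i1] [a2 i2]; split; first exact: affine_bij_comp.
  by move=> z /=; rewrite i1 i2.
- move=> f [af jf]; have [h [ah fK hK]] := affine_bij_inv af; exists h; split=> //.
  by split=> // z; rewrite -[in RHS](hK z) jf.
Qed.

Section frame.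
Variables (p u w : V).
Hypothesis uw : cr u w != 0.
Local Notation fx := (coordx p u w).
Local Notation fy := (coordy p u w).
Local Notation pt := (frame_pt p u w).

Definition acts f F := forall z, fx (f z) = (F (fx z, fy z)).1 /\ fy (f z) = (F (fx z, fy z)).2.
Definition moves G F := exists2 g, G g & acts g F.

Lemma moves_comp G F F' : affine_group G -> moves G F -> moves G F' -> moves G (F \o F').
Proof.
move=> aG [g Gg gF] [g' Gg' gF']; exists (g \o g'); first exact: agroup_comp.
move=> z /=; have [-> ->] := gF (g' z); have [-> ->] := gF' z.
by rewrite -surjective_pairing.
Qed.

Lemma moves_eq G F F' : moves G F -> (forall s t, F (s, t) = F' (s, t)) -> moves G F'.
Proof. by move=> [g Gg gF] e; exists g => // z; rewrite -e; exact: gF. Qed.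

Lemma moves_translation G (i j : R) : moves G (fun o => (o.1 + i, o.2 + j)) ->
  G (fun x => x + (i *: u + j *: w)).
Proof.
move=> [g Gg gF]; suff -> : (fun x => x + (i *: u + j *: w)) = g by [].
apply/funext => z; have [h1 h2] := gF z; rewrite -(ptK p (g z) uw) h1 h2 /= -{1}(ptK p z uw) /frame_pt.
by apply: plane_ext; rewrite !pE; ring.
Qed.

Definition same_orbit G (o o' : R * R) := exists2 g, G g & g (pt o.1 o.2) = pt o'.1 o'.2.

Lemma same_orbit_refl G o : affine_group G -> same_orbit G o o.
Proof. by move=> [[G1 _ _] _]; exists id. Qed.

Lemma same_orbit_sym G o o' : affine_group G -> same_orbit G o o' -> same_orbit G o' o.
Proof.
move=> aG [g Gg e]; have [h [Gh gK hK]] := agroup_inv aG Gg.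
by exists h => //; rewrite -e gK.
Qed.

Lemma same_orbit_trans G o1 o2 o3 : affine_group G -> same_orbit G o1 o2 -> same_orbit G o2 o3 ->
  same_orbit G o1 o3.
Proof.
move=> aG [g Gg e] [h Gh e']; exists (h \o g); first exact: agroup_comp.
by rewrite /= e e'.
Qed.

Lemma moves_orbit G F s t : moves G F -> same_orbit G (s, t) (F (s, t)).
Proof.
move=> [g Gg gF]; exists g => //=; have [] := gF (pt s t); rewrite fxpt // fypt // => h1 h2.
by apply: (frame_eq uw (p := p)); rewrite ?fxpt ?fypt.
Qed.

Lemma null_frame_line (i j k : R) : (i, j) != (0, 0) ->
  lebesgue_null [set z | i * fx z + j * fy z + k = 0].
Proof.
move=> ij; have := null_line (hfr p u w i j k).2 (hfr_neq0 p uw k ij).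
apply: nullS => z /=; by rewrite -hfrE // => /eqP; rewrite subr_eq0 => /eqP.
Qed.

Definition grid : set V := [set z | [\/ fx z = 0, fy z = 0 | fx z + fy z = 1]].

Lemma pair_neq0 (i j : R) : i != 0 \/ j != 0 -> (i, j) != (0, 0).
Proof. by move=> h; apply/eqP => -[e1 e2]; case: h; rewrite ?e1 ?e2 eqxx. Qed.

Lemma null_grid : lebesgue_null grid.
Proof.
apply: nullS (nullU (@null_frame_line 1 0 0 _) (nullU (@null_frame_line 0 1 0 _) (@null_frame_line 1 1 (-1) _))).
- move=> z [h|h|h]; [left|right; left|right; right]; rewrite /= ?h; lra.
- by apply: pair_neq0; left; exact: oner_neq0.
- by apply: pair_neq0; right; exact: oner_neq0.
- by apply: pair_neq0; left; exact: oner_neq0.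
Qed.

(** [inv] has to separate points of the open triangle only, since its sides lie in the null set
    [grid]. *)
Lemma tri_tile (T : Type) (inv : R -> R -> T) : let G := affine_weyl_group (tri p u w) in
  (forall f, reflections (tri p u w) f -> forall z, inv (fx (f z)) (fy (f z)) = inv (fx z) (fy z)) ->
  (forall x y x' y' : R, 0 < x -> 0 < y -> x + y < 1 -> 0 < x' -> 0 < y' -> x' + y' < 1 ->
    inv x y = inv x' y' -> x = x' /\ y = y') ->
  (forall x y : R, exists x' y' : R, [/\ 0 <= x', 0 <= y', x' + y' <= 1 & same_orbit G (x, y) (x', y')]) ->
  tile G (tri p u w).
Proof.
move=> G I U cov; apply: (tile_of_folding (weyl_affine _) null_grid).
  have st z : tri p u w z -> ~ grid z -> [/\ 0 < fx z, 0 < fy z & fx z + fy z < 1].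
    move=> [h1 h2 h3] ng; split; rewrite lt_neqAle ?h1 ?h2 ?h3 andbT; apply/eqP => e; apply: ng.
    - by constructor 1.
    - by constructor 2.
    - by constructor 3.
  move=> g z Gg Cz Cgz nz ngz; have [x0 y0 xy] := st z Cz nz; have [x0' y0' xy'] := st _ Cgz ngz.
  have := weyl_invariant (inv := fun z => inv (fx z) (fy z)) I Gg z.
  by move=> /(U _ _ _ _ x0' y0' xy' x0 y0 xy) [e1 e2]; exact: (frame_eq uw e1 e2).
move=> z; have [x' [y' [x0 y0 xy [g Gg]]]] := cov (fx z) (fy z).
rewrite /= ptK // => e; exists g => //; rewrite e.
by split; rewrite ?fxpt ?fypt.
Qed.

Lemma quad_tile (T : Type) (inv : R -> R -> T) : let G := affine_weyl_group (quad p u w) in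
  (forall f, reflections (quad p u w) f -> forall z, inv (fx (f z)) (fy (f z)) = inv (fx z) (fy z)) ->
  (forall x y x' y' : R, 0 <= x <= 1 -> 0 <= y <= 1 -> 0 <= x' <= 1 -> 0 <= y' <= 1 ->
    inv x y = inv x' y' -> x = x' /\ y = y') ->
  (forall x y : R, exists x' y' : R, [/\ 0 <= x' <= 1, 0 <= y' <= 1 & same_orbit G (x, y) (x', y')]) ->
  tile G (quad p u w).
Proof.
move=> G I U cov; apply: (tile_of_folding (weyl_affine _) (null_set0 (R := R))).
  move=> g z Gg [h1 h2] [h3 h4] _ _.
  have := weyl_invariant (inv := fun z => inv (fx z) (fy z)) I Gg z.
  by move=> /(U _ _ _ _ h3 h4 h1 h2) [e1 e2]; exact: (frame_eq uw e1 e2).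
move=> z; have [x' [y' [hx hy [g Gg]]]] := cov (fx z) (fy z).
rewrite /= ptK // => e; exists g => //; rewrite e.
by split; rewrite ?fxpt ?fypt.
Qed.

Lemma mirror_acts q d (i0 j0 i j : R) F : q = pt i0 j0 -> d = i *: u + j *: w ->
  (forall s t, let c := 2 * ((s - i0) * (i * dotcv u u + j * dotcv u w) +
                (t - j0) * (i * dotcv u w + j * dotcv w w)) /
    (i ^+ 2 * dotcv u u + 2 * i * j * dotcv u w + j ^+ 2 * dotcv w w) in
   F (s, t) = (2 * i0 - s + c * i, 2 * j0 - t + c * j)) ->
  acts (mirror q d) F.
Proof.
by move=> -> dE FE z; rewrite (mirror_act p uw _ _ _ dE) fxpt // fypt // FE.
Qed.

Lemma frame_vertices : [/\ p = pt 0 0, p + u = pt 1 0 & p + w = pt 0 1].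
Proof. by split; rewrite /frame_pt !(scale0r, scale1r, addr0). Qed.

Lemma frame_dirs : [/\ u = 1 *: u + 0 *: w, w = 0 *: u + 1 *: w & w - u = (-1) *: u + 1 *: w].
Proof. by split; rewrite ?scale0r ?scale1r ?scaleN1r ?addr0 ?add0r // addrC. Qed.

End frame.

End weyl_tiles.

(** * Common tiles of Weyl groups and lattices *)

Section common_tiles.
Context {R : realType}.
Local Notation V := 'cV[R]_2.
Implicit Types (u v w z n a b c d p q : V) (X Y K C : set V) (x y s t : R) (f g : V -> V)
  (G : set (V -> V)) (F : R * R -> R * R) (P : R -> R -> Prop).

(** The data that [three_way_tile] consumes: [c] is a nonzero translation common to both groups, and
    [K] is bounded with [0] in its interior. *)
Definition common_tile G := exists u w K c,
  [/\ cr u w != 0, lebesgue_measurable K, interior K 0 & exists M : R, forall z, K z -> enorm z <= M] /\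
  [/\ tile G K, tile (translations (lat u w)) K, c != 0, lat u w c & G (fun z => z + c)].

Section frame.
Variables (p u w : V).
Hypothesis uw : cr u w != 0.
Local Notation fx := (coordx p u w).
Local Notation fy := (coordy p u w).
Local Notation pt := (frame_pt p u w).

Definition region P : set V := [set z | P (fx z) (fy z)].

Lemma region_shift P (i j : R) :
  (fun z => z + (i *: u + j *: w)) @` region P = region (fun x y => P (x - i) (y - j)).
Proof.
have fE z : z = pt (fx z) (fy z) by rewrite ptK.
have sE x y : pt x y + (i *: u + j *: w) = pt (x + i) (y + j).
  by rewrite /frame_pt; apply: plane_ext; rewrite !pE; ring.
apply/seteqP; split=> z; rewrite /region /=.
  by move=> [z' Pz' <-]; rewrite (fE z') sE fxpt // fypt // !addrK.
by move=> Pz; exists (pt (fx z - i) (fy z - j)); rewrite /= ?fxpt ?fypt // sE !subrK ptK.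
Qed.

Lemma region_acts g F P : acts p u w g F -> (forall o, F (F o) = o) ->
  g @` region P = region (fun x y => P (F (x, y)).1 (F (x, y)).2).
Proof.
move=> gF FF; apply/seteqP; split=> z; rewrite /region /=.
  by move=> [z' Pz' <-]; have [-> ->] := gF z'; rewrite -surjective_pairing FF.
move=> Pz; exists (pt (F (fx z, fy z)).1 (F (fx z, fy z)).2); first by rewrite /= fxpt // fypt.
have [h1 h2] := gF (pt (F (fx z, fy z)).1 (F (fx z, fy z)).2).
by apply: (frame_eq uw (p := p)); rewrite ?h1 ?h2 fxpt // fypt // -surjective_pairing FF.
Qed.

Lemma region_halfplane (i j k : R) : lebesgue_measurable (region (fun x y => i * x + j * y <= k)).
Proof.
have := lmeas_halfplane (hfr p u w i j (- k)).1 (hfr p u w i j (- k)).2.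
congr lebesgue_measurable; apply/funext => z; apply/propext; rewrite /region /=.
by rewrite -subr_le0 hfrE // subr_le0.
Qed.

Lemma tri_measurable : lebesgue_measurable (tri p u w).
Proof.
have -> : tri p u w = region (fun x y => (-1) * x + 0 * y <= 0) `&`
    (region (fun x y => 0 * x + (-1) * y <= 0) `&` region (fun x y => 1 * x + 1 * y <= 1)).
  apply/seteqP; split=> z; rewrite /region /tri /=.
    by move=> [h1 h2 h3]; split; [|split]; lra.
  by move=> [h1 [h2 h3]]; split; lra.
by apply: lmeasI; [|apply: lmeasI]; exact: region_halfplane.
Qed.

Lemma quad_measurable : lebesgue_measurable (quad p u w).
Proof.
have -> : quad p u w = (region (fun x y => (-1) * x + 0 * y <= 0) `&` region (fun x y => 1 * x + 0 * y <= 1)) `&`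
    (region (fun x y => 0 * x + (-1) * y <= 0) `&` region (fun x y => 0 * x + 1 * y <= 1)).
  apply/seteqP; split=> z; rewrite /region /quad /=.
    by move=> [/andP[h1 h2] /andP[h3 h4]]; split; split; lra.
  by move=> [[h1 h2] [h3 h4]]; split; apply/andP; split; lra.
by apply: lmeasI; apply: lmeasI; exact: region_halfplane.
Qed.

Lemma region_bounded (M : R) : exists B : R, forall z, `|fx z| <= M -> `|fy z| <= M -> enorm z <= B.
Proof.
exists (enorm p + M * enorm u + M * enorm w) => z h1 h2.
rewrite -(ptK p z uw) /frame_pt; apply: le_trans (enorm_tri _ _) _; apply: lerD.
  apply: le_trans (enorm_tri _ _) _; apply: lerD => //.
  by rewrite enormZ ler_wpM2r // enorm_ge0.
by rewrite enormZ ler_wpM2r // enorm_ge0.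
Qed.

Lemma region_open (i j k : R) z : i * fx z + j * fy z < k ->
  interior (region (fun x y => i * x + j * y < k)) z.
Proof.
move=> h; pose e := (k - (i * fx z + j * fy z)) / 2.
have : interior (inL [:: hfr p u w i j (e - k)]) z.
  by apply: strict_interior => h'; rewrite inE => /eqP ->; rewrite -subr_lt0 hfrE // /e; lra.
apply: interiorS => z' /(_ _ (mem_head _ _)); rewrite -subr_le0 hfrE // /region /= /e; lra.
Qed.

Lemma tri_interior z : interior (tri p u w) z -> [/\ 0 < fx z, 0 < fy z & fx z + fy z < 1].
Proof.
have H (i j k : R) : (i, j) != (0, 0) -> (forall z, tri p u w z -> i * fx z + j * fy z + k <= 0) ->
    interior (tri p u w) z -> i * fx z + j * fy z + k < 0.
  move=> ij Hz iz; rewrite -hfrE // subr_lt0.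
  apply: interior_strict iz; first exact: hfr_neq0.
  by move=> z' /Hz; rewrite -hfrE // subr_le0.
move=> iz.
have h1 : (-1) * fx z + 0 * fy z + 0 < 0.
  by apply: H iz; [apply: pair_neq0; left; rewrite oppr_eq0 oner_neq0|move=> z' [] *; lra].
have h2 : 0 * fx z + (-1) * fy z + 0 < 0.
  by apply: H iz; [apply: pair_neq0; right; rewrite oppr_eq0 oner_neq0|move=> z' [] *; lra].
have h3 : 1 * fx z + 1 * fy z + (-1) < 0.
  by apply: H iz; [apply: pair_neq0; left; rewrite oner_neq0|move=> z' [] *; lra].
by split; lra.
Qed.

(** In frame coordinates a parallelogram of area [1/2], that of the triangle. In [stacked_cell] its
    corner at the origin is raised by [1/2], which completes the top of the triangle; in
    [folded_cell] what sticks out beyond the hypotenuse is shifted to the other side of [x = 0]. *)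
Definition base_cell x y : Prop := (0 <= x < 1) /\ (0 <= y < 1 / 2).
Definition stacked_cell x y := (base_cell x y /\ ~ (x + y <= 1 / 2)) \/
  (base_cell x (y - 1 / 2) /\ x + (y - 1 / 2) <= 1 / 2).
Definition folded_cell (j : R) x y := (stacked_cell x y /\ ~ (1 < x + y)) \/
  (stacked_cell (x + 1) (y - j) /\ 1 < (x + 1) + (y - j)).
Definition in_tri x y := [/\ 0 <= x, 0 <= y & x + y <= 1].
Definition cut_cell F x y := (in_tri x y /\ ~ (x + y <= 1 / 2)) \/
  (in_tri (F (x, y)).1 (F (x, y)).2 /\ (F (x, y)).1 + (F (x, y)).2 <= 1 / 2).

Lemma half_neq0 : cr u ((1 / 2) *: w) != 0.
Proof.
have -> : cr u ((1 / 2) *: w) = 1 / 2 * cr u w by rewrite /cr !pE; ring.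
by rewrite mulf_neq0 // gt_eqF //; lra.
Qed.

Lemma folded_tile (j : int) : tile (translations (lat u ((1 / 2) *: w))) (region (folded_cell (j%:~R / 2))).
Proof.
set Gam := translations _.
have aG : affine_group Gam by exact: lat_group.
have t0 : tile Gam (region base_cell).
  have := half_open_tile p half_neq0; congr (tile _ _); apply/seteqP; split=> z; rewrite /region /=.
    move=> [s [t [hs /andP[t0 t1] ->]]].
    have -> : p + s *: u + t *: ((1 / 2) *: w) = pt s (t / 2).
      by rewrite /frame_pt; apply: plane_ext; rewrite !pE; ring.
    by rewrite fxpt // fypt //; split=> //; apply/andP; split; lra.
  move=> [hx /andP[y0 y1]]; exists (fx z), (2 * fy z); split=> //; first by apply/andP; split; lra.
  by rewrite -{1}(ptK p z uw) /frame_pt; apply: plane_ext; rewrite !pE; field.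
have G1 : Gam (fun z => z + (0 *: u + (1 / 2) *: w)).
  by exists (0 *: u + (1 / 2) *: w) => //; exists 0, 1; rewrite scale1r.
have G2 : Gam (fun z => z + ((- 1) *: u + (j%:~R / 2) *: w)).
  exists ((- 1) *: u + (j%:~R / 2) *: w) => //; exists (-1), j; rewrite mulrN1z scalerA.
  by congr (_ + _ *: _); field.
have t1 := tile_move (region (fun x y => x + y <= 1 / 2)) aG t0 G1.
have t2 := tile_move (region (fun x y => 1 < x + y)) aG t1 G2.
move: t2; congr (tile _ _).
have I P P' : region P `&` region P' = region (fun x y => P x y /\ P' x y) by [].
have D P P' : region P `\` region P' = region (fun x y => P x y /\ ~ P' x y) by [].
have U P P' : region P `|` region P' = region (fun x y => P x y \/ P' x y) by [].
rewrite !I !D region_shift !U !I !D region_shift U; congr region.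
by apply/funext => x; apply/funext => y; rewrite /folded_cell /stacked_cell !subr0 !opprK.
Qed.

Definition cut_lines : set V := [set z | fx z = 0 \/ fy z = 0 \/ fy z = 1 / 2 \/ fx z + fy z = 0 \/
  fx z + fy z = - (1 / 2)].

Lemma null_cut_lines : lebesgue_null cut_lines.
Proof.
have n10 : ((1 : R), (0 : R)) != (0, 0) by apply: pair_neq0; left; exact: oner_neq0.
have n01 : ((0 : R), (1 : R)) != (0, 0) by apply: pair_neq0; right; exact: oner_neq0.
have n11 : ((1 : R), (1 : R)) != (0, 0) by apply: pair_neq0; left; exact: oner_neq0.
apply: nullS (nullU (null_frame_line p uw 0 n10) (nullU (null_frame_line p uw 0 n01)
  (nullU (null_frame_line p uw (- (1 / 2)) n01) (nullU (null_frame_line p uw 0 n11)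
   (null_frame_line p uw (1 / 2) n11))))).
by move=> z [h|[h|[h|[h|h]]]]; [left|right; left|right; right; left|right; right; right; left|right; right; right; right];
  rewrite /=; lra.
Qed.

(* The corner [x + y <= 1/2] is turned about the vertex [p] or folded over the side
   [x = 0]; [j] is the corresponding vertical shift of the cut parallelogram. *)
Definition corner_move F (j : int) :=
  (F = (fun o => (- o.1, - o.2)) /\ j = -1) \/ (F = (fun o => (- o.1, o.1 + o.2)) /\ j = 0).

(** The excluded lines are those where open and closed inequalities differ. The part of
    [stacked_cell] beyond the hypotenuse, once shifted, is the displaced corner of the triangle. *)
Lemma cut_folded F j x y : corner_move F j -> x <> 0 -> y <> 0 -> y <> 1 / 2 -> x + y <> 0 ->
  x + y <> - (1 / 2) -> cut_cell F x y <-> folded_cell (j%:~R / 2) x y.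
Proof.
move=> Fj nx ny ny2 ns ns2.
have lt (k l : R) : k <= l -> k <> l -> k < l by move=> h /eqP h'; rewrite lt_neqAle h' h.
have left_part : in_tri x y /\ ~ (x + y <= 1 / 2) <-> stacked_cell x y /\ ~ (1 < x + y).
  split.
    move=> [[x0 y0 xy] /negP]; rewrite -ltNge => xy2.
    have x0' := lt _ _ x0 (nesym nx); have y0' := lt _ _ y0 (nesym ny).
    split; last by apply/negP; rewrite -leNgt.
    have [y1|y1] := ltP y (1 / 2).
      left; split; last by apply/negP; rewrite -ltNge.
      by split; apply/andP; split; lra.
    by right; split; [split; apply/andP; split; lra|lra].
  move=> [[[[/andP[x0 x1] /andP[y0 y1]] /negP]|[[/andP[x0 x1] /andP[y0 y1]] xy2]] /negP]; rewrite -?leNgt -?ltNge => h1.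
    move=> h2; split; first by split; lra.
    by apply/negP; rewrite -ltNge; lra.
  split; first by split=> //; lra.
  apply/negP; rewrite -ltNge; have := lt _ _ x0 (nesym nx); lra.
suff right_part : in_tri (F (x, y)).1 (F (x, y)).2 /\ (F (x, y)).1 + (F (x, y)).2 <= 1 / 2 <->
    stacked_cell (x + 1) (y - j%:~R / 2) /\ 1 < (x + 1) + (y - j%:~R / 2).
  by rewrite /cut_cell /folded_cell left_part right_part.
case: Fj => [[-> ->]|[-> ->]] /=.
  rewrite mulrN1z; split.
    move=> [[x0 y0 _] xy]; have x0' := lt _ _ x0 (ltac:(lra)); have y0' := lt _ _ y0 (ltac:(lra)).
    have xy' := lt (- (1 / 2)) (x + y) (ltac:(lra)) (nesym ns2).
    split; last lra.
    left; split; first by split; apply/andP; split; lra.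
    by apply/negP; rewrite -ltNge; lra.
  move=> [[[[/andP[x0 x1] /andP[y0 y1]] _]|[_ xy2]] xy]; last by exfalso; lra.
  by split; [split; lra|lra].
rewrite mulr0z mul0r subr0; split.
  move=> [[x0 y0 _] xy]; have x0' := lt _ _ x0 (ltac:(lra)).
  have xy' := lt 0 (x + y) (ltac:(lra)) (nesym ns).
  have y1' := lt y (1 / 2) (ltac:(lra)) ny2.
  split; last lra.
  left; split; first by split; apply/andP; split; lra.
  by apply/negP; rewrite -ltNge; lra.
move=> [[[[/andP[x0 x1] /andP[y0 y1]] _]|[_ xy2]] xy]; last by exfalso; lra.
by split; [split; lra|lra].
Qed.

(** One set, two descriptions: as a triangle with a corner moved by an element of [G] it tiles under
    [G], as a rearranged parallelogram it tiles under the lattice of [u] and [w / 2]. The cut corner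
    is [x + y <= 1/2], hence the condition on the coordinates of [0]. *)
Lemma cut_corner G F (j k l : int) : affine_group G -> tile G (tri p u w) -> moves p u w G F ->
  corner_move F j -> (k, l) != (0, 0) ->
  G (fun z => z + (k%:~R *: u + l%:~R *: w)) -> interior (tri p u w) 0 -> 1 / 2 < fx 0 + fy 0 ->
  common_tile G.
Proof.
move=> aG tG [g Gg gF] Fj kl Gc i0 h0.
have FF o : F (F o) = o.
  by case: Fj => [[-> _]|[-> _]]; case: o => s t /=; rewrite opprK; congr pair; ring.
have t1 := tile_move (region (fun x y => x + y <= 1 / 2)) aG tG Gg.
have KE : (tri p u w `\` region (fun x y => x + y <= 1 / 2)) `|`
    g @` (tri p u w `&` region (fun x y => x + y <= 1 / 2)) = region (cut_cell F).
  have -> : tri p u w `&` region (fun x y => x + y <= 1 / 2) =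
    region (fun x y => in_tri x y /\ x + y <= 1 / 2) by [].
  by rewrite (region_acts _ gF FF).
rewrite KE in t1.
exists u, ((1 / 2) *: w), (region (cut_cell F)), (k%:~R *: u + l%:~R *: w); split; split=> //.
- exact: half_neq0.
- rewrite -KE; have mU : lebesgue_measurable (region (fun x y => x + y <= 1 / 2)).
    by have := region_halfplane 1 1 (1 / 2); congr lebesgue_measurable; apply/funext => z; rewrite /region /= !mul1r.
  by apply: lmeasU; [apply: lmeasD|apply: lmeas_affine (aG.2 g Gg) _; apply: lmeasI]; rewrite //; exact: tri_measurable.
- have : interior (tri p u w `&` region (fun x y => (-1) * x + (-1) * y < - (1 / 2))) 0.
    by rewrite interiorI; split=> //; apply: region_open; lra.
  apply: interiorS => z [Tz]; rewrite /region /= => h; left; split=> //.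
  by apply/negP; rewrite -ltNge; lra.
- have [B HB] := region_bounded 1; exists B => z; rewrite /region /= => Kz; apply: HB.
    by case: Kz => [[[x0 y0 xy] _]|]; [|case: Fj => [[-> _]|[-> _]] /= [[x0 y0 xy] xy2]]; rewrite ler_norml; apply/andP; split; lra.
  by case: Kz => [[[x0 y0 xy] _]|]; [|case: Fj => [[-> _]|[-> _]] /= [[x0 y0 xy] xy2]]; rewrite ler_norml; apply/andP; split; lra.
- apply: tile_ae (lat_group _ _) (lat_countable _ _) (folded_tile j) _ _.
    apply: nullS null_cut_lines => z [Fz nKz]; apply: contrapT => nz; apply: nKz.
    by apply/(cut_folded Fj) => // e; apply: nz; rewrite /cut_lines /=; tauto.
  apply: nullS null_cut_lines => z [Kz nFz]; apply: contrapT => nz; apply: nFz.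
  by apply/(cut_folded Fj) => // e; apply: nz; rewrite /cut_lines /=; tauto.
- apply: contra_neq kl => c0.
  have e : pt k%:~R l%:~R = pt 0 0.
    by rewrite /frame_pt -!addrA c0 !scale0r !addr0.
  have := congr1 fx e; have := congr1 fy e; rewrite !fxpt // !fypt // => /eqP; rewrite intr_eq0 => /eqP ->.
  by move=> /eqP; rewrite intr_eq0 => /eqP ->.
- exists k, (2 * l); congr (_ + _); rewrite scalerA; congr (_ *: _).
  by rewrite intrM; field.
Qed.

End frame.
End common_tiles.

(** * Common tiles shape by shape *)

Section shapes.
Context {R : realType}.
Local Notation V := 'cV[R]_2.
Implicit Types (u v w z n a b c d p q : V) (X Y K C : set V) (x y s t : R) (f g : V -> V)
  (G : set (V -> V)) (F : R * R -> R * R).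

Section frame.
Variables (p u w : V).
Hypothesis uw : cr u w != 0.
Local Notation fx := (coordx p u w).
Local Notation fy := (coordy p u w).
Local Notation pt := (frame_pt p u w).
Local Notation G := (affine_weyl_group (tri p u w)).

Lemma swap_frame z : coordx p w u z = fy z /\ coordy p w u z = fx z.
Proof.
have wu : cr w u != 0 by rewrite (_ : cr w u = - cr u w) ?oppr_eq0 // /cr; ring.
have zE : pt (fx z) (fy z) = frame_pt p w u (fy z) (fx z) by rewrite /frame_pt addrAC.
by rewrite -{1 3}(ptK p z uw) zE fxpt // fypt.
Qed.

Lemma tri_swap : tri p w u = tri p u w.
Proof.
by apply/seteqP; split=> z; have [h1 h2] := swap_frame z; move=> [k1 k2 k3]; split;
  move: k1 k2 k3; rewrite ?h1 ?h2 // addrC.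
Qed.

Lemma cr_swap : cr w u != 0.
Proof. by rewrite (_ : cr w u = - cr u w) ?oppr_eq0 // /cr; ring. Qed.

Lemma cr_flip : cr (- u) (w - u) != 0.
Proof. by rewrite (_ : cr (- u) _ = - cr u w) ?oppr_eq0 // /cr !pE; ring. Qed.

(** The same triangle seen from the vertex [p + u], in barycentric coordinates, so that the corner
    to be cut can be chosen. *)
Lemma flip_frame z : coordx (p + u) (- u) (w - u) z = 1 - fx z - fy z /\
  coordy (p + u) (- u) (w - u) z = fy z.
Proof.
have zE : pt (fx z) (fy z) = frame_pt (p + u) (- u) (w - u) (1 - fx z - fy z) (fy z).
  by rewrite /frame_pt; apply: plane_ext; rewrite !pE; ring.
by rewrite -{1 4}(ptK p z uw) zE fxpt ?fypt //; exact: cr_flip.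
Qed.

Lemma tri_flip : tri (p + u) (- u) (w - u) = tri p u w.
Proof.
by apply/seteqP; split=> z; have [h1 h2] := flip_frame z; move=> [k1 k2 k3]; split;
  move: k1 k2 k3; rewrite ?h1 ?h2 => *; lra.
Qed.

Lemma moves_swap H F : moves p u w H F ->
  moves p w u H (fun o => ((F (o.2, o.1)).2, (F (o.2, o.1)).1)).
Proof.
move=> [g Hg gF]; exists g => // z; have [-> ->] := swap_frame (g z).
by have [-> ->] := swap_frame z; have [-> ->] := gF z.
Qed.

Lemma moves_flip H F : moves p u w H F ->
  moves (p + u) (- u) (w - u) H
    (fun o => let o' := F (1 - o.1 - o.2, o.2) in (1 - o'.1 - o'.2, o'.2)).
Proof.
move=> [g Hg gF]; exists g => // z; have [-> ->] := flip_frame (g z).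
have [-> ->] := flip_frame z; have [-> ->] := gF z; rewrite /=.
by have -> : 1 - (1 - fx z - fy z) - fy z = fx z by ring.
Qed.

Lemma acts_moves F1 F2 F3 : acts p u w (mirror p u) F1 -> acts p u w (mirror p w) F2 ->
  acts p u w (mirror (p + u) (w - u)) F3 ->
  [/\ moves p u w G F1, moves p u w G F2 & moves p u w G F3].
Proof.
have H f : reflections (tri p u w) f -> G f by move=> h; apply: sub_generated.
move=> h1 h2 h3; split; [exists (mirror p u)|exists (mirror p w)|exists (mirror (p + u) (w - u))] => //;
  by apply: H; rewrite tri_reflections //=; tauto.
Qed.

Lemma acts_invariant (T : Type) (inv : R -> R -> T) F1 F2 F3 :
  acts p u w (mirror p u) F1 -> acts p u w (mirror p w) F2 ->
  acts p u w (mirror (p + u) (w - u)) F3 ->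
  (forall s t, [/\ inv (F1 (s, t)).1 (F1 (s, t)).2 = inv s t, inv (F2 (s, t)).1 (F2 (s, t)).2 = inv s t &
    inv (F3 (s, t)).1 (F3 (s, t)).2 = inv s t]) ->
  forall f, reflections (tri p u w) f -> forall z, inv (fx (f z)) (fy (f z)) = inv (fx z) (fy z).
Proof.
move=> h1 h2 h3 I f; rewrite tri_reflections //= => -[->|[->|->]] z; have [i1 i2 i3] := I (fx z) (fy z).
- by have [-> ->] := h1 z.
- by have [-> ->] := h2 z.
- by have [-> ->] := h3 z.
Qed.

Let U_neq0 : dotcv u u != 0.
Proof. by have [u0 _] := uw_neq0 uw; exact: dot_self_neq0. Qed.

Let O1 o : same_orbit p u w G o o. Proof. exact: same_orbit_refl (weyl_affine _). Qed.
Let O2 o o' : same_orbit p u w G o o' -> same_orbit p u w G o' o.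
Proof. exact: same_orbit_sym (weyl_affine _). Qed.
Let O3 (o1 o2 o3 : R * R) : same_orbit p u w G o1 o2 -> same_orbit p u w G o2 o3 -> same_orbit p u w G o1 o3.
Proof. exact: same_orbit_trans (weyl_affine _). Qed.

Section equilateral.
Hypotheses (hW : dotcv w w = dotcv u u) (hD : dotcv u w = dotcv u u / 2).

Lemma equilateral_acts : [/\ acts p u w (mirror p u) (fun o => (o.1 + o.2, - o.2)),
  acts p u w (mirror p w) (fun o => (- o.1, o.1 + o.2)) &
  acts p u w (mirror (p + u) (w - u)) (fun o => (1 - o.2, 1 - o.1))].
Proof.
have [v0 v1 v2] := frame_vertices p u w; have [d1 d2 d3] := frame_dirs u w.
by split; [apply: (mirror_acts uw v0 d1)|apply: (mirror_acts uw v0 d2)|apply: (mirror_acts uw v1 d3)];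
  move=> s t c; rewrite /c hW hD /=; move: U_neq0; move: (dotcv u u) => U U0; congr pair; field;
  apply: contra_neq U0 => e; lra.
Qed.

Lemma equilateral_tile : tile G (tri p u w).
Proof.
have [a1 a2 a3] := equilateral_acts; have [m1 m2 m3] := acts_moves a1 a2 a3.
apply: (tri_tile uw (acts_invariant (inv := @alcove_count R) a1 a2 a3 _) (@alcove_count_inj R)).
  by move=> s t /=; split; [exact: alcove_count_sy|exact: alcove_count_sx|exact: alcove_count_h].
apply: (fold_equilateral O1 O2 O3) => x y.
- exact: (moves_orbit uw x y m2).
- exact: (moves_orbit uw x y m1).
- exact: (moves_orbit uw x y m3).
Qed.

(** At an angle [pi / 3] the mirrors generate rotations by multiples of [2 pi / 3] only, so no
    half-turn about a vertex is available and the corner is folded over a side. *)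
Lemma equilateral_corner : interior (tri p u w) 0 -> 1 / 2 < fx 0 + fy 0 -> common_tile G.
Proof.
have [a1 a2 a3] := equilateral_acts; have [m1 m2 m3] := acts_moves a1 a2 a3.
have aG := weyl_affine (tri p u w).
apply: (@cut_corner _ p u w uw G (fun o => (- o.1, o.1 + o.2)) 0 1 1) => //.
- exact: equilateral_tile.
- by right.
- apply: (moves_translation uw).
  apply: moves_eq (moves_comp aG m3 (moves_comp aG m2 (moves_comp aG m1 m2))) _ => s t /=.
  by rewrite mulr1z; congr pair; ring.
Qed.

End equilateral.

Section right_isosceles.
Hypotheses (hW : dotcv w w = dotcv u u) (hD : dotcv u w = 0).

Lemma right_isosceles_acts : [/\ acts p u w (mirror p u) (fun o => (o.1, - o.2)),
  acts p u w (mirror p w) (fun o => (- o.1, o.2)) &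
  acts p u w (mirror (p + u) (w - u)) (fun o => (1 - o.2, 1 - o.1))].
Proof.
have [v0 v1 v2] := frame_vertices p u w; have [d1 d2 d3] := frame_dirs u w.
by split; [apply: (mirror_acts uw v0 d1)|apply: (mirror_acts uw v0 d2)|apply: (mirror_acts uw v1 d3)];
  move=> s t c; rewrite /c hW hD /=; move: U_neq0; move: (dotcv u u) => U U0; congr pair; field;
  apply: contra_neq U0 => e; lra.
Qed.

(** Difference and product of two cosines determine the square of their sum, and the sum is positive
    when [x + y < 1]; so both cosines are determined. *)
Lemma cos_pair_inj x y x' y' : 0 < x -> 0 < y -> x + y < 1 -> 0 < x' -> 0 < y' -> x' + y' < 1 ->
  (cos (pi * x) - cos (pi * y), cos (pi * x) * cos (pi * y)) =
  (cos (pi * x') - cos (pi * y'), cos (pi * x') * cos (pi * y')) -> x = x' /\ y = y'.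
Proof.
have p0 := pi_gt0 R.
have pos s t : 0 < s -> 0 < t -> s + t < 1 -> 0 < cos (pi * s) + cos (pi * t).
  move=> s0 t0 st; have -> : cos (pi * t) = - cos (pi * (1 - t)).
    by rewrite mulrBr mulr1 addrC cosDpi cosN opprK.
  have I (k : R) : 0 <= k <= 1 -> pi * k \in `[0, pi].
    by move=> /andP[k0 k1]; rewrite in_itv /=; apply/andP; split; [exact: (mulr_ge0 (ltW p0) k0)|rewrite ler_piMr // ltW].
  by rewrite subr_gt0 ltr_cos ?I ?ltr_pM2l //; try (apply/andP; split); lra.
move=> x0 y0 xy x0' y0' xy' [].
have hS := pos _ _ x0 y0 xy; have hS' := pos _ _ x0' y0' xy'.
have inj k l : 0 < k -> k < 1 -> 0 < l -> l < 1 -> cos (pi * k) = cos (pi * l) -> k = l.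
  by move=> k0 k1 l0 l1; apply: cos_pi_inj; apply/andP; split; exact: ltW.
move=> e1 e2.
have e3 : cos (pi * x) + cos (pi * y) = cos (pi * x') + cos (pi * y').
  apply/eqP; rewrite -(eqrXn2 (ltn0Sn 1) (ltW hS) (ltW hS')); apply/eqP.
  transitivity ((cos (pi * x) - cos (pi * y)) ^+ 2 + 4 * (cos (pi * x) * cos (pi * y))); first by ring.
  by rewrite e1 e2; ring.
by split; apply: inj; lra.
Qed.

Lemma right_isosceles_tile : tile G (tri p u w).
Proof.
have [a1 a2 a3] := right_isosceles_acts; have [m1 m2 m3] := acts_moves a1 a2 a3.
apply: (tri_tile uw (acts_invariant (inv := fun x y =>
  (cos (pi * x) - cos (pi * y), cos (pi * x) * cos (pi * y))) a1 a2 a3 _) cos_pair_inj).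
  move=> s t /=; rewrite !mulrN !cosN; split=> //.
  have h (k : R) : cos (pi * (1 - k)) = - cos (pi * k).
    by rewrite mulrBr mulr1 addrC cosDpi cosN.
  by rewrite !h; congr pair; ring.
apply: (fold_right_isosceles O1 O2 O3) => x y.
- exact: (moves_orbit uw x y m2).
- exact: (moves_orbit uw x y m1).
- exact: (moves_orbit uw x y m3).
Qed.

(** The angles [pi / 2] at [p] and [pi / 4] at [p + u] both yield half-turns in the group, so the
    corner can be turned at whichever of the two is away from [0]. *)
Lemma right_isosceles_common : interior (tri p u w) 0 -> common_tile G.
Proof.
have [a1 a2 a3] := right_isosceles_acts; have [m1 m2 m3] := acts_moves a1 a2 a3.
have aG := weyl_affine (tri p u w) => i0.
have m4 : moves p u w G (fun o => (2 - o.1, o.2)).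
  apply: moves_eq (moves_comp aG m3 (moves_comp aG m1 m3)) _ => s t /=.
  by congr pair; ring.
have G2 : G (fun z => z + (2%:~R *: u + 0%:~R *: w)).
  apply: (moves_translation uw); apply: moves_eq (moves_comp aG m4 m2) _ => s t /=.
  by congr pair; rewrite ?mulr0z; ring.
have [x0 y0 xy] := tri_interior uw i0.
have [c|c] := ltP (1 / 2) (fx 0 + fy 0).
  apply: (@cut_corner _ p u w uw G (fun o => (- o.1, - o.2)) (-1) 2 0) => //.
  - exact: right_isosceles_tile.
  - by apply: moves_eq (moves_comp aG m2 m1) _.
  - by left.
apply: (@cut_corner _ (p + u) (- u) (w - u) cr_flip G (fun o => (- o.1, - o.2)) (-1) (-2) 0) => //.
- by rewrite tri_flip; exact: right_isosceles_tile.
- apply: moves_eq (moves_flip (moves_comp aG m4 m1)) _ => s t /=.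
  by congr pair; ring.
- by left.
- by move: G2; congr (G _); apply/funext => z; congr (_ + _); rewrite !mulr0z !scale0r !addr0 rmorphN /= scaleNr scalerN opprK.
- by rewrite tri_flip.
- by have [-> ->] := flip_frame 0; lra.
Qed.

End right_isosceles.

Section half_equilateral.
Hypotheses (hW : dotcv w w = 3 * dotcv u u) (hD : dotcv u w = 0).

Lemma half_equilateral_acts : [/\ acts p u w (mirror p u) (fun o => (o.1, - o.2)),
  acts p u w (mirror p w) (fun o => (- o.1, o.2)) &
  acts p u w (mirror (p + u) (w - u)) (fun o => ((3 - o.1 - 3 * o.2) / 2, (1 - o.1 + o.2) / 2))].
Proof.
have [v0 v1 v2] := frame_vertices p u w; have [d1 d2 d3] := frame_dirs u w.
by split; [apply: (mirror_acts uw v0 d1)|apply: (mirror_acts uw v0 d2)|apply: (mirror_acts uw v1 d3)];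
  move=> s t c; rewrite /c hW hD /=; move: U_neq0; move: (dotcv u u) => U U0; congr pair; field;
  apply: contra_neq U0 => e; lra.
Qed.

(* The triangle is half of an equilateral one, with vertices [p - u], [p + u], [p + w]; [count] is
   [alcove_count] in the frame of the latter. *)
Let count (x y : R) := alcove_count ((x + 1 - y) / 2) y.

(** The mirror [x -> - x] between the two halves exchanges the two counts, so their unordered pair
    is invariant. For injectivity, a match with the second count would force [x = - x'] between
    positive numbers. *)
Lemma half_equilateral_tile : tile G (tri p u w).
Proof.
have [a1 a2 a3] := half_equilateral_acts; have [m1 m2 m3] := acts_moves a1 a2 a3.
apply: (tri_tile uw (acts_invariant (inv := fun x y => [set count x y; count (- x) y]) a1 a2 a3 _)).
- have e (k l k' l' : R) : k = k' -> l = l' -> alcove_count k l = alcove_count k' l' by move=> -> ->.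
  move=> s t /=; split.
  + have sy x : count x (- t) = count x t.
      by rewrite /count -[RHS]alcove_count_sy; apply: e; field.
    by rewrite !sy.
  + by rewrite opprK setUC.
  + congr (_ `|` _); congr [set _].
      by rewrite /count -[RHS]alcove_count_h; apply: e; field.
    by rewrite /count -[RHS]alcove_count_sx; apply: e; field.
- move=> x y x' y' x0 y0 xy x0' y0' xy' e.
  have : [set count x' y'; count (- x') y'] (count x y) by rewrite -e; left.
  case=> h.
    have [h1 h2] : (x + 1 - y) / 2 = (x' + 1 - y') / 2 /\ y = y' by apply: alcove_count_inj h; lra.
    by split; lra.
  have [h1 h2] : (x + 1 - y) / 2 = (- x' + 1 - y') / 2 /\ y = y' by apply: alcove_count_inj h; lra.
  by exfalso; lra.
- apply: (fold_half_equilateral O1 O2 O3) => x y.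
  + exact: (moves_orbit uw x y m2).
  + exact: (moves_orbit uw x y m1).
  + exact: (moves_orbit uw x y m3).
Qed.

Lemma half_equilateral_moves : [/\ moves p u w G (fun o => (- o.1, - o.2)),
  moves p u w G (fun o => (- o.1, 2 - o.2)) & G (fun z => z + (0%:~R *: u + 2%:~R *: w))].
Proof.
have [a1 a2 a3] := half_equilateral_acts; have [m1 m2 m3] := acts_moves a1 a2 a3.
have aG := weyl_affine (tri p u w).
have m4 : moves p u w G (fun o => (- o.1, 2 - o.2)).
  (* The angle at [p + w] is [pi / 6]: the product of its two mirrors is a rotation by [pi / 3],
     whose cube is the half-turn about [p + w]. *)
  have m5 := moves_comp aG m2 m3.
  apply: moves_eq (moves_comp aG m5 (moves_comp aG m5 m5)) _ => s t /=.
  by congr pair; field.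
have m6 : moves p u w G (fun o => (- o.1, - o.2)) by apply: moves_eq (moves_comp aG m2 m1) _.
split=> //; apply: (moves_translation uw).
apply: moves_eq (moves_comp aG m4 m6) _ => s t /=.
by congr pair; rewrite ?mulr0z; ring.
Qed.

End half_equilateral.
End frame.

(** When [0] lies in the half-size corner at [p], its first coordinate is below [1/2], so it lies
    outside the corner at [p + u]. *)
Lemma equilateral_common p u w : cr u w != 0 -> dotcv w w = dotcv u u -> dotcv u w = dotcv u u / 2 ->
  interior (tri p u w) 0 -> common_tile (affine_weyl_group (tri p u w)).
Proof.
move=> uw hW hD i0; have [x0 y0 xy] := tri_interior uw i0.
have [c|c] := ltP (1 / 2) (coordx p u w 0 + coordy p u w 0); first exact: equilateral_corner.
rewrite -(tri_flip p uw); apply: equilateral_corner; rewrite ?(tri_flip p uw) //.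
- exact: cr_flip.
- by move: hW hD; rewrite !dotE !pE; lra.
- by move: hW hD; rewrite !dotE !pE; lra.
- by have [-> ->] := flip_frame p uw 0; lra.
Qed.

(** The choice is between [p] and [p + w], where the angles [pi / 2] and [pi / 6] provide
    half-turns; the angle [pi / 3] at [p + u] does not. *)
Lemma half_equilateral_common p u w : cr u w != 0 -> dotcv w w = 3 * dotcv u u -> dotcv u w = 0 ->
  interior (tri p u w) 0 -> common_tile (affine_weyl_group (tri p u w)).
Proof.
move=> uw hW hD i0; have [x0 y0 xy] := tri_interior uw i0.
have [m1 m2 t2] := half_equilateral_moves p uw hW hD.
have aG := weyl_affine (tri p u w).
have tG := half_equilateral_tile p uw hW hD.
have [c|c] := ltP (1 / 2) (coordx p u w 0 + coordy p u w 0).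
  by apply: (@cut_corner _ p u w uw _ (fun o => (- o.1, - o.2)) (-1) 0 2) => //; left.
have wu := cr_swap uw; have triE : tri (p + w) (- w) (u - w) = tri p u w by rewrite tri_flip // tri_swap.
apply: (@cut_corner _ (p + w) (- w) (u - w) (cr_flip wu) _ (fun o => (- o.1, - o.2)) (-1) (-2) 0) => //.
- by rewrite triE.
- apply: moves_eq (moves_flip wu (moves_swap uw m2)) _ => s t /=.
  by congr pair; ring.
- by left.
- move: t2; congr (affine_weyl_group _ _); apply/funext => z; congr (_ + _).
  by rewrite !mulr0z !scale0r addr0 add0r rmorphN /= scaleNr scalerN opprK.
- by rewrite triE.
- have [-> ->] := flip_frame p wu 0; have [-> ->] := swap_frame p uw 0; lra.
Qed.

Lemma box_common p u w : cr u w != 0 -> dotcv u w = 0 -> interior (quad p u w) 0 ->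
  tile (affine_weyl_group (quad p u w)) (quad p u w) /\ common_tile (affine_weyl_group (quad p u w)).
Proof.
move=> uw hD i0; have aG := weyl_affine (quad p u w).
have [v0 v1 v2] := frame_vertices p u w; have [d1 d2 _] := frame_dirs u w.
have [u0 [w0 _]] := uw_neq0 uw; have U0 := dot_self_neq0 u0; have W0 := dot_self_neq0 w0.
have a1 : acts p u w (mirror p u) (fun o => (o.1, - o.2)).
  apply: (mirror_acts uw v0 d1) => s t c; rewrite /c hD /=; move: U0; move: (dotcv u u) => U U0.
  by congr pair; field.
have a2 : acts p u w (mirror (p + w) u) (fun o => (o.1, 2 - o.2)).
  apply: (mirror_acts uw v2 d1) => s t c; rewrite /c hD /=; move: U0; move: (dotcv u u) => U U0.
  by congr pair; field.
have a3 : acts p u w (mirror p w) (fun o => (- o.1, o.2)).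
  apply: (mirror_acts uw v0 d2) => s t c; rewrite /c hD /=; move: W0; move: (dotcv w w) => U U0'.
  by congr pair; field.
have a4 : acts p u w (mirror (p + u) w) (fun o => (2 - o.1, o.2)).
  apply: (mirror_acts uw v1 d2) => s t c; rewrite /c hD /=; move: W0; move: (dotcv w w) => U U0'.
  by congr pair; field.
have H f F : reflections (quad p u w) f -> acts p u w f F -> moves p u w (affine_weyl_group (quad p u w)) F.
  by move=> h hF; exists f => //; apply: sub_generated.
have m1 : moves p u w (affine_weyl_group (quad p u w)) (fun o => (o.1, - o.2)).
  by apply: H a1; rewrite quad_reflections //=; tauto.
have m2 : moves p u w (affine_weyl_group (quad p u w)) (fun o => (o.1, 2 - o.2)).
  by apply: H a2; rewrite quad_reflections //=; tauto.
have m3 : moves p u w (affine_weyl_group (quad p u w)) (fun o => (- o.1, o.2)).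
  by apply: H a3; rewrite quad_reflections //=; tauto.
have m4 : moves p u w (affine_weyl_group (quad p u w)) (fun o => (2 - o.1, o.2)).
  by apply: H a4; rewrite quad_reflections //=; tauto.
have tG : tile (affine_weyl_group (quad p u w)) (quad p u w).
  apply: (quad_tile uw (inv := fun x y => (cos (pi * x), cos (pi * y)))).
  - move=> f; rewrite quad_reflections // => fE z.
    have c2 (k : R) : cos (pi * (2 - k)) = cos (pi * k).
      by rewrite mulrBr mulr_natr addrC cosD2pi cosN.
    case: fE => [->|[->|[->|->]]].
    + by have [-> ->] := a1 z; rewrite /= mulrN cosN.
    + by have [-> ->] := a2 z; rewrite /= c2.
    + by have [-> ->] := a3 z; rewrite /= mulrN cosN.
    + by have [-> ->] := a4 z; rewrite /= c2.
  - by move=> x y x' y' hx hy hx' hy' [e1 e2]; split; exact: cos_pi_inj.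
  - apply: (fold_square (fun o => same_orbit_refl p u w o aG) (fun o o' => same_orbit_sym aG)
      (fun o1 o2 o3 => same_orbit_trans aG)) => x y.
    + exact: (moves_orbit uw x y m3).
    + exact: (moves_orbit uw x y m4).
    + exact: (moves_orbit uw x y m1).
    + exact: (moves_orbit uw x y m2).
split=> //; exists u, w, (quad p u w), (2%:~R *: u + 0%:~R *: w); split; split=> //.
- exact: quad_measurable.
- have [B HB] := region_bounded p uw 1; exists B => z [/andP[x0 x1] /andP[y0 y1]].
  by apply: HB; rewrite ler_norml; apply/andP; split; lra.
- apply: tile_ae (lat_group _ _) (lat_countable _ _) (half_open_tile p uw) _ _.
    apply: nullS (null_set0 (R := R)) => z [[s [t [/andP[s0 s1] /andP[t0 t1] ->]]]]; apply.
    by split; rewrite ?(fxpt p s t uw) ?(fypt p s t uw); apply/andP; split=> //; exact: ltW.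
  have n10 : ((1 : R), (0 : R)) != (0, 0) by apply: pair_neq0; left; exact: oner_neq0.
  have n01 : ((0 : R), (1 : R)) != (0, 0) by apply: pair_neq0; right; exact: oner_neq0.
  apply: nullS (nullU (null_frame_line p uw (-1) n10) (null_frame_line p uw (-1) n01)) => z.
  move=> [[/andP[x0 x1] /andP[y0 y1]] h].
  have [e|e] := eqVneq (coordx p u w z) 1; first by left; rewrite /= e; lra.
  have [e'|e'] := eqVneq (coordy p u w z) 1; first by right; rewrite /= e'; lra.
  exfalso; apply: h; exists (coordx p u w z), (coordy p u w z); split; last by rewrite -{1}(ptK p z uw).
    by rewrite x0 lt_neqAle e.
  by rewrite y0 lt_neqAle e'.
- rewrite mulr0z scale0r addr0 scaler_eq0 (negbTE u0) orbF intr_eq0 //.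
- by exists 2, 0.
- apply: (moves_translation uw); apply: moves_eq (moves_comp aG m4 m3) _ => s t /=.
  by congr pair; rewrite ?mulr0z; ring.
Qed.

End shapes.

(** * The three kinds of triangle *)

Section classification.
Context {R : realType}.
Local Notation V := 'cV[R]_2.
Implicit Types (u v w z n a b c d p q : V) (X Y K C : set V) (x y s t : R).

Lemma cos_pi_third : cos (pi / 3) = 1 / 2 :> R.
Proof.
have p0 := pi_gt0 R; set x : R := pi / 3; set c := cos x.
have c0 : 0 < c by apply: cos_gt0_pihalf; rewrite /x; apply/andP; split; lra.
have e1 : cos (x + x) = - c.
  have -> : x + x = - x + pi by rewrite /x; field.
  by rewrite cosDpi cosN.
have e2 : cos (x + x) = 2 * c ^+ 2 - 1.
  by have := cos2Dsin2 x; rewrite cosD -/c => h; lra.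
have : (2 * c - 1) * (c + 1) = 0 by rewrite mulrDr mulr1 mulrBl mul1r -mulrA -expr2; lra.
move=> /eqP; rewrite mulf_eq0 (gt_eqF (_ : 0 < c + 1)) ?orbF; last by lra.
by move=> /eqP; lra.
Qed.

(** The equation says that the reciprocals add up to [1]. Hence the least number is at most [3];
    with [2] the middle one is at most [4], with [3] it is [3], and the last one follows. *)
Lemma coxeter_numbers (m0 m1 m2 : nat) : (1 < m0)%N -> (m0 <= m1)%N -> (m1 <= m2)%N ->
  (m1 * m2 + m0 * m2 + m0 * m1 = m0 * m1 * m2)%N ->
  [\/ [/\ m0 = 3, m1 = 3 & m2 = 3], [/\ m0 = 2, m1 = 4 & m2 = 4] | [/\ m0 = 2, m1 = 3 & m2 = 6]]%N.
Proof.
move=> h0 h01 h12 e.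
have m03 : (m0 <= 3)%N by nia.
have [e0|e0] : (m0 = 2 \/ m0 = 3)%N by lia.
  have m14 : (m1 <= 4)%N by nia.
  have [e1|[e1|e1]] : (m1 = 2 \/ m1 = 3 \/ m1 = 4)%N by lia.
  - by exfalso; nia.
  - by constructor 3; split=> //; nia.
  - by constructor 2; split=> //; nia.
have m13 : (m1 <= 3)%N by nia.
by constructor 1; split=> //; nia.
Qed.

Lemma angle_at_sym p q q' m : angle_at p q q' m -> angle_at p q' q m.
Proof. by move=> [h1 h2]; split=> //; rewrite dotcvC h2 (mulrC (enorm (q - p))). Qed.

Lemma triangle_swap01 C p0 p1 p2 m0 m1 m2 : triangle C p0 p1 p2 m0 m1 m2 ->
  triangle C p1 p0 p2 m1 m0 m2.
Proof.
move=> [uw -> a0 a1 a2]; split=> //; last exact: angle_at_sym.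
  apply: contra_neq uw => e; apply: oppr_inj; rewrite oppr0 -e.
  by rewrite /cr !pE; ring.
apply/seteqP; split=> z [i [j [k [i0 j0 k0 ijk ->]]]]; exists j, i, k; split=> //; rewrite ?(addrC j) //.
  by rewrite (addrC (j *: _)).
by rewrite (addrC (j *: _)).
Qed.

Lemma triangle_swap12 C p0 p1 p2 m0 m1 m2 : triangle C p0 p1 p2 m0 m1 m2 ->
  triangle C p0 p2 p1 m0 m2 m1.
Proof.
move=> [uw -> a0 a1 a2]; split=> //; last exact: angle_at_sym.
- apply: contra_neq uw => e; apply: oppr_inj; rewrite oppr0 -e.
  by rewrite /cr !pE; ring.
- by apply/seteqP; split=> z [i [j [k [i0 j0 k0 ijk ->]]]]; exists i, k, j; split=> //; rewrite addrAC.
Qed.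

Lemma triangle_sorted C p0 p1 p2 m0 m1 m2 : triangle C p0 p1 p2 m0 m1 m2 ->
  (m1 * m2 + m0 * m2 + m0 * m1 = m0 * m1 * m2)%N ->
  exists q0 q1 q2 (n0 n1 n2 : nat), triangle C q0 q1 q2 n0 n1 n2 /\
    [\/ [/\ n0 = 3, n1 = 3 & n2 = 3], [/\ n0 = 2, n1 = 4 & n2 = 4] | [/\ n0 = 2, n1 = 3 & n2 = 6]]%N.
Proof.
move=> T0 e; have [_ _ [h0 _] [h1 _] [h2 _]] := T0.
have T1 := triangle_swap01 T0; have T2 := triangle_swap12 T0.
have T12 := triangle_swap12 T1; have T21 := triangle_swap01 T2.
have T121 := triangle_swap01 T12.
have [c01|c01] := leqP m0 m1; have [c12|c12] := leqP m1 m2; have [c02|c02] := leqP m0 m2.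
- by exists p0, p1, p2, m0, m1, m2; split=> //; apply: coxeter_numbers.
- by exfalso; lia.
- by exists p0, p2, p1, m0, m2, m1; split=> //; apply: coxeter_numbers => //; lia.
- by exists p2, p0, p1, m2, m0, m1; split=> //; apply: coxeter_numbers => //; lia.
- by exists p1, p0, p2, m1, m0, m2; split=> //; apply: coxeter_numbers => //; lia.
- by exists p1, p2, p0, m1, m2, m0; split=> //; apply: coxeter_numbers => //; lia.
- by exfalso; lia.
- by exists p2, p1, p0, m2, m1, m0; split=> //; apply: coxeter_numbers => //; lia.
Qed.

(** From here on the triangle is known by its scalar products: the last three equations are the
    angles at the three vertices. *)
Lemma triangle_frame C p0 p1 p2 m0 m1 m2 : triangle C p0 p1 p2 m0 m1 m2 ->
  let u := p1 - p0 in let w := p2 - p0 in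
  [/\ cr u w != 0, C = tri p0 u w & exists a b c : R, [/\ 0 < a, 0 < b, 0 < c,
    [/\ dotcv u u = a ^+ 2, dotcv w w = b ^+ 2 & dotcv u u + dotcv w w - 2 * dotcv u w = c ^+ 2] &
    [/\ dotcv u w = a * b * cos (pi / m0%:R), dotcv u u - dotcv u w = a * c * cos (pi / m1%:R) &
        dotcv w w - dotcv u w = b * c * cos (pi / m2%:R)]]].
Proof.
move=> [uw CE [_ a0] [_ a1] [_ a2]] u w; split=> //; first by rewrite CE hull3_tri.
have [u0 [w0 wu0]] := uw_neq0 uw.
exists (enorm u), (enorm w), (enorm (w - u)); split; [exact: enorm_gt0|exact: enorm_gt0|exact: enorm_gt0| |].
  by rewrite !enorm_sqr; split=> //; rewrite !dotE !pE; ring.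
have e1 : enorm (p0 - p1) = enorm u by rewrite enormC.
have e2 : enorm (p0 - p2) = enorm w by rewrite enormC.
have wuE : w - u = p2 - p1 by rewrite /w /u; apply: plane_ext; rewrite !pE; ring.
have e3 : enorm (p1 - p2) = enorm (w - u) by rewrite enormC wuE.
split=> //.
  rewrite wuE -e1 -a1 /u /w !dotE !pE; ring.
rewrite -e2 -e3 -a2 /u /w !dotE !pE; ring.
Qed.

Lemma triangle_common C p0 p1 p2 m0 m1 m2 : triangle C p0 p1 p2 m0 m1 m2 ->
  [\/ [/\ m0 = 3, m1 = 3 & m2 = 3], [/\ m0 = 2, m1 = 4 & m2 = 4] | [/\ m0 = 2, m1 = 3 & m2 = 6]]%N ->
  interior C 0 -> [/\ lebesgue_measurable C, tile (affine_weyl_group C) C & common_tile (affine_weyl_group C)].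
Proof.
move=> /triangle_frame []; move: (p1 - p0) (p2 - p0) => u w uw -> [a [b [c [a0 b0 c0 [hU hW hC] [h0 h1 h2]]]]] m i0.
have mC := tri_measurable p0 uw.
have cancel_mul (k l l' : R) : 0 < k -> k * l = k * l' -> l = l' by move=> k0; apply: mulfI; rewrite gt_eqF.
case: m => -[e0 e1 e2]; move: h0 h1 h2; rewrite e0 e1 e2 ?cos_pi_third ?cos_pihalf => h0 h1 h2.
- have k1 : 2 * a - b = c by apply: (cancel_mul a) => //; lra.
  have k2 : 2 * b - a = c by apply: (cancel_mul b) => //; lra.
  have ab : a = b by lra.
  have sW : dotcv w w = dotcv u u by rewrite hU hW ab.
  have sD : dotcv u w = dotcv u u / 2 by rewrite h0 hU ab; lra.
  by split=> //; [exact: equilateral_tile|exact: equilateral_common].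
- have D0 : dotcv u w = 0 by rewrite h0 mulr0.
  have k1 : a = c * cos (pi / 4%:R) by apply: (cancel_mul a) => //; lra.
  have k2 : b = c * cos (pi / 4%:R) by apply: (cancel_mul b) => //; lra.
  have sW : dotcv w w = dotcv u u by rewrite hU hW k1 k2.
  by split=> //; [exact: right_isosceles_tile|exact: right_isosceles_common].
- have D0 : dotcv u w = 0 by rewrite h0 mulr0.
  have k1 : 2 * a = c by apply: (cancel_mul a) => //; lra.
  have sW : dotcv w w = 3 * dotcv u u by rewrite -k1 in hC; lra.
  by split=> //; [exact: half_equilateral_tile|exact: half_equilateral_common].
Qed.

End classification.

(** * The three-way tiling set *)

Section final.
Context {R : realType}.
Local Notation V := 'cV[R]_2.

Lemma foldable_common (C : set V) : foldable C -> interior C 0 ->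
  [/\ lebesgue_measurable C, tile (affine_weyl_group C) C & common_tile (affine_weyl_group C)].
Proof.
move=> hC i0; have [S [r fo]] := foldable_folding hC.
have [L L0 CL] := folding_polygon fo i0.
have [[p [u [w [uw0 uw CE]]]]|[p0 [p1 [p2 [m0 [m1 [m2 [tC e]]]]]]]] := folding_shape fo i0 L0 CL.
  have CQ : C = quad p u w by rewrite CE box_quad.
  rewrite CQ in i0 *; have [h1 h2] := box_common uw uw0 i0; split=> //.
  exact: quad_measurable.
have [q0 [q1 [q2 [n0 [n1 [n2 [tC' n]]]]]]] := triangle_sorted tC e.
exact: triangle_common tC' n i0.
Qed.

Lemma parallelepiped_tile (B : 'M[R]_2) (Gamma : set V) : lattice_basis B Gamma ->
  [/\ affine_group (translations Gamma), tile (translations Gamma) (parallelepiped B) &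
      lebesgue_measurable (parallelepiped B)].
Proof.
move=> /lattice_cols [u [w [uw -> BE]]].
have BE' : parallelepiped B = [set x | exists s t : R, [/\ 0 <= s < 1, 0 <= t < 1 & x = 0 + s *: u + t *: w]].
  by rewrite BE; apply/seteqP; split=> x [s [t [hs ht ->]]]; exists s, t; rewrite add0r.
split; first exact: lat_group.
  by rewrite BE'; exact: (half_open_tile 0 uw).
have -> : parallelepiped B = (region 0 u w (fun x y => (-1) * x + 0 * y <= 0) `\` region 0 u w (fun x y => (-1) * x + 0 * y <= -1))
   `&` (region 0 u w (fun x y => 0 * x + (-1) * y <= 0) `\` region 0 u w (fun x y => 0 * x + (-1) * y <= -1)).
  rewrite BE'; apply/seteqP; split=> z.
    move=> [s [t [/andP[s0 s1] /andP[t0 t1] zE]]].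
    have -> : z = frame_pt 0 u w s t by [].
    rewrite /region; split; split; rewrite /= ?fxpt ?fypt //; try lra; apply/negP; rewrite -ltNge; lra.
  rewrite /region /= => -[[h1 /negP]]; rewrite -ltNge => h2 [h3 /negP]; rewrite -ltNge => h4.
  exists (coordx 0 u w z), (coordy 0 u w z); split; last by rewrite -{1}(ptK 0 z uw).
    by apply/andP; split; lra.
  by apply/andP; split; lra.
by apply: lmeasI; apply: lmeasD; exact: region_halfplane.
Qed.

Lemma translation_muln (G : set (V -> V)) (c : V) : affine_group G -> G (fun z => z + c) ->
  forall n : nat, G (fun z => z + c *+ n).
Proof.
move=> aG Gc; elim=> [|n IH].
  by have -> : (fun z : V => z + c *+ 0) = id; [apply/funext => z; rewrite addr0|case: aG => -[]].
have -> : (fun z : V => z + c *+ n.+1) = (fun z => z + c *+ n) \o (fun z => z + c).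
  by apply/funext => z /=; rewrite mulrS addrA.
exact: agroup_comp.
Qed.

End final.

Theorem theorem2p2 (R : realType) (A : 'M[R]_2) (C : set 'cV[R]_2)
    (hA : expansive A) (hC : foldable C) (hC0 : interior C 0) :
  exists Gamma W : set 'cV[R]_2,
    full_rank_lattice Gamma /\
    lebesgue_measurable W /\
    (measurable_tiling (translations Gamma) W /\
     measurable_tiling (affine_weyl_group C) W /\
     measurable_tiling (dilations A) W) /\
    dilation_translation_wavelet_set A Gamma W /\
    dilation_reflection_wavelet_set A C W /\
    allowable C Gamma A.
Proof.
have [mC tC [u [w [K [c [[uw mK iK [M KM]] [tK tK' c0 lc Gc]]]]]]] := foldable_common hC hC0.
have [Au [m [nm [D [hn D0 nmD Dnm]]]]] := expansive_norm hA.
have aW := weyl_affine C; have aL := lat_group u w; have aD := dilations_group Au.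
have [e e0 eK] := (nbhs_enormP 0 K).1 iK.
have Lc : translations (lat u w) (fun z => z + c) by exists c.
have [W [mW tW1 tW2 tW3]] : exists W, [/\ lebesgue_measurable W, tile (affine_weyl_group C) W,
    tile (translations (lat u w)) W & tile (dilations A) W].
  (* [D] compares the norm expanded by [A] with the sum of the absolute values of the coordinates.
     On [K] each of these is at most [M], hence the bound [D * (M + M)]; the ball of radius [e] in
     [K] yields the radius [e / D]. *)
  apply: (three_way_tile Au hn (K := K) (M := D * (M + M)) (e := e / D) mK _ _ _ aW aL tK tK' c0
    (translation_muln aW Gc) (translation_muln aL Lc)).
  - move=> x /KM xM; apply: le_trans (nmD x) _; rewrite ler_pM2l //.
    by apply: lerD; [apply: le_trans (enorm_px x) xM|apply: le_trans (enorm_py x) xM].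
  - by rewrite divr_gt0.
  - move=> x; rewrite ltr_pdivlMr // mulrC => h; apply: eK; rewrite subr0.
    by apply: le_lt_trans (enorm_le1 x) _; apply: le_lt_trans (Dnm x) h.
have T1 := tile_tiling aW tW1; have T2 := tile_tiling aL tW2; have T3 := tile_tiling aD tW3.
(* Two measurable tiles of one group are congruent, and [C] is itself a tile of its Weyl group. *)
have cW := tile_congruent aW tW1 tC mW mC.
exists (lat u w), W; split.
  by have [B HB] := lattice_of_cols uw; exists B.
split=> //; split=> //; split; first by split.
split; first by split.
exists W; split=> // B /parallelepiped_tile [_ tB mB].
exact: tile_congruent aL tW2 tB mW mB.
Qed.
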